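(* Let $C\subset\mathbb{R}^{n+1}$ be an unbounded convex body, different from a half-space, such that any asymptotic cylinder of $C$ is either a half-space or $\mathbb{R}^{n+1}$. Then $C$ is of uniform geometry and any generalized isoperimetric region must lie in $C$, for any given volume; that is, for every $v>0$, if $K\in\{C\}\cup\mathcal{K}(C)$ and $E\subset K$ satisfy $|E|=v$ and $P_K(E)=I_C(v)$, then $K=C$.
   Context: Here $n\ge 1$. A convex body is a closed convex subset of $\mathbb{R}^{n+1}$ with non-empty interior. $|E|$ is Lebesgue measure. For measurable $E\subset C$ the relative perimeter is $P_C(E)=\sup\{\int_E \mathrm{div}\,\xi\,dx:\ \xi$ a smooth vector field with compact support in $\mathrm{int}(C)$, $|\xi|\le 1\}$; the isoperimetric profile is $I_C(v)=\inf\{P_C(E): E\subset C\text{ measurable},|E|=v\}$. $C$ is of uniform geometry if it is unbounded and there is $r_0>0$ with $\inf_{x\in C}|C\cap\overline{B}(x,r_0)|>0$. A sequence $C_i$ of closed convex sets converges locally in Hausdorff distance to a closed convex set $K$ if, for every open ball $B$ with $K\cap B\ne\emptyset$, $C_i\cap\overline{B}$ converges to $K\cap\overline{B}$ in Hausdorff distance. $\mathcal{K}(C)$ is the set of asymptotic cylinders of $C$: all local Hausdorff limits of sequences $-x_i+C$ with $x_i\in C$, $|x_i|\to\infty$. For a convex body of uniform geometry, a generalized isoperimetric region of volume $v$ amounts to a set $E\subset K$, $K\in\{C\}\cup\mathcal{K}(C)$, with $|E|=v$ and $P_K(E)=I_C(v)$; at least one always exists. *)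

(* Defs.v *)
From HB Require Import structures.
From mathcomp Require Import all_boot all_order all_algebra.
From mathcomp Require Import all_classical all_reals all_analysis.

Set Implicit Arguments.
Unset Strict Implicit.
Unset Printing Implicit Defensive.

Import Order.TTheory GRing.Theory Num.Theory.
Import numFieldNormedType.Exports.

Local Open Scope classical_set_scope.
Local Open Scope ring_scope.

(* R^(n+1) is 'rV[R]_n.+1. Its library norm `|x| is the sup norm: topology,   *)
(* boundedness, differentiability and compactness are insensitive to this,    *)
(* but every metric notion below goes through the Euclidean norm enorm.       *)
Section Euclidean.
Variables (R : realType) (n : nat).
Implicit Types (x y a : 'rV[R]_n.+1) (A B K : set 'rV[R]_n.+1).

Definition dotp x y : R := \sum_(i < n.+1) x 0 i * y 0 i.

Definition enorm x : R := Num.sqrt (dotp x x).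

Definition eball x (r : R) : set 'rV[R]_n.+1 := [set y | enorm (y - x) < r].

Definition eclosed_ball x (r : R) : set 'rV[R]_n.+1 :=
  [set y | enorm (y - x) <= r].

Definition half_space A : Prop :=
  exists a (b : R), a != 0 /\ A = [set x | dotp a x <= b].

Definition convex_body A : Prop := [/\ closed A, convex_set A & A° !=set0].

Definition translate x A : set 'rV[R]_n.+1 := [set x + y | y in A].

Definition neighborhood A (r : R) : set 'rV[R]_n.+1 :=
  [set x | exists2 y, A y & enorm (x - y) <= r].

(* Equal to +oo when exactly one of A and B is empty. *)
Definition hausdorff_dist A B : \bar R :=
  ereal_inf [set r%:E | r in [set r : R |
    [/\ 0 <= r, A `<=` neighborhood B r & B `<=` neighborhood A r]]].

Definition local_hausdorff_cvg (A_ : nat -> set 'rV[R]_n.+1) K : Prop :=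
  forall c (r : R), K `&` eball c r !=set0 ->
    hausdorff_dist (A_ i `&` eclosed_ball c r) (K `&` eclosed_ball c r)
      @[i --> \oo] --> 0%E.

(* K is required to be non-empty: the empty set would otherwise vacuously be  *)
(* a local limit of every sequence.                                           *)
Definition asymptotic_cylinder (C K : set 'rV[R]_n.+1) : Prop :=
  [/\ closed K, convex_set K, K !=set0 &
    exists x_ : nat -> 'rV[R]_n.+1,
      [/\ forall i, C (x_ i),
          enorm (x_ i) @[i --> \oo] --> +oo &
          local_hausdorff_cvg (fun i => translate (- x_ i) C) K]].

End Euclidean.

(* Lebesgue measure on R^(n+1): the outer measure given by countable covers   *)
(* by half-open boxes ]a, b], restricted to its Caratheodory-measurable sets. *)
Section Lebesgue.
Variables (R : realType) (n : nat).
Implicit Types (A : set 'rV[R]_n.+1) (p : 'rV[R]_n.+1 * 'rV[R]_n.+1).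

Definition box p : set 'rV[R]_n.+1 :=
  [set x | forall i, p.1 0 i < x 0 i <= p.2 0 i].

Definition box_volume p : R := \prod_(i < n.+1) Num.max 0 (p.2 0 i - p.1 0 i).

Definition box_cover A : set (nat -> 'rV[R]_n.+1 * 'rV[R]_n.+1) :=
  [set q | A `<=` \bigcup_k box (q k)].

Definition outer_lebesgue A : \bar R :=
  ereal_inf [set (\sum_(k <oo) (box_volume (q k))%:E)%E | q in box_cover A].

Lemma box_volume_ge0 p : 0 <= box_volume p.
Proof. by apply: prodr_ge0 => i _; rewrite le_max lexx. Qed.

Lemma outer_lebesgue_ge0 A : (0 <= outer_lebesgue A)%E.
Proof.
apply: le_ereal_inf_tmp => _ [q _ <-].
by apply: nneseries_ge0 => k _ _; rewrite lee_fin box_volume_ge0.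
Qed.

Lemma outer_lebesgue0 : outer_lebesgue set0 = 0%E.
Proof.
apply/eqP; rewrite eq_le outer_lebesgue_ge0 andbT.
apply: ereal_inf_lbound; exists (fun=> (0, 0)); first exact: sub0set.
rewrite eseries0// => k _ _; congr EFin.
by rewrite /box_volume big_ord_recl /= subrr maxxx mul0r.
Qed.

Lemma le_outer_lebesgue : {homo outer_lebesgue : A B / A `<=` B >-> (A <= B)%E}.
Proof.
move=> A B AB; apply: ereal_inf_le_tmp => _ [q Bp <-].
by exists q => //; exact: subset_trans Bp.
Qed.

Lemma outer_lebesgue_sigma_subadditive : sigma_subadditive outer_lebesgue.
Proof.
move=> A; have [[i ioo]|] := pselect (exists i, outer_lebesgue (A i) = +oo%E).
  rewrite (eseries_pinfty _ _ ioo) ?leey// => k _.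
  by rewrite -ltNye (lt_le_trans _ (outer_lebesgue_ge0 _)).
rewrite -forallNE => Aoo.
apply/lee_addgt0Pr => _/posnumP[e].
apply: le_trans (epsilon_trick _ _ _); last 2 first.
- by move=> k; exact: outer_lebesgue_ge0.
- by [].
pose P k q := box_cover (A k) q /\
  (\sum_(j <oo) (box_volume (q j))%:E <=
    outer_lebesgue (A k) + (e%:num / (2 ^ k.+1)%:R)%:E)%E.
have [G PG] : {G & forall k, P k (G k)}.
  apply: (@choice _ _ P) => k.
  have e0 : 0 < e%:num / (2 ^ k.+1)%:R :> R by [].
  have fk : outer_lebesgue (A k) \is a fin_num.
    by rewrite ge0_fin_numE ?outer_lebesgue_ge0// ltey; exact/eqP/Aoo.
  have [_ [q Ap <-] /ltW pe] := lb_ereal_inf_adherent e0 fk.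
  by exists q.
pose v (ij : nat * nat) : \bar R := (box_volume (uncurry G ij))%:E.
have v0 ij : (0 <= v ij)%E by rewrite lee_fin box_volume_ge0.
have /card_esym/ppcard_eqP[f] := card_nat2.
apply: (@le_trans _ _ (\esum_(i in setT) v i)%E).
  apply: ereal_inf_lbound; exists (uncurry G \o f).
    move=> t [i _ Ait]; have [j _ Gijt] := (PG i).1 _ Ait.
    by exists (f^-1%FUN (i, j)) => //=; rewrite invK ?inE.
  rewrite (reindex_esum [set: nat] [set: nat * nat] f v 'bij_f).
  by rewrite nneseries_esumT// => k; exact: v0.
rewrite (_ : esum _ _ = (\sum_(i <oo) \sum_(j <oo) v (i, j))%E); last first.
  rewrite nneseries_esumT; last by move=> i; exact: nneseries_ge0.
  transitivity (\esum_(i in [set: nat]) \esum_(j in [set: nat]) v (i, j))%E.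
    rewrite esum_esum//; congr esum; last by apply/funext => -[].
    by apply/seteqP; split=> [[]|].
  by apply: eq_esum => i _; rewrite nneseries_esumT.
apply: lee_nneseries => [k _ _|k _].
  exact: nneseries_ge0.
exact: (PG k).2.
Qed.

HB.instance Definition _ := isOuterMeasure.Build R 'rV[R]_n.+1 outer_lebesgue
  outer_lebesgue0 outer_lebesgue_ge0 le_outer_lebesgue
  outer_lebesgue_sigma_subadditive.

Let mu : {outer_measure set 'rV[R]_n.+1 -> \bar R} := outer_lebesgue.

Definition lebesgue_space : measurableType _ := caratheodory_type mu.

Definition lebesgue : {measure set lebesgue_space -> \bar R} :=
  (mu : set (caratheodory_type mu) -> \bar R).

End Lebesgue.

Section Perimeter.
Variables (R : realType) (n : nat).
Implicit Types (C K E : set 'rV[R]_n.+1) (xi : 'rV[R]_n.+1 -> 'rV[R]_n.+1).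

Definition lebesgue_measurable E : Prop :=
  measurable (E : set (lebesgue_space R n)).

Definition uniform_geometry C : Prop :=
  ~ bounded_set C /\
  exists2 r0 : R, 0 < r0 &
    (0 < ereal_inf [set lebesgue R n (C `&` eclosed_ball x r0) | x in C])%E.

Fixpoint Ck (k : nat) xi : Prop :=
  if k is k'.+1 then
    (forall x, differentiable xi x) /\ (forall v, Ck k' ('D_v xi))
  else continuous xi.

Definition smooth xi : Prop := forall k, Ck k xi.

Definition divergence xi (x : 'rV[R]_n.+1) : R :=
  \sum_(i < n.+1) ('D_(delta_mx 0 i) xi x) 0 i.

Definition test_field C xi : Prop :=
  let supp := closure [set x | xi x != 0] in
  [/\ smooth xi, compact supp, supp `<=` C° & forall x, enorm (xi x) <= 1].

Definition relative_perimeter C E : \bar R :=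
  ereal_sup [set (\int[lebesgue R n]_(x in E) (divergence xi x)%:E)%E
            | xi in test_field C].

Definition isoperimetric_profile C (v : R) : \bar R :=
  ereal_inf [set relative_perimeter C E | E in [set E |
    [/\ lebesgue_measurable E, E `<=` C & lebesgue R n E = v%:E]]].

Definition generalized_isoperimetric_region C (v : R) K E : Prop :=
  [/\ K = C \/ asymptotic_cylinder C K, lebesgue_measurable E, E `<=` K,
      lebesgue R n E = v%:E &
      relative_perimeter K E = isoperimetric_profile C v].

End Perimeter.

(* Main.v *)
(* Half-spaces, and hence R^N, satisfy the sharp isoperimetric inequality of
   half balls: if r is the radius at which a half ball has volume v, then a set
   of volume v has perimeter at least N v / r. This is Gromov's argument: the
   Knothe map from a smoothed finite union of boxes, covering most of the set and
   of total volume less than that of the half ball, to the half ball of radius r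
   has divergence at least N on the boxes (AM-GM); divided by r and cut off it is
   an almost optimal test field.
   On the other hand, the sections E of C by balls centered at p in C have
   perimeter at most N |E| / r in C: cut a test field off in the thin shell
   between the radii r and (1 + s) r, whose volume is at most
   ((1 + s)^N - 1) |E| because C is star-shaped at p.
   It remains to find p such that |C \cap B(p, r)| is strictly less than the
   volume of a half ball for every r. Take a supporting half-space of C at a
   boundary point and a line in its boundary hyperplane. If C contained the line
   it would be invariant under translations along it, and a translate of C would
   be an asymptotic cylinder of C, which is excluded; so the line leaves C at
   some point p, near which C misses a part of the half-space.
   Uniform geometry: if unit balls centered at x_i in C had volumes in C tending
   to 0, then |x_i| -> oo, and a subsequence of -x_i + C would converge to an
   asymptotic cylinder (Blaschke selection), which contains a ball near 0; by
   convexity so do the bodies -x_i + C, a contradiction. *)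

Require Import Defs.
From mathcomp Require Import all_boot all_order all_algebra.
From mathcomp Require Import all_classical all_reals all_analysis.
From mathcomp Require Import measurable_realfun.
From mathcomp Require Import ring lra.
Set Implicit Arguments.
Unset Strict Implicit.
Unset Printing Implicit Defensive.
Import Order.TTheory GRing.Theory Num.Theory.
Import numFieldNormedType.Exports.

Local Open Scope classical_set_scope.
Local Open Scope ring_scope.

(** * Euclidean structure *)

(** Volumes are compared through coverings by boxes, mostly by one-sided estimates. The volume of
    the unit half ball is represented by [half_ball_const], a product of one-dimensional integrals.
    For sections of the ball it is an upper bound, obtained by slicing, and this is the direction in
    which the sections of C must be estimated. The Knothe map has to be smooth on the whole space,
    which forces a source density that is positive everywhere; the excess mass is absorbed by the
    strict inequality between the volume of the boxes and that of the half ball. Strictness also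
    gives the final contradiction: if v = |C \cap B(p, r)| lies strictly below the half ball, the
    radius can be lowered a little, so a set of volume v in a cylinder has perimeter strictly larger
    than N v / r, hence than I_C(v). If C is the whole space it has no boundary point, but then its
    only asymptotic cylinder is C itself. *)

Lemma continuous_sumr (T : topologicalType) (R : realType) (I : Type) (s : seq I)
    (P : pred I) (f : I -> T -> R) :
  (forall i, P i -> continuous (f i)) ->
  continuous (fun x => \sum_(i <- s | P i) f i x).
Proof.
move=> cf; elim: s => [|i s IH].
  rewrite (_ : (fun x => _) = fun=> 0); first by move=> x; exact: cvg_cst.
  by apply/funext => x; rewrite big_nil.
have [Pi|Pi] := boolP (P i); last first.
  rewrite (_ : (fun x => _) = fun x => \sum_(i <- s | P i) f i x)//.
  by apply/funext => x; rewrite big_cons (negPf Pi).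
rewrite (_ : (fun x => _) = fun x => f i x + \sum_(i <- s | P i) f i x).
  by move=> x; apply: cvgD; [exact: cf|exact: IH].
by apply/funext => x; rewrite big_cons Pi.
Qed.

Section EuclideanFacts.
Variables (R : realType) (n : nat).
Local Notation V := 'rV[R]_n.+1.
Implicit Types (x y z a c : V) (A B C K : set V).

Lemma dotpC x y : dotp x y = dotp y x.
Proof. by apply: eq_bigr => i _; rewrite mulrC. Qed.

Lemma dotpDl x y z : dotp (x + y) z = dotp x z + dotp y z.
Proof. by rewrite -big_split; apply: eq_bigr => i _; rewrite mxE mulrDl. Qed.

Lemma dotpZl (c : R) x y : dotp (c *: x) y = c * dotp x y.
Proof. by rewrite mulr_sumr; apply: eq_bigr => i _; rewrite mxE mulrA. Qed.

Lemma dotpDr x y z : dotp x (y + z) = dotp x y + dotp x z.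
Proof. by rewrite dotpC dotpDl dotpC (dotpC z). Qed.

Lemma dotpZr (c : R) x y : dotp x (c *: y) = c * dotp x y.
Proof. by rewrite dotpC dotpZl dotpC. Qed.

Lemma dotpNl x y : dotp (- x) y = - dotp x y.
Proof. by rewrite -scaleN1r dotpZl mulN1r. Qed.

Lemma dotpNr x y : dotp x (- y) = - dotp x y.
Proof. by rewrite dotpC dotpNl dotpC. Qed.

Lemma dotpBl x y z : dotp (x - y) z = dotp x z - dotp y z.
Proof. by rewrite dotpDl dotpNl. Qed.

Lemma dotpBr x y z : dotp x (y - z) = dotp x y - dotp x z.
Proof. by rewrite dotpDr dotpNr. Qed.

Lemma dotp0r x : dotp x 0 = 0.
Proof. by rewrite /dotp big1// => i _; rewrite mxE mulr0. Qed.

Lemma dotp0l x : dotp 0 x = 0.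
Proof. by rewrite dotpC dotp0r. Qed.

Lemma dotpp_ge0 x : 0 <= dotp x x.
Proof. by apply: sumr_ge0 => i _; rewrite -expr2 sqr_ge0. Qed.

Lemma dotpp_eq0 x : (dotp x x == 0) = (x == 0).
Proof.
apply/eqP/eqP => [h|->]; last exact: dotp0r.
apply/rowP => i; rewrite mxE; apply/eqP; rewrite -sqrf_eq0 expr2.
move/eqP: h; rewrite psumr_eq0; last by move=> j _; rewrite -expr2 sqr_ge0.
by move/allP => /(_ i); rewrite mem_index_enum => /(_ isT).
Qed.

Lemma dotpp_gt0 x : (0 < dotp x x) = (x != 0).
Proof. by rewrite lt_def dotpp_eq0 dotpp_ge0 andbT. Qed.

Lemma enorm_ge0 x : 0 <= enorm x. Proof. exact: sqrtr_ge0. Qed.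

Lemma enormE x : enorm x ^+ 2 = dotp x x.
Proof. by rewrite sqr_sqrtr// dotpp_ge0. Qed.

Lemma enorm0 : enorm (0 : V) = 0. Proof. by rewrite /enorm dotp0r sqrtr0. Qed.

Lemma enorm_eq0 x : (enorm x == 0) = (x == 0).
Proof. by rewrite -sqrf_eq0 enormE dotpp_eq0. Qed.

Lemma enorm_gt0 x : (0 < enorm x) = (x != 0).
Proof. by rewrite lt_def enorm_eq0 enorm_ge0 andbT. Qed.

Lemma enormZ (c : R) x : enorm (c *: x) = `|c| * enorm x.
Proof.
by rewrite /enorm dotpZl dotpZr mulrA -expr2 sqrtrM ?sqr_ge0// sqrtr_sqr.
Qed.

Lemma enormN x : enorm (- x) = enorm x.
Proof. by rewrite -scaleN1r enormZ normrN1 mul1r. Qed.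

Lemma enormB x y : enorm (x - y) = enorm (y - x).
Proof. by rewrite -enormN opprB. Qed.

(** Expanding the squared norm of [enorm y *: x - enorm x *: y] gives [2 * enorm x * enorm y] times
    the difference of the two sides. *)
Lemma dotp_le x y : dotp x y <= enorm x * enorm y.
Proof.
have [->|y0] := eqVneq y 0; first by rewrite dotp0r enorm0 mulr0.
have [->|x0] := eqVneq x 0; first by rewrite dotp0l enorm0 mul0r.
have nx : 0 < enorm x by rewrite enorm_gt0.
have ny : 0 < enorm y by rewrite enorm_gt0.
have := dotpp_ge0 (enorm y *: x - enorm x *: y).
rewrite dotpBl !dotpBr !dotpZl !dotpZr -!enormE (dotpC y x) => h.
have h2 : 0 <= (enorm x * enorm y) * (enorm x * enorm y - dotp x y).
  by rewrite -(pmulr_rge0 _ (ltr0Sn R 1)); move: h; lra.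
by rewrite pmulr_rge0 ?mulr_gt0// subr_ge0 in h2.
Qed.

Lemma normr_dotp_le x y : `|dotp x y| <= enorm x * enorm y.
Proof.
rewrite ler_norml dotp_le andbT lerNl -dotpNl.
by apply: le_trans (dotp_le _ _) _; rewrite enormN.
Qed.

Lemma enormD x y : enorm (x + y) <= enorm x + enorm y.
Proof.
rewrite -ler_sqr ?nnegrE ?enorm_ge0 ?addr_ge0 ?enorm_ge0//.
rewrite enormE dotpDl !dotpDr (dotpC y x) sqrrD !enormE.
by have := dotp_le x y; lra.
Qed.

Lemma enorm_trans z x y : enorm (x - y) <= enorm (x - z) + enorm (z - y).
Proof. by apply: le_trans (enormD _ _); rewrite addrA subrK. Qed.

Lemma coord_le_enorm x i : `|x 0 i| <= enorm x.
Proof.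
rewrite -ler_sqr ?nnegrE ?enorm_ge0// enormE real_normK ?num_real// /dotp (bigD1 i)//= -expr2.
by rewrite lerDl sumr_ge0// => j _; rewrite -expr2 sqr_ge0.
Qed.

Lemma enorm_le_coord x (c : R) :
  (forall i, `|x 0 i| <= c) -> enorm x <= n.+1%:R * c.
Proof.
move=> h; have c0 : 0 <= c by apply: le_trans (h 0).
rewrite -ler_sqr ?nnegrE ?enorm_ge0 ?mulr_ge0// enormE exprMn.
apply: (@le_trans _ _ (\sum_(i < n.+1) c ^+ 2)).
  apply: ler_sum => i _; rewrite -expr2 -(real_normK (num_real (x 0 i))).
  by rewrite ler_sqr ?nnegrE.
rewrite sumr_const card_ord -[leLHS]mulr_natl; apply: ler_wpM2r; rewrite ?sqr_ge0//.
by rewrite -natrX ler_nat -mulnn leq_pmulr.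
Qed.

Lemma norm_le_enorm x : `|x| <= enorm x.
Proof.
rewrite -[leLHS]/(mx_norm x) mx_normrE; apply: bigmax_le.
  exact: enorm_ge0.
by move=> [i j] _ /=; rewrite ord1 coord_le_enorm.
Qed.

Lemma coord_le_norm x i : `|x 0 i| <= `|x|.
Proof.
rewrite -[leRHS]/(mx_norm x) mx_normrE.
by apply: (le_bigmax _ (fun ij => `|x ij.1 ij.2|) (0, i)).
Qed.

Lemma enorm_le_norm x : enorm x <= n.+1%:R * `|x|.
Proof. by apply: enorm_le_coord => i; exact: coord_le_norm. Qed.

Lemma continuous_dotpl a : continuous (dotp a : V -> R).
Proof.
apply: continuous_sumr => i _ x.
by apply: continuousM; [exact: cst_continuous|exact: coord_continuous].
Qed.

Lemma continuous_enorm : continuous (@enorm R n).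
Proof.
move=> x; apply: continuous_comp; last exact: sqrt_continuous.
by apply: continuous_sumr => i _ y; apply: continuousM; exact: coord_continuous.
Qed.

Lemma continuous_enormB c : continuous (fun x : V => enorm (x - c)).
Proof.
move=> x; apply: (@continuous_comp _ _ _ (fun x => x - c) (@enorm R n)).
  by apply: continuousB; [move=> A; exact|exact: cst_continuous].
exact: continuous_enorm.
Qed.

Lemma open_eball c (r : R) : open (eball c r).
Proof.
rewrite (_ : eball c r = (fun x => enorm (x - c)) @^-1` [set t | t < r])//.
by apply: open_comp; [move=> x _; exact: continuous_enormB|exact: open_lt].
Qed.

Lemma closed_eclosed_ball c (r : R) : closed (eclosed_ball c r).
Proof.
rewrite (_ : eclosed_ball c r = (fun x => enorm (x - c)) @^-1` [set t | t <= r])//.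
by apply: closed_comp; [move=> x _; exact: continuous_enormB|exact: closed_le].
Qed.

Lemma enorm_bounded A (r : R) : (forall x, A x -> enorm x <= r) -> bounded_set A.
Proof.
move=> h; exists r; split; first exact: num_real.
by move=> M rM x /h; have := norm_le_enorm x; rewrite /=; lra.
Qed.

Lemma bounded_enorm A : bounded_set A -> exists r, forall x, A x -> enorm x <= r.
Proof.
case=> M [_ h]; exists (n.+1%:R * (M + 1)) => x Ax.
apply: le_trans (enorm_le_norm _) _; rewrite ler_wpM2l//.
by apply: h Ax; rewrite ltrDl.
Qed.

Lemma compact_eclosed_ball c (r : R) : compact (eclosed_ball c r).
Proof.
apply: bounded_closed_compact; last exact: closed_eclosed_ball.
apply: (@enorm_bounded _ (r + enorm c)) => x xr.
by have := enorm_trans c x 0; rewrite !subr0 /eclosed_ball/= in xr *; lra.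
Qed.

Lemma nbhs_eball x A : nbhs x A <-> exists2 e : R, 0 < e & eball x e `<=` A.
Proof.
split.
  move=> /nbhs_ballP[e /= e0 h]; exists e => // y yx; apply: h.
  rewrite -ball_normE /ball_/= -normrN opprB; apply: le_lt_trans yx.
  exact: norm_le_enorm.
case=> e e0 h; apply: filterS h _; apply: open_nbhs_nbhs; split; first exact: open_eball.
by rewrite /eball/= subrr enorm0.
Qed.

Lemma dotp_delta x i : dotp x (delta_mx 0 i) = x 0 i.
Proof.
rewrite /dotp (bigD1 i)//= big1 ?addr0; first by rewrite mxE !eqxx mulr1.
by move=> j ji; rewrite mxE (negPf ji) andbF mulr0.
Qed.

Lemma enorm_delta i : enorm (delta_mx 0 i : V) = 1.
Proof. by rewrite /enorm dotp_delta mxE !eqxx sqrtr1. Qed.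

(** [convex_set] takes coefficients packaged with a proof that they lie in [0, 1]; the geometric
    arguments use plain reals. *)
Lemma convexE A : convex_set A <->
  forall x y (t : R), 0 <= t -> t <= 1 -> A x -> A y -> A (t *: x + (1 - t) *: y).
Proof.
split=> [h x y t t0 t1 Ax Ay|h x y l].
  have t01 : Itv.spec (@Itv.num_sem R) (Itv.Real `[0%Z, 1%Z]) t.
    by apply/andP; split; [exact: num_real|rewrite /= in_itv/= t0 t1].
  have := h x y (Itv.mk t01); rewrite !inE => /(_ Ax Ay).
  done.
rewrite !inE => Ax Ay.
by have := h x y l%:num (ge0 l) (le1 l) Ax Ay; apply.
Qed.
End EuclideanFacts.

(** * Lebesgue outer measure *)

Section OuterMeasure.
Variables (R : realType).

Lemma nneseries_first (f : nat -> \bar R) :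
  (forall k, (0 < k)%N -> f k = 0%E) -> (0 <= f 0%N)%E -> (\sum_(k <oo) f k)%E = f 0%N.
Proof.
move=> f0 f00; rewrite (@nneseries_split _ _ 0%N 1%N)/=; last first.
  by move=> [|k] _ //; rewrite f0.
rewrite add0n big_nat1 eseries0 ?adde0// => k k1 _; exact: f0.
Qed.

Lemma le_nneseries_term (f : nat -> \bar R) k :
  (forall k, 0 <= f k)%E -> (f k <= \sum_(k <oo) f k)%E.
Proof.
move=> f0; apply: le_trans (nneseries_lim_ge (P := xpredT) (m := 0%N) k.+1 _) => //=.
by rewrite big_nat_recr//= leeDr// sume_ge0.
Qed.

Lemma outer_lebesgue_box (n : nat) (p : 'rV[R]_n.+1 * 'rV[R]_n.+1) :
  (outer_lebesgue (box p) <= (box_volume p)%:E)%E.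
Proof.
pose q (k : nat) : 'rV[R]_n.+1 * 'rV[R]_n.+1 := if k is 0%N then p else (0, 0).
apply: ereal_inf_lbound; exists q; first by move=> x px; exists 0%N.
rewrite nneseries_first//=; last by rewrite lee_fin box_volume_ge0.
move=> [//|k] _ /=; congr EFin.
by rewrite /box_volume big_ord_recl /= subrr maxxx mul0r.
Qed.

(** A covering of [D] by boxes yields a covering of [A] by the sets [F p], at a cost multiplied by
    [c]. Translations, dilations, slabs and reflections are all instances. *)
Lemma outer_lebesgue_map (m n : nat) (A : set 'rV[R]_m.+1) (D : set 'rV[R]_n.+1)
    (c : R) (F : 'rV[R]_n.+1 * 'rV[R]_n.+1 -> set 'rV[R]_m.+1) :
  0 < c ->
  (forall p, outer_lebesgue (F p) <= c%:E * (box_volume p)%:E)%E ->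
  (forall q, box_cover D q -> A `<=` \bigcup_k F (q k)) ->
  (outer_lebesgue A <= c%:E * outer_lebesgue D)%E.
Proof.
move=> c0 Fc Fcov; rewrite -lee_pdivrMl//; apply: le_ereal_inf_tmp => _ [q qD <-].
rewrite lee_pdivrMl// -nneseriesZl//; last by move=> k _; rewrite lee_fin box_volume_ge0.
apply: le_trans (le_outer_lebesgue (Fcov q qD)) _.
apply: le_trans (outer_lebesgue_sigma_subadditive _) _.
apply: lee_nneseries => [k _ _|k _]; first exact: outer_lebesgue_ge0.
exact: Fc.
Qed.

End OuterMeasure.

Section LebesgueSpace.
Variables (R : realType) (n : nat).
Local Notation V := 'rV[R]_n.+1.
Local Notation mu := (@outer_lebesgue R n).
Implicit Types (x y c : V) (A B : set V).

Lemma outer_lebesgue_translate_le c A : (mu (translate c A) <= mu A)%E.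
Proof.
rewrite -[leRHS]mul1e.
apply: (@outer_lebesgue_map _ _ _ _ _ 1 (fun p => box (c + p.1, c + p.2))) => //.
  move=> p; rewrite mul1e; apply: le_trans (outer_lebesgue_box _) _.
  rewrite lee_fin le_eqVlt; apply/orP; left; apply/eqP; apply: eq_bigr => i _ /=.
  by rewrite !mxE [c 0 i + p.2 0 i]addrC addrKA.
move=> q qA _ [y /qA[k _ yk] <-]; exists k => // i; have := yk i.
by rewrite !mxE ltrD2l lerD2l.
Qed.

Lemma translateK c A : translate (- c) (translate c A) = A.
Proof.
apply/seteqP; split=> [_ [_ [x Ax <-] <-]|x Ax]; first by rewrite addKr.
by exists (c + x); [exists x|rewrite addKr].
Qed.

Lemma outer_lebesgue_translate c A : mu (translate c A) = mu A.
Proof.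
apply/eqP; rewrite eq_le outer_lebesgue_translate_le /=.
by rewrite -{1}(translateK c A) outer_lebesgue_translate_le.
Qed.

Lemma outer_lebesgue_dilate_le (l : R) A : 0 < l ->
  (mu [set l *: x | x in A] <= (l ^+ n.+1)%:E * mu A)%E.
Proof.
move=> l0.
apply: (@outer_lebesgue_map _ _ _ _ _ _ (fun p => box (l *: p.1, l *: p.2))).
- exact: exprn_gt0.
- move=> p; apply: le_trans (outer_lebesgue_box _) _; rewrite -EFinM lee_fin.
  rewrite (_ : l ^+ n.+1 = \prod_(i < n.+1) l); last by rewrite prodr_const card_ord.
  rewrite /box_volume -big_split/=.
  apply: ler_prod => i _; rewrite le_max lexx/= !mxE -mulrBr.
  by rewrite maxr_pMr ?mulr0// ltW.
- move=> q qA _ [y /qA[k _ yk] <-]; exists k => // i; have := yk i.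
  by rewrite !mxE ltr_pM2l// ler_pM2l.
Qed.

Lemma outer_lebesgue_dilate (l : R) A : 0 < l ->
  mu [set l *: x | x in A] = ((l ^+ n.+1)%:E * mu A)%E.
Proof.
move=> l0; apply/eqP; rewrite eq_le outer_lebesgue_dilate_le//=.
have := @outer_lebesgue_dilate_le l^-1 [set l *: x | x in A].
rewrite invr_gt0 => /(_ l0); rewrite (_ : [set l^-1 *: x | x in [set l *: x | x in A]] = A).
  by rewrite exprVn lee_pdivlMl ?exprn_gt0.
apply/seteqP; split=> [_ [_ [x Ax <-] <-]|x Ax].
  by rewrite scalerA mulVf ?scale1r// gt_eqF.
by exists (l *: x); [exists x|rewrite scalerA mulVf ?scale1r// gt_eqF].
Qed.

Definition row_set x (i : 'I_n.+1) (s : R) : V :=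
  \row_j (if j == i then s else x 0 j).

Lemma row_setE x i s : row_set x i s 0 i = s.
Proof. by rewrite mxE eqxx. Qed.

Lemma row_set_neq x i s j : j != i -> row_set x i s 0 j = x 0 j.
Proof. by move=> ji; rewrite mxE (negPf ji). Qed.

(** The hyperplane cuts each box of a covering into two half-open boxes whose volumes add up, so a
    covering of [X] splits into coverings of the two pieces. *)
Lemma caratheodory_coord_le (i : 'I_n.+1) (c : R) :
  mu.-caratheodory [set x : V | x 0 i <= c].
Proof.
apply: le_caratheodory_measurable => X.
apply: le_ereal_inf_tmp => _ [q qX <-].
pose q1 k := ((q k).1, row_set (q k).2 i (Num.min ((q k).2 0 i) c)).
pose q2 k := (row_set (q k).1 i (Num.max ((q k).1 0 i) c), (q k).2).
have vol k : box_volume (q k) = box_volume (q1 k) + box_volume (q2 k).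
  rewrite /box_volume (bigD1 i)// [in X in _ = X + _](bigD1 i)//.
  rewrite [in X in _ = _ + X](bigD1 i)//= !row_setE.
  rewrite [X in _ = _ * X + _](eq_bigr (fun j => Num.max 0 ((q k).2 0 j - (q k).1 0 j))); last first.
    by move=> j ji; rewrite row_set_neq.
  rewrite [X in _ = _ + _ * X](eq_bigr (fun j => Num.max 0 ((q k).2 0 j - (q k).1 0 j))); last first.
    by move=> j ji; rewrite row_set_neq.
  rewrite -mulrDl; congr (_ * _).
  set a := (q k).1 0 i; set b := (q k).2 0 i.
  case: (leP b c) => ?; case: (leP a c) => ?;
    do ?[case: (leP 0 (_ - _)) => ?]; lra.
rewrite (eq_eseriesr (g := fun k => ((box_volume (q1 k))%:E + (box_volume (q2 k))%:E)%E)); last first.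
  by move=> k _; rewrite vol EFinD.
rewrite nneseriesD; try by move=> k _ _; rewrite lee_fin box_volume_ge0.
apply: leeD; apply: ereal_inf_lbound.
- exists q1 => // x [/qX[k _ xk] xc]; exists k => // j; have := xk j.
  have [->|ji] := eqVneq j i; last by rewrite /= row_set_neq.
  by rewrite /= row_setE le_min => /andP[-> ->].
- exists q2 => // x [/qX[k _ xk] /negP xc]; exists k => // j; have := xk j.
  have [->|ji] := eqVneq j i; last by rewrite /= row_set_neq.
  by rewrite /= row_setE gt_max => /andP[-> ->]; rewrite ltNge xc.
Qed.

(** The lower bounds for balls derive from this one. For a covering, the indicators of the boxes sum
    to at least 1 on the cube; integrating one coordinate after the other replaces indicators by
    side lengths until the sum of the volumes is reached. *)
Lemma outer_lebesgue_unit_cube : (1%:E <= mu [set x : V | forall i, (0 <= x 0 i <= 1)%R])%E.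
Proof.
apply: le_ereal_inf_tmp => _ [q qX <-].
pose len k i := Num.max 0 ((q k).2 0 i - (q k).1 0 i).
pose ind k i (s : R) : R := \1_(`](q k).1 0 i, (q k).2 0 i]%classic) s.
(* In [h j k] the first [j] coordinates still contribute indicators and the others already
   contribute lengths; the induction lowers [j] from [n.+1] to 0. *)
pose h j k (x : V) : R := \prod_(i < n.+1) (if (i < j)%N then ind k i (x 0 i) else len k i).
have h0 j k x : 0 <= h j k x.
  apply: prodr_ge0 => i _; case: ifP => _; first by rewrite /ind indicE.
  by rewrite le_max lexx.
suff H j : (j <= n.+1)%N -> forall x : V, (forall i, 0 <= x 0 i <= 1) ->
    (1%:E <= \sum_(k <oo) (h (n.+1 - j)%N k x)%:E)%E.
  have := H n.+1 (leqnn _) 0; rewrite subnn; apply.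
  by move=> i; rewrite mxE lexx ler01.
elim: j => [_ x x01|j IH jn x x01].
  have [k _ xk] := qX x x01; rewrite subn0.
  apply: le_trans (le_nneseries_term k _); last by move=> l; rewrite lee_fin h0.
  rewrite lee_fin /h big1// => i _; rewrite ltn_ord /ind indicE.
  by rewrite (_ : _ \in _ = true)//; apply/mem_set; rewrite /= in_itv/=; exact: xk.
have {}IH := IH (ltnW jn).
set j' := (n.+1 - j.+1)%N; have j'n : (j' < n.+1)%N by rewrite /j' ltn_subrL.
have jj : (n.+1 - j)%N = j'.+1 by rewrite /j' -subSn ?subSS.
pose i0 := Ordinal j'n.
pose c k := \prod_(i < n.+1 | i != i0) (if (i < j')%N then ind k i (x 0 i) else len k i).
have c0 k : 0 <= c k.
  apply: prodr_ge0 => i _; case: ifP => _; first by rewrite /ind indicE.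
  by rewrite le_max lexx.
have hE k s : h j'.+1 k (row_set x i0 s) = c k * ind k i0 s.
  rewrite /h (bigD1 i0)//= ltnSn row_setE mulrC; congr (_ * _).
  apply: eq_bigr => i ii0; rewrite row_set_neq// ltnS leq_eqVlt.
  by rewrite (_ : (i == j' :> nat) = false)//; apply/negbTE.
have hE' k : h j' k x = c k * len k i0.
  by rewrite /h (bigD1 i0)//= ltnn mulrC.
(* Integrating the previous inequality over [0, 1] in coordinate [i0] keeps the 1 on the left; on
   the right each indicator integrates to at most its length. *)
apply: (@le_trans _ _ (\int[lebesgue_measure]_(s in `[0%R, 1%R])
     (\sum_(k <oo) (c k * ind k i0 s)%:E))%E).
  apply: (@le_trans _ _ (\int[lebesgue_measure]_(s in `[(0:R)%R, 1%R]) (cst 1%:E) s)%E).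
    by rewrite integral_cst//= lebesgue_measure_itv/= lte_fin ltr01 sube0 mule1.
  apply: ge0_le_integral => //.
  - apply: ge0_emeasurable_sum => //.
      by move=> k s _ _; rewrite lee_fin mulr_ge0// /ind indicE.
    by move=> k _; apply/measurable_EFinP; apply: measurable_funM => //; exact: measurable_indic.
  - move=> s; rewrite /= in_itv/= => s01.
    have := IH (row_set x i0 s); rewrite jj.
    under eq_eseriesr do rewrite hE.
    apply => i; have [->|ii0] := eqVneq i i0; first by rewrite row_setE.
    by rewrite row_set_neq.
rewrite integral_nneseries//; last 2 first.
- by move=> k; apply/measurable_EFinP; apply: measurable_funM => //; exact: measurable_indic.
- by move=> k s _; rewrite lee_fin mulr_ge0// /ind indicE.
apply: lee_nneseries => [k _ _|k _].
  by apply: integral_ge0 => s _; rewrite lee_fin mulr_ge0// /ind indicE.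
rewrite hE'; under eq_integral do rewrite EFinM.
rewrite ge0_integralZl//; last 3 first.
- by apply/measurable_EFinP; exact: measurable_indic.
- by move=> s _; rewrite lee_fin /ind indicE.
- by rewrite lee_fin.
rewrite EFinM lee_wpmul2l ?lee_fin// integral_indic//.
apply: (@le_trans _ _ (lebesgue_measure `](q k).1 0 i0, (q k).2 0 i0]%classic)).
  by apply: le_measure; rewrite ?inE//; exact: measurableI.
rewrite lebesgue_measure_itv/= lte_fin /len; case: ltP => ab; last by rewrite lee_fin le_max lexx.
by rewrite -EFinB lee_fin le_max lexx orbT.
Qed.

End LebesgueSpace.

Section Measurability.
Variables (R : realType) (n : nat).
Local Notation V := 'rV[R]_n.+1.
Local Notation mu := (@outer_lebesgue R n).
Implicit Types (x y c : V) (A B : set V).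

Lemma measurable_coord_le (i : 'I_n.+1) (c : R) :
  lebesgue_measurable [set x : V | x 0 i <= c].
Proof. exact: caratheodory_coord_le. Qed.

Lemma measurable_box (p : V * V) : lebesgue_measurable (box p).
Proof.
rewrite /lebesgue_measurable (_ : box p = \bigcap_(i in [set: 'I_n.+1])
   ([set x : V | x 0 i <= p.2 0 i] `\` [set x : V | x 0 i <= p.1 0 i])); last first.
  apply/seteqP; split=> x /= h i.
    by move=> _; have /andP[h1 h2] := h i; split=> //=; apply/negP; rewrite -ltNge.
  by have [//=|h1 /negP] := h i; rewrite -ltNge => ->.
apply: fin_bigcap_measurable => // i _.
by apply: measurableD; exact: measurable_coord_le.
Qed.

Lemma open_lebesgue_measurable A : open A -> lebesgue_measurable A.
Proof.
move=> oA.
pose F (p : 'rV[rat]_n.+1 * 'rV[rat]_n.+1) : set V :=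
  box (map_mx ratr p.1, map_mx ratr p.2).
rewrite /lebesgue_measurable (_ : A = \bigcup_p (if pselect (F p `<=` A) then F p else set0)).
  apply: countable_bigcupT_measurable; first exact: countableP.
  by move=> p; case: pselect => pA; [exact: measurable_box|exact: measurable0].
apply/seteqP; split=> [x Ax|x [p _]]; last by case: pselect => [pA /pA|].
have /nbhs_ballP[e /= e0 xe] : nbhs x A by apply: open_nbhs_nbhs; split.
have H1 i : {q : rat | ratr q \in `]x 0 i - e, x 0 i[}.
  by apply: cid; have [q hq] := @rat_in_itvoo R (x 0 i - e) (x 0 i) ltac:(lra); exists q.
have H2 i : {q : rat | ratr q \in `]x 0 i, x 0 i + e[}.
  by apply: cid; have [q hq] := @rat_in_itvoo R (x 0 i) (x 0 i + e) ltac:(lra); exists q.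
exists (\row_i sval (H1 i), \row_i sval (H2 i)) => //.
case: pselect => [pA|]; last first.
  case; move=> y hy; apply: xe; split=> // i j; rewrite ord1; have := hy j; rewrite !mxE /=.
  have := svalP (H1 j); have := svalP (H2 j); rewrite !in_itv/= => /andP[? ?] /andP[? ?] /andP[? ?].
  by rewrite -ball_normE /ball_/= ltr_norml; apply/andP; split; lra.
move=> i; rewrite !mxE.
have := svalP (H1 i); have := svalP (H2 i); rewrite !in_itv/= => /andP[? ?] /andP[? ?].
by apply/andP; split=> //; exact: ltW.
Qed.

Lemma closed_lebesgue_measurable A : closed A -> lebesgue_measurable A.
Proof.
move=> cA; rewrite /lebesgue_measurable -(setCK A); apply: measurableC.
by apply: open_lebesgue_measurable; exact: closed_openC.
Qed.

Lemma continuous_lebesgue_measurable (f : V -> R) : continuous f ->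
  measurable_fun setT (f : lebesgue_space R n -> R).
Proof.
move=> cf; apply: (measurability _ (RGenOInfty.measurableE R)) => _ [_ [a ->] <-].
rewrite setTI; apply: open_lebesgue_measurable.
by apply: open_comp => [x _|]; [exact: cf|exact: interval_open].
Qed.

Lemma outer_lebesgue_finite_cover (I : eqType) (s : seq I) (F : I -> set V) A :
  (A `<=` \bigcup_(k in [set` s]) F k) -> (mu A <= \sum_(k <- s) mu (F k))%E.
Proof.
elim: s A => [|i s IH] A h.
  rewrite big_nil (_ : A = set0) ?outer_lebesgue0//.
  by apply/seteqP; split=> // x /h[k].
rewrite big_cons; apply: (@le_trans _ _ (mu (F i `|` (A `\` F i)))%E).
  by apply: le_outer_lebesgue => x Ax; have [|] := pselect (F i x); [left|right].
apply: le_trans (outer_measureU2 _ _ _) _; apply: leeD => //; apply: IH.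
move=> x [/h[k + Fk] nF]; rewrite /= in_cons => /orP[/eqP ki|ks]; last by exists k.
by rewrite ki in Fk.
Qed.

End Measurability.

Lemma continuous_prodr (T : topologicalType) (R : realType) (I : Type) (s : seq I)
    (P : pred I) (f : I -> T -> R) :
  (forall i, P i -> continuous (f i)) ->
  continuous (fun x => \prod_(i <- s | P i) f i x).
Proof.
move=> cf; elim: s => [|i s IH].
  rewrite (_ : (fun x => _) = fun=> 1); first by move=> x; exact: cvg_cst.
  by apply/funext => x; rewrite big_nil.
have [Pi|Pi] := boolP (P i); last first.
  rewrite (_ : (fun x => _) = fun x => \prod_(i <- s | P i) f i x)//.
  by apply/funext => x; rewrite big_cons (negPf Pi).
rewrite (_ : (fun x => _) = fun x => f i x * \prod_(i <- s | P i) f i x).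
  by move=> x; apply: cvgM; [exact: cf|exact: IH].
by apply/funext => x; rewrite big_cons Pi.
Qed.

(** Small parameters (overlaps, shell widths, dilation factors) are chosen by this one-sided form of
    continuity at 0. *)
Lemma continuous_eventually_le (R : realType) (f : R -> R) (e : R) :
  {for 0, continuous f} -> 0 < e ->
  exists2 d : R, 0 < d & forall s, 0 <= s -> s < d -> f s <= f 0 + e.
Proof.
move=> cf e0; have /cvgrPdist_lt /(_ e e0) := cf.
move=> /nbhs_ballP[d /= d0 h]; exists d => // s s0 sd.
have := h s; rewrite /ball/= sub0r normrN ger0_norm// => /(_ sd).
by rewrite ltr_norml => /andP[? ?]; lra.
Qed.

(** * Slabs: the inequality of Fubini type that coverings provide *)

Section Slabs.
Variables (R : realType).

Definition row_cons (n : nat) (s : R) (x : 'rV[R]_n) : 'rV[R]_n.+1 :=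
  \row_j (if unlift ord0 j is Some j' then x 0 j' else s).

Definition row_behead (n : nat) (x : 'rV[R]_n.+1) : 'rV[R]_n :=
  \row_j x 0 (lift ord0 j).

Lemma row_cons0 n s (x : 'rV[R]_n) : row_cons s x 0 ord0 = s.
Proof. by rewrite mxE unlift_none. Qed.

Lemma row_cons_lift n s (x : 'rV[R]_n) j : row_cons s x 0 (lift ord0 j) = x 0 j.
Proof. by rewrite mxE liftK. Qed.

(** Boxes covering the base [D], multiplied by the interval ]s, t], cover [A]. *)
Lemma outer_lebesgue_slab (n : nat) (A : set 'rV[R]_n.+2) (D : set 'rV[R]_n.+1) (s t : R) :
  s < t -> (forall x, A x -> s < x 0 0 <= t /\ D (row_behead x)) ->
  (outer_lebesgue A <= (t - s)%:E * outer_lebesgue D)%E.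
Proof.
move=> st AD.
apply: (@outer_lebesgue_map _ _ _ _ _ _ (fun p => box (row_cons s p.1, row_cons t p.2))).
- by rewrite subr_gt0.
- move=> p; apply: le_trans (outer_lebesgue_box _) _.
  rewrite -EFinM lee_fin {1}/box_volume big_ord_recl/= !row_cons0.
  rewrite max_r; last by rewrite subr_ge0 ltW.
  rewrite /box_volume le_eqVlt; apply/orP; left; apply/eqP.
  by congr (_ * _); apply: eq_bigr => i _; rewrite !row_cons_lift.
- move=> q qD x /AD[xst /qD[k _ xk]]; exists k => // i.
  case: (unliftP ord0 i) => [j ->|->] /=; last by rewrite !row_cons0.
  by have := xk j; rewrite !row_cons_lift mxE.
Qed.

Lemma outer_lebesgue_closed_slab (n : nat) (A : set 'rV[R]_n.+2) (D : set 'rV[R]_n.+1)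
    (s t d : R) :
  s <= t -> (outer_lebesgue D <= d%:E)%E ->
  (forall x, A x -> s <= x 0 0 <= t /\ D (row_behead x)) ->
  (outer_lebesgue A <= ((t - s) * d)%:E)%E.
Proof.
move=> st Dd AD.
have d0 : 0 <= d by rewrite -lee_fin; apply: le_trans Dd; exact: outer_lebesgue_ge0.
apply/lee_addgt0Pr => e e0.
(* Boxes are open on the left, so the slab is extended downwards by [e / (d + 1)], at a cost of at
   most [e]; the 1 keeps the denominator positive when [d] is 0. *)
have h : 0 < e / (d + 1) by rewrite divr_gt0//; lra.
apply: (@le_trans _ _ ((t - (s - e / (d + 1)))%:E * outer_lebesgue D)%E).
  apply: outer_lebesgue_slab; first by lra.
  by move=> x /AD[/andP[sx ->] xD]; split=> //; rewrite andbT; lra.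
apply: (@le_trans _ _ ((t - (s - e / (d + 1)))%:E * d%:E)%E).
  by rewrite lee_wpmul2l// lee_fin; lra.
rewrite -EFinM -EFinD lee_fin.
have : e / (d + 1) * d <= e.
  by rewrite mulrAC ler_pdivrMr ?ler_pM2l//; lra.
by lra.
Qed.

End Slabs.

(** * Volumes of balls and half balls *)

Section BallVolume.
Variable R : realType.

(** The slice of the unit ball of dimension [e + 1] at height [s], in units of the unit ball of
    dimension [e]. *)
Definition cap_density (e : nat) (s : R) : R := Num.sqrt (1 - s ^+ 2) ^+ e.

(* Integrating from -2 rather than -1 makes [cap_prim] differentiable on a neighborhood of [-1, 1]. *)
Definition cap_prim (e : nat) (x : R) : R :=
  (\int[lebesgue_measure]_(t in [set` Interval (BLeft (- 2)) (BRight x)]) cap_density e t)%R.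

(** The ratio between the volumes of the unit balls of dimensions [e + 1] and [e]. *)
Definition cap_full (e : nat) : R := cap_prim e 1 - cap_prim e (-1).

Lemma continuous_cap_density e : continuous (cap_density e).
Proof.
move=> x; apply: (@continuous_comp _ _ _ (fun s : R => Num.sqrt (1 - s ^+ 2)) (fun y => y ^+ e)).
  apply: (@continuous_comp _ _ _ (fun s : R => 1 - s ^+ 2) Num.sqrt); last exact: sqrt_continuous.
  by apply: continuousB; [exact: cst_continuous|exact: exprn_continuous].
exact: exprn_continuous.
Qed.

Lemma is_derive_cap_prim e (x : R) : -2 < x ->
  is_derive x (1 : R) (cap_prim e) (cap_density e x).
Proof.
move=> ax.
have ig b c : lebesgue_measure.-integrable [set` Interval (BLeft b) (BRight c)] (EFin \o cap_density e).
  apply: continuous_compact_integrable; first exact: segment_compact.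
  by apply: continuous_subspaceT; exact: continuous_cap_density.
have x1 : x < x + 1 by lra.
have [dF dFE] := continuous_FTC1_closed x1 (ig (-2) (x + 1)) ax (@continuous_cap_density e x).
have dF' : derivable (cap_prim e) x (1 : R) := dF.
have E : derive1 (cap_prim e) x = cap_density e x := dFE.
apply: DeriveDef; first exact: dF'.
by rewrite -derive1E E.
Qed.

Lemma continuous_cap_prim e (x : R) : -2 < x -> {for x, continuous (cap_prim e)}.
Proof.
move=> x2; apply: differentiable_continuous; apply/derivable1_diffP.
by have := is_derive_cap_prim e x2 => -[].
Qed.

Lemma cap_prim_MVT e (s t : R) : -1 <= s -> s <= t ->
  exists2 c, s <= c <= t & cap_prim e t - cap_prim e s = cap_density e c * (t - s).
Proof.
move=> s1 st.
have [||c cst ->] := @MVT_segment R (cap_prim e) (cap_density e) s t st.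
- by move=> x; rewrite in_itv/= => /andP[sx _]; apply: is_derive_cap_prim; lra.
- apply: continuous_in_subspaceT => x; rewrite inE/= in_itv/= => /andP[sx _].
  by apply: continuous_cap_prim; lra.
- by exists c.
Qed.

Lemma exprD_le (e : nat) (y d : R) : 0 <= y -> y <= 1 -> 0 <= d -> d <= 2 ->
  (y + d) ^+ e <= y ^+ e + d * (e%:R * 3 ^+ e).
Proof.
move=> y0 y1 d0 d2; elim: e => [|e IH]; first by rewrite !expr0 mul0r mulr0 addr0.
rewrite !exprS; apply: (@le_trans _ _ ((y + d) * (y ^+ e + d * (e%:R * 3 ^+ e)))).
  by rewrite ler_wpM2l//; lra.
have h3 : 1 <= (3 : R) ^+ e by apply: exprn_ege1; lra.
have ye : y ^+ e <= 1 by apply: exprn_ile1.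
have e0 : 0 <= e%:R :> R by [].
rewrite -[e.+1%:R]natr1; set X := y ^+ e in ye *; set Y := 3 ^+ e in h3 *; set E := e%:R in e0 *.
have -> : (y + d) * (X + d * (E * Y)) = y * X + d * (X + (y + d) * (E * Y)) by ring.
have -> : y * X + d * ((E + 1) * (3 * Y)) = y * X + d * (3 * Y + 3 * (E * Y)) by ring.
rewrite lerD2l ler_wpM2l// lerD//; first by lra.
by rewrite ler_wpM2r ?mulr_ge0//; lra.
Qed.

(** The radicands differ by at most 2 |s - u| <= d^2, and the square root turns this into [d].
    Unlike a Lipschitz bound, this survives at the poles, where the profile of the ball has infinite
    slope. *)
Lemma sqrt_circle_le (s u d : R) : `|s| <= 1 -> `|u| <= 1 -> 0 <= d ->
  2 * `|s - u| <= d ^+ 2 ->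
  Num.sqrt (1 - u ^+ 2) <= Num.sqrt (1 - s ^+ 2) + d.
Proof.
move=> s1 u1 d0 h.
rewrite -ler_sqr ?nnegrE ?addr_ge0 ?sqrtr_ge0// sqrrD.
have sq (v : R) : `|v| <= 1 -> 0 <= 1 - v ^+ 2.
  by move=> v1; rewrite subr_ge0 -real_normK ?num_real// exprn_ile1.
rewrite !sqr_sqrtr ?sq//.
have h1 : 0 <= Num.sqrt (1 - s ^+ 2) * d by rewrite mulr_ge0// sqrtr_ge0.
have h2 : s ^+ 2 - u ^+ 2 <= 2 * `|s - u|.
  rewrite subr_sqr mulrC; apply: le_trans (ler_norm _) _; rewrite normrM ler_wpM2r//.
  by apply: le_trans (ler_normD _ _) _; lra.
rewrite mulr2n; lra.
Qed.

Lemma dotp_behead (n : nat) (x : 'rV[R]_n.+2) :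
  dotp x x = x 0 0 ^+ 2 + dotp (row_behead x) (row_behead x).
Proof.
rewrite /dotp big_ord_recl expr2; congr (_ + _).
by apply: eq_bigr => i _; rewrite !mxE.
Qed.

Lemma eclosed_ball_dilate (n : nat) (r : R) : 0 < r ->
  eclosed_ball (0 : 'rV[R]_n.+1) r = [set r *: x | x in eclosed_ball 0 1].
Proof.
move=> r0; apply/seteqP; split=> [x|_ [x /= x1 <-]].
  rewrite /eclosed_ball/= subr0 => xr; exists (r^-1 *: x).
    by rewrite /= subr0 enormZ ger0_norm ?invr_ge0 ?(ltW r0)// mulrC ler_pdivrMr ?mul1r.
  by rewrite scalerA divff ?scale1r// gt_eqF.
rewrite /eclosed_ball/= !subr0 in x1 *.
by rewrite enormZ ger0_norm ?(ltW r0)// -[leRHS]mulr1 ler_pM2l.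
Qed.

Section Sections.
Variables (n : nat) (kappa : R).
Hypothesis kappa_ball :
  (outer_lebesgue (eclosed_ball (0 : 'rV[R]_n.+1) 1) <= kappa%:E)%E.
Variable W : set 'rV[R]_n.+2.
Hypothesis W_ball : W `<=` eclosed_ball 0 1.

Let kappa_ge0 : 0 <= kappa.
Proof. by rewrite -lee_fin; apply: le_trans kappa_ball; exact: outer_lebesgue_ge0. Qed.

Let ball_r (r : R) : 0 < r ->
  (outer_lebesgue (eclosed_ball (0 : 'rV[R]_n.+1) r) <= (r ^+ n.+1 * kappa)%:E)%E.
Proof.
move=> r0; rewrite eclosed_ball_dilate// outer_lebesgue_dilate// EFinM.
by rewrite lee_pmul2l// lte_fin exprn_gt0.
Qed.

(** A thin slab lies in a cylinder over a ball of radius [M] of one dimension less. The mean value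
    theorem expresses the integral of [cap_density] by its value at some [c] in [s, t], and [M]
    exceeds the radius at height [c] by at most [2 * d]. *)
Let slab_le (s t d : R) : -1 <= s -> s <= t -> t <= 1 -> 0 < d -> d <= 1 ->
  2 * (t - s) <= d ^+ 2 ->
  (outer_lebesgue (W `&` [set x | (s <= x 0 0 <= t)%R]) <=
   (kappa * (cap_prim n.+1 t - cap_prim n.+1 s) +
    (t - s) * (kappa * (2 * d * (n.+1%:R * 3 ^+ n.+1))))%:E)%E.
Proof.
move=> s1 st t1 d0 d1 std.
have [c /andP[sc ct] ->] := cap_prim_MVT n.+1 s1 st.
pose M := Num.sqrt (1 - s ^+ 2) + d.
have M0 : 0 < M by rewrite ltr_wpDl// sqrtr_ge0.
apply: le_trans (@outer_lebesgue_closed_slab _ _ _ (eclosed_ball 0 M) s t (M ^+ n.+1 * kappa) st (ball_r M0) _) _.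
  move=> x [/W_ball]; rewrite /eclosed_ball/= !subr0 => x1 /andP[sx xt].
  split; first by rewrite sx.
  apply: le_trans (_ : Num.sqrt (1 - x 0 0 ^+ 2) <= _).
    rewrite /enorm ler_wsqrtr// lerBrDl -dotp_behead -enormE.
    by rewrite exprn_ile1// enorm_ge0.
  apply: sqrt_circle_le; rewrite ?ler_norml; try lra; try (apply/andP; split; lra).
  by rewrite distrC ger0_norm ?subr_ge0//; apply: le_trans std; lra.
have Mc : M <= Num.sqrt (1 - c ^+ 2) + 2 * d.
  rewrite mulrDl mul1r addrA lerD2r.
  apply: sqrt_circle_le; rewrite ?ler_norml; try lra; try (apply/andP; split; lra).
  by rewrite ger0_norm ?subr_ge0//; apply: le_trans std; lra.
have Me : M ^+ n.+1 <= cap_density n.+1 c + 2 * d * (n.+1%:R * 3 ^+ n.+1).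
  apply: (@le_trans _ _ ((Num.sqrt (1 - c ^+ 2) + 2 * d) ^+ n.+1)).
    by apply: lerXn2r => //; rewrite nnegrE; [exact: ltW|exact: le_trans (ltW M0) Mc].
  apply: exprD_le; [exact: sqrtr_ge0| |lra|lra].
  by rewrite -[leRHS]sqrtr1 ler_wsqrtr// lerBlDr lerDl sqr_ge0.
rewrite lee_fin.
apply: le_trans (_ : (t - s) * ((cap_density n.+1 c + 2 * d * (n.+1%:R * 3 ^+ n.+1)) * kappa) <= _).
  by rewrite ler_wpM2l ?subr_ge0// ler_wpM2r.
by rewrite le_eqVlt; apply/orP; left; apply/eqP; ring.
Qed.

(** A Riemann sum over thin slabs: the errors in [slab_le] are proportional to the thickness, so
    they add up to at most [2 * (d * K)]. *)
Lemma outer_lebesgue_ball_sections (a b : R) : -1 <= a -> a <= b -> b <= 1 ->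
  (forall x, W x -> a <= x 0 0 <= b) ->
  (outer_lebesgue W <= (kappa * (cap_prim n.+1 b - cap_prim n.+1 a))%:E)%E.
Proof.
move=> a1 ab b1 Wab; apply/lee_addgt0Pr => e e0.
pose K := kappa * (2 * (n.+1%:R * 3 ^+ n.+1)).
have K0 : 0 <= K by rewrite !mulr_ge0// exprn_ge0.
pose d := Num.min 1 (e / (2 * K + 1)).
have d0 : 0 < d by rewrite lt_min ltr01 divr_gt0//; lra.
have d1 : d <= 1 by rewrite ge_min lexx.
have dK : 2 * (d * K) <= e.
  have : d <= e / (2 * K + 1) by rewrite ge_min lexx orbT.
  by rewrite ler_pdivlMr; last lra; nra.
(* Since [b - a <= 2], with this number of slabs the thickness [h] satisfies [2 * h <= d ^+ 2]. *)
pose L := (Num.trunc (4 / d ^+ 2)).+1.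
have L0 : 0 < L%:R :> R by [].
have LL : 4 / d ^+ 2 < L%:R by apply: truncnS_gt.
pose h := (b - a) / L%:R.
have h0 : 0 <= h by rewrite divr_ge0// subr_ge0.
have hd : 2 * h <= d ^+ 2.
  move: LL; rewrite ltr_pdivrMr ?exprn_gt0// => LL.
  by rewrite /h mulrA ler_pdivrMr// mulrC [leRHS]mulrC; lra.
have hL : h * L%:R = b - a by rewrite divfK// gt_eqF.
have H (k : nat) : (k <= L)%N ->
  (outer_lebesgue (W `&` [set x | (x 0 0 <= a + k%:R * h)%R]) <=
   (kappa * (cap_prim n.+1 (a + k%:R * h) - cap_prim n.+1 a) + k%:R * h * (d * K))%:E)%E.
  elim: k => [_|k IH kL].
    rewrite !mul0r addr0 subrr mulr0 add0r.
    apply: le_trans (le_outer_lebesgue (y := W `&` [set x | (a <= x 0 0 <= a)%R]) _) _.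
      by move=> x [Wx /= xa]; split=> //=; rewrite xa andbT; have /andP[] := Wab _ Wx.
    apply: le_trans (slab_le a1 (lexx a) _ d0 d1 _) _; [lra| |].
      by rewrite subrr mulr0 sqr_ge0.
    by rewrite !subrr mulr0 mul0r addr0.
  have kh : a + k.+1%:R * h <= b.
    apply: (@le_trans _ _ (a + L%:R * h)); last by rewrite mulrC hL; lra.
    by rewrite lerD2l ler_wpM2r// ler_nat.
  have kh0 : 0 <= k%:R * h by rewrite mulr_ge0.
  apply: le_trans (le_outer_lebesgue (y := (W `&` [set x | (x 0 0 <= a + k%:R * h)%R]) `|`
     (W `&` [set x | (a + k%:R * h <= x 0 0 <= a + k.+1%:R * h)%R])) _) _.
    move=> x [Wx /= xk]; have [|] := leP (x 0 0) (a + k%:R * h); first by left.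
    by move=> /ltW xk'; right; split=> //=; rewrite xk'.
  apply: le_trans (outer_measureU2 _ _ _) _.
  have kS : k.+1%:R * h = k%:R * h + h by rewrite -[k.+1%:R]natr1 mulrDl mul1r.
  have s1 : -1 <= a + k%:R * h by lra.
  have st : a + k%:R * h <= a + k.+1%:R * h by rewrite kS; lra.
  have t1 : a + k.+1%:R * h <= 1 by lra.
  have hd' : 2 * (a + k.+1%:R * h - (a + k%:R * h)) <= d ^+ 2 by rewrite kS; lra.
  apply: le_trans (leeD (IH (ltnW kL)) (slab_le s1 st t1 d0 d1 hd')) _.
  rewrite -EFinD lee_fin le_eqVlt; apply/orP; left; apply/eqP.
  by rewrite kS /K; ring.
apply: le_trans (le_outer_lebesgue (y := W `&` [set x | (x 0 0 <= a + L%:R * h)%R]) _) _.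
  by move=> x Wx; split=> //=; rewrite mulrC hL; have := Wab _ Wx; lra.
apply: le_trans (H L (leqnn _)) _.
rewrite [L%:R * h]mulrC hL (_ : a + (b - a) = b); last by ring.
rewrite -EFinD lee_fin lerD2l.
have ba2 : b - a <= 2 by lra.
have : (b - a) * (d * K) <= 2 * (d * K) by rewrite ler_wpM2r// mulr_ge0// ltW.
by lra.
Qed.

End Sections.

(** The volume of the unit ball of dimension [n + 1], built up one dimension at a time. *)
Definition ball_const (n : nat) : R := \prod_(e < n.+1) cap_full e.

(** The unit half ball of dimension [n + 2]: the first coordinate runs over [-1, 0] and the slices
    are full balls. [prod_cap_mass] recovers the same product as the mass of the target of the
    Knothe map. *)
Definition half_ball_const (n : nat) : R :=
  (cap_prim n.+1 0 - cap_prim n.+1 (-1)) * ball_const n.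

Lemma cap_full0 : cap_full 0 = 2.
Proof.
have [|c _] := @cap_prim_MVT 0 (-1) 1 (lexx _); first by lra.
by rewrite /cap_full => ->; rewrite /cap_density expr0; ring.
Qed.

Lemma outer_lebesgue_unit_ball (n : nat) :
  (outer_lebesgue (eclosed_ball (0 : 'rV[R]_n.+1) 1) <= (ball_const n)%:E)%E.
Proof.
elim: n => [|n IH].
  rewrite /ball_const big_ord1 cap_full0; apply/lee_addgt0Pr => e e0.
  pose p : 'rV[R]_1 * 'rV[R]_1 := (const_mx (-1 - e), const_mx 1).
  apply: le_trans (le_outer_lebesgue (y := box p) _) _.
    move=> x; rewrite /eclosed_ball/= subr0 => x1 i; rewrite !mxE.
    have := le_trans (coord_le_enorm x i) x1; rewrite ler_norml => /andP[? ->].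
    by rewrite andbT; lra.
  apply: le_trans (outer_lebesgue_box _) _.
  rewrite /box_volume big_ord1 !mxE/= -EFinD lee_fin ge_max; apply/andP; split; lra.
rewrite /ball_const big_ord_recr/= mulrC -/(ball_const n).
rewrite mulrC; apply: (outer_lebesgue_ball_sections IH) => //.
move=> x; rewrite /eclosed_ball/= subr0 => x1.
by have := le_trans (coord_le_enorm x 0) x1; rewrite ler_norml.
Qed.

Lemma outer_lebesgue_half_ball (n : nat) :
  (outer_lebesgue (eclosed_ball (0 : 'rV[R]_n.+2) 1 `&` [set x | (x 0 0 <= 0)%R])
   <= (half_ball_const n)%:E)%E.
Proof.
rewrite /half_ball_const mulrC.
apply: (outer_lebesgue_ball_sections (outer_lebesgue_unit_ball n)) => //.
move=> x []; rewrite /eclosed_ball/= subr0 => x1 ->; rewrite andbT.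
by have := le_trans (coord_le_enorm x 0) x1; rewrite ler_norml => /andP[].
Qed.

End BallVolume.

(** * Orthogonal invariance *)

Section OrthogonalInvariance.
Variables (R : realType) (n : nat).
Local Notation V := 'rV[R]_n.+1.
Local Notation mu := (@outer_lebesgue R n).
Implicit Types (x y a : V) (A : set V).

(** A symmetric involution is orthogonal and its own inverse, so an inequality for the images of all
    sets gives the reverse one at once. *)
Definition reflection_mx (O : 'M[R]_n.+1) := O^T = O /\ O *m O = 1%:M.

Lemma dotpE x y : dotp x y = (x *m y^T) 0 0.
Proof. by rewrite mxE; apply: eq_bigr => i _; rewrite mxE. Qed.

Lemma dotp_mulmx (O : 'M[R]_n.+1) x y : dotp (x *m O) y = dotp x (y *m O^T).
Proof. by rewrite !dotpE trmx_mul trmxK mulmxA. Qed.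

(** The reflection in the hyperplane orthogonal to the difference [w] exchanges [a] and the first
    basis vector. When [w] is 0 the identity does. *)
Lemma householder a : enorm a = 1 ->
  exists2 O : 'M[R]_n.+1, reflection_mx O & a *m O = delta_mx 0 0.
Proof.
move=> a1; pose w : V := a - delta_mx 0 0.
have wE : w = a - delta_mx 0 0 by [].
clearbody w.
have [w0|w0] := eqVneq w 0.
  exists 1%:M; first by split; [exact: trmx1|rewrite mulmx1].
  by rewrite mulmx1; apply/eqP; rewrite -subr_eq0 -wE w0.
have ww : 0 < dotp w w by rewrite dotpp_gt0.
pose c := 2 / dotp w w.
have wwE : w *m w^T = (dotp w w)%:M.
  by apply/matrixP => i j; rewrite !ord1 -dotpE mxE eqxx mulr1n.
have cw : c * dotp w w = 2 by rewrite /c divfK// gt_eqF.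
exists (1%:M - c *: (w^T *m w)).
  split.
    by rewrite linearB/= linearZ/= trmx1 trmx_mul trmxK.
  rewrite mulmxBl mul1mx -scalemxAl mulmxBr mulmx1 -scalemxAr scalerBr.
  rewrite (_ : w^T *m w *m (w^T *m w) = dotp w w *: (w^T *m w)); last first.
    by rewrite mulmxA -(mulmxA w^T) wwE mul_mx_scalar -scalemxAl.
  rewrite !scalerA -mulrA cw (_ : c * 2 = c + c); last by ring.
  by rewrite scalerDl opprB addrK subrK.
rewrite mulmxBr mulmx1 -scalemxAr mulmxA.
have -> : a *m w^T = (dotp a w)%:M.
  by apply/matrixP => i j; rewrite !ord1 -dotpE mxE eqxx mulr1n.
have aw : 2 * dotp a w = dotp w w.
  rewrite wE !dotpBl !dotpBr !dotp_delta -(enormE a) a1 (dotpC _ a) !dotp_delta.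
  by rewrite !mxE !eqxx /=; ring.
rewrite mul_scalar_mx scalerA (_ : c * dotp a w = 1); last first.
  by rewrite /c mulrAC aw divff// gt_eqF.
by rewrite scale1r wE opprB addrC subrK.
Qed.

Section Reflection.
Variable O : 'M[R]_n.+1.
Hypothesis O_refl : reflection_mx O.
Let f x := x *m O.

Lemma mulmx_reflectionK : involutive (fun x : V => x *m O).
Proof. by move=> x; rewrite -mulmxA O_refl.2 mulmx1. Qed.

Lemma dotp_reflection x y : dotp (x *m O) (y *m O) = dotp x y.
Proof. by rewrite dotp_mulmx O_refl.1 mulmx_reflectionK. Qed.

Lemma enorm_reflection x : enorm (x *m O) = enorm x.
Proof. by rewrite /enorm dotp_reflection. Qed.

Let cube (a : V) (s : R) : set V := [set x | forall i, a 0 i <= x 0 i <= a 0 i + s].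

Let cube_dilate a s : 0 < s -> cube a s = translate a [set s *: x | x in cube 0 1].
Proof.
move=> s0; apply/seteqP; split=> [x xa|_ [_ [x x1 <-] <-] i]; last first.
  by have := x1 i; rewrite !mxE add0r lerDl lerD2l => /andP[x0 x1']; rewrite mulr_ge0 ?(ltW s0)//= ger_pMr.
exists (x - a); last by rewrite addrC subrK.
exists (s^-1 *: (x - a)); last by rewrite scalerA divff ?scale1r// gt_eqF.
move=> i; have := xa i; rewrite !mxE => /andP[? ?].
rewrite add0r mulr_ge0 ?invr_ge0 ?subr_ge0 ?(ltW s0)//=.
by rewrite mulrC ler_pdivrMr// mul1r lerBlDl.
Qed.

(** The factor by which [f] scales cubes, hence boxes. It is bounded by 1 through the invariance of
    the ball, without any determinant. *)
Let c0 := mu (f @` cube 0 1).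

Let mu_cube a s : 0 < s -> (mu (cube a s) <= (s ^+ n.+1)%:E)%E.
Proof.
move=> s0; rewrite cube_dilate// outer_lebesgue_translate outer_lebesgue_dilate//.
rewrite -[leRHS]mule1 lee_pmul2l// ?lte_fin ?exprn_gt0//.
apply/lee_addgt0Pr => e e0.
have [d d0 /(_ (d / 2)) h] : exists2 d : R, 0 < d & forall t, 0 <= t -> t < d ->
    \prod_(i < n.+1) (1 + t) <= \prod_(i < n.+1) (1 + 0) + e.
  apply: (@continuous_eventually_le _ (fun t => \prod_(i < n.+1) (1 + t))) => //.
  by apply: continuous_prodr => i _ x; apply: cvgD; [exact: cvg_cst|exact: cvg_id].
apply: (@le_trans _ _ (mu (box (const_mx (- (d / 2)), const_mx 1)))).
  apply: le_outer_lebesgue => x x1 i; have := x1 i; rewrite !mxE add0r => /andP[? ->].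
  by rewrite andbT; lra.
apply: le_trans (outer_lebesgue_box _) _; rewrite -EFinD lee_fin /box_volume.
apply: (@le_trans _ _ (\prod_(i < n.+1) (1 + d / 2))).
  rewrite le_eqVlt; apply/orP; left; apply/eqP; apply: eq_bigr => i _.
  by rewrite !mxE/= opprK max_r//; lra.
apply: le_trans (h _ _) _; [lra|lra|].
by rewrite addr0 big1_eq.
Qed.

Let mu_cube01 : mu (cube 0 1) = 1%E.
Proof.
apply/eqP; rewrite eq_le; apply/andP; split.
  by have := mu_cube 0 (@ltr01 R); rewrite expr1n.
apply: le_trans (@outer_lebesgue_unit_cube R n) _; apply: le_outer_lebesgue.
by move=> x x1 i; rewrite mxE add0r.
Qed.

Let mu_f_cube a s : 0 < s -> mu (f @` cube a s) = ((s ^+ n.+1)%:E * c0)%E.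
Proof.
move=> s0; rewrite cube_dilate//.
rewrite (_ : f @` _ = translate (f a) [set s *: x | x in f @` cube 0 1]).
  by rewrite outer_lebesgue_translate outer_lebesgue_dilate.
apply/seteqP; split=> [_ [_ [_ [x x1 <-] <-] <-]|_ [_ [_ [x x1 <-] <-] <-]].
  exists (s *: f x); first by exists (f x) => //; exists x.
  by rewrite /f mulmxDl scalemxAl.
exists (a + s *: x); first by exists (s *: x) => //; exists x.
by rewrite /f mulmxDl scalemxAl.
Qed.

Let c0_fin : (c0 <= ((2 * n.+1%:R) ^+ n.+1)%:E)%E.
Proof.
apply: le_trans (mu_cube (const_mx (- n.+1%:R)) _); last by rewrite mulr_gt0.
apply: le_outer_lebesgue => _ [x x1 <-] i; rewrite mxE.
have : `|f x 0 i| <= n.+1%:R.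
  apply: le_trans (coord_le_enorm _ _) _; rewrite /f enorm_reflection.
  rewrite -[leRHS]mulr1; apply: enorm_le_coord => j.
  by have := x1 j; rewrite mxE add0r => /andP[? ?]; rewrite ger0_norm.
by rewrite ler_norml => /andP[? ?]; apply/andP; split=> //; lra.
Qed.

(** Cubes of side 1 / L cover the box, and their total volume tends to that of the box as L grows;
    the image of each cube costs [c0] times its volume. *)
Let mu_f_box (p : V * V) : (mu (f @` box p) <= c0 * (box_volume p)%:E)%E.
Proof.
have c0E : c0 = (fine c0)%:E.
  rewrite fineK// ge0_fin_numE ?outer_lebesgue_ge0//.
  by apply: le_lt_trans c0_fin _; rewrite ltry.
have fc0 : 0 <= fine c0 by rewrite fine_ge0// outer_lebesgue_ge0.
apply/lee_addgt0Pr => e e0.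
pose l i := Num.max 0 (p.2 0 i - p.1 0 i).
have l0 i : 0 <= l i by rewrite le_max lexx.
have e1 : 0 < e / (fine c0 + 1) by rewrite divr_gt0//; lra.
have [d d0 h] : exists2 d : R, 0 < d & forall t, 0 <= t -> t < d ->
    \prod_i (l i + t) <= \prod_i (l i + 0) + e / (fine c0 + 1).
  apply: (@continuous_eventually_le _ (fun t => \prod_i (l i + t))) => //.
  by apply: continuous_prodr => i _ x; apply: cvgD; [exact: cvg_cst|exact: cvg_id].
pose L := (Num.trunc d^-1).+1.
have L0 : 0 < L%:R :> R by [].
have Ld : L%:R^-1 < d by rewrite invf_plt//; apply: truncnS_gt.
pose K i := (Num.trunc (l i * L%:R)).+1.
pose I := {dffun forall i : 'I_n.+1, 'I_(K i)}.
pose corner (k : I) : V := \row_i (p.1 0 i + (k i)%:R / L%:R).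
have cov : f @` box p `<=` \bigcup_(k in [set` enum I]) (f @` cube (corner k) L%:R^-1).
  move=> _ [x xp <-].
  have x1 i : 0 <= (x 0 i - p.1 0 i) * L%:R.
    by rewrite mulr_ge0// subr_ge0; have /andP[/ltW] := xp i.
  have kP i : (Num.trunc ((x 0 i - p.1 0 i) * L%:R)%R < K i)%N.
    rewrite ltnS; apply: le_truncn; rewrite ler_pM2r// /l le_max.
    by have /andP[_ ?] := xp i; rewrite lerD2r; apply/orP; right.
  exists [ffun i => Ordinal (kP i)]; first by rewrite /= mem_enum.
  exists x => // i; rewrite mxE ffunE/=.
  have := truncn_itv (x1 i) => /andP[]; set k := Num.trunc _.
  rewrite -ler_pdivrMr// -ltr_pdivlMr// (_ : k.+1%:R / L%:R = k%:R / L%:R + L%:R^-1); last first.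
    by rewrite -[k.+1%:R]natr1 mulrDl mul1r.
  move=> h1 h2.
  by apply/andP; split; lra.
apply: le_trans (outer_lebesgue_finite_cover cov) _.
under eq_bigr do rewrite mu_f_cube ?invr_gt0//.
rewrite c0E -!EFinM sumEFin big_enum /= sumr_const -EFinD lee_fin.
have cardI : #|I|%:R = \prod_i (K i)%:R :> R.
  rewrite card_dep_ffun foldrE big_image/= natr_prod.
  by apply: eq_bigr => i _; rewrite card_ord.
have cardL : #|I|%:R * L%:R^-1 ^+ n.+1 <= box_volume p + e / (fine c0 + 1).
  rewrite cardI (_ : L%:R^-1 ^+ n.+1 = \prod_(i < n.+1) L%:R^-1); last by rewrite prodr_const card_ord.
  rewrite -big_split/=; apply: le_trans (_ : \prod_i (l i + L%:R^-1) <= _).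
    apply: ler_prod => i _; rewrite mulr_ge0 ?invr_ge0//= ler_pdivrMr// mulrDl mulVf ?gt_eqF//.
    rewrite /K -[X in X%:R]addn1 natrD lerD2r truncn_le//.
    by rewrite mulr_ge0.
  apply: le_trans (h _ _ Ld) _; first by rewrite invr_ge0.
  by rewrite lerD2r le_eqVlt; apply/orP; left; apply/eqP/eq_bigr => i _; rewrite addr0.
rewrite -[leLHS]mulr_natl [leLHS]mulrA.
apply: le_trans (_ : (box_volume p + e / (fine c0 + 1)) * fine c0 <= _).
  by rewrite ler_wpM2r.
rewrite mulrDl [_ * fine c0]mulrC lerD2l mulrAC ler_pdivrMr ?ler_pM2l//; lra.
Qed.

(** The maximum with 1 makes the constant positive, as [outer_lebesgue_map] requires. It equals [c0]
    while [c0 > 1] is being refuted, and 1 afterwards. *)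
Let f_le A : (mu (f @` A) <= (Num.max (fine c0) 1)%:E * mu A)%E.
Proof.
have c0E : c0 = (fine c0)%:E.
  rewrite fineK// ge0_fin_numE ?outer_lebesgue_ge0//.
  by apply: le_lt_trans c0_fin _; rewrite ltry.
apply: (@outer_lebesgue_map _ _ _ _ _ _ (fun p => f @` box p)).
- by rewrite lt_max ltr01 orbT.
- move=> p; apply: le_trans (mu_f_box p) _; rewrite c0E.
  by rewrite -!EFinM lee_fin ler_wpM2r ?box_volume_ge0// le_max lexx.
- by move=> q qA _ [x /qA[k _ xk] <-]; exists k => //; exists x.
Qed.

Let ball := eclosed_ball (0 : V) 1.

Let f_ball : f @` ball = ball.
Proof.
apply/seteqP; split=> [_ [x x1 <-]|x x1].
  by rewrite /ball/eclosed_ball/= subr0 /f enorm_reflection -[x]subr0.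
exists (f x); last exact: mulmx_reflectionK.
by move: x1; rewrite /ball/eclosed_ball/= !subr0 /f enorm_reflection.
Qed.

Let mu_ball_gt0 : (0 < mu ball)%E.
Proof.
have N0 : 0 < n.+1%:R^-1 :> R by rewrite invr_gt0.
have := @outer_lebesgue_dilate R n n.+1%:R^-1 (cube 0 1) N0.
rewrite mu_cube01 mule1 => h.
apply: (@lt_le_trans _ _ (mu [set n.+1%:R^-1 *: x | x in cube 0 1])).
  by rewrite h lte_fin exprn_gt0.
apply: le_outer_lebesgue => _ [x x1 <-]; rewrite /ball/eclosed_ball/= subr0.
rewrite enormZ ger0_norm ?(ltW N0)// mulrC ler_pdivrMr// mul1r -[leRHS]mulr1.
apply: enorm_le_coord => i; have := x1 i; rewrite mxE add0r => /andP[? ?].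
by rewrite ger0_norm.
Qed.

(** Since [f] maps the ball onto itself, c0 |Q| is at most |ball| + c0 |Q - ball| for a cube [Q]
    around the ball. As the ball has positive finite measure, a factor above 1 is impossible. *)
Let c0_le1 : (c0 <= 1)%E.
Proof.
rewrite leNgt; apply/negP => c1.
pose Q := cube (const_mx (-1)) 2.
have QB : ball `<=` Q.
  move=> x; rewrite /ball/eclosed_ball/= subr0 => x1 i; rewrite mxE.
  have := le_trans (coord_le_enorm x i) x1; rewrite ler_norml => /andP[-> ?] /=; lra.
have c0E : c0 = (fine c0)%:E.
  rewrite fineK// ge0_fin_numE ?outer_lebesgue_ge0//.
  by apply: le_lt_trans c0_fin _; rewrite ltry.
have muQ : (mu Q <= (2 ^+ n.+1)%:E)%E by apply: mu_cube.
have mball : lebesgue_measurable ball.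
  by apply: closed_lebesgue_measurable; exact: closed_eclosed_ball.
have QE : mu Q = (mu ball + mu (Q `\` ball))%E.
  by rewrite [LHS](mball Q); congr (mu _ + _)%E; exact/setIidr.
have fQ : ((2 ^+ n.+1)%:E * c0 <= mu ball + c0 * mu (Q `\` ball))%E.
  rewrite -(mu_f_cube (const_mx (-1))) ?ltr0Sn//.
  apply: le_trans (le_outer_lebesgue (y := (f @` ball) `|` (f @` (Q `\` ball))) _) _.
    move=> _ [x xQ <-]; have [xb|xb] := pselect (ball x); [left|right]; exists x => //.
  apply: le_trans (outer_measureU2 _ _ _) _; rewrite f_ball leeD2l//.
  by apply: le_trans (f_le _) _; rewrite max_l -?c0E// ltW// -lte_fin -c0E.
have bfin : mu ball \is a fin_num.
  rewrite ge0_fin_numE ?outer_lebesgue_ge0//; apply: le_lt_trans (le_outer_lebesgue QB) _.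
  by apply: le_lt_trans muQ _; rewrite ltry.
have dfin : mu (Q `\` ball) \is a fin_num.
  rewrite ge0_fin_numE ?outer_lebesgue_ge0//.
  apply: le_lt_trans (le_outer_lebesgue (y := Q) _) _; first by move=> x [].
  by apply: le_lt_trans muQ _; rewrite ltry.
move: muQ fQ mu_ball_gt0 c1; rewrite QE c0E.
rewrite -(fineK bfin) -(fineK dfin) -!EFinM -!EFinD !lee_fin !lte_fin.
set b := fine (mu ball); set q := fine (mu (Q `\` ball)); set c := fine c0.
move=> h1 h2 h3 h4.
have : (b + q) * c <= 2 ^+ n.+1 * c by rewrite ler_wpM2r//; lra.
nra.
Qed.

Lemma outer_lebesgue_reflection A : mu [set x *m O | x in A] = mu A.
Proof.
have le B : (mu (f @` B) <= mu B)%E.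
  apply: le_trans (f_le _) _; rewrite max_r ?mul1e// -lee_fin fineK ?c0_le1//.
  by rewrite ge0_fin_numE ?outer_lebesgue_ge0// (le_lt_trans c0_le1) ?ltry.
apply/eqP; rewrite eq_le le /=.
apply: le_trans (le (f @` A)); apply: le_outer_lebesgue => x Ax.
by exists (f x); [exists x|exact: mulmx_reflectionK].
Qed.

End Reflection.
End OrthogonalInvariance.

(** * Scalar functions of class C^k *)

Section ScalarCk.
Variables (R : realType) (V : normedModType R).
Implicit Types (f g : V -> R) (k : nat).

(** The scalar counterpart of [Ck]: by [Ck_coord] and [Ck_coordP] the smoothness of a field is
    checked on its coordinates, where products and compositions are available. *)
Fixpoint Cks k f : Prop :=
  if k is k'.+1 then (forall x, differentiable f x) /\ (forall v, Cks k' ('D_v f))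
  else continuous f.

Lemma Cks_continuous k f : Cks k f -> continuous f.
Proof. by case: k => [//|k] [df _] x; exact: differentiable_continuous. Qed.

Lemma CksS k f : Cks k.+1 f -> Cks k f.
Proof.
elim: k f => [|k IH] f; first exact: Cks_continuous.
by move=> [df Df]; split=> // v; exact: IH.
Qed.

Lemma Cks_cst k (c : R) : Cks k (fun=> c).
Proof.
elim: k c => [|k IH] c; first by move=> x; exact: cvg_cst.
split=> [x|v]; first exact: differentiable_cst.
rewrite (_ : 'D_v _ = fun=> 0)//; apply/funext => x.
exact: (@derive_cst _ _ _ c).
Qed.

Lemma CksD k f g : Cks k f -> Cks k g -> Cks k (fun x => f x + g x).
Proof.
elim: k f g => [|k IH] f g; first by move=> cf cg x; apply: cvgD; [exact: cf|exact: cg].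
move=> [df Df] [dg Dg]; split=> [x|v]; first exact: differentiableD.
rewrite (_ : 'D_v _ = fun x => 'D_v f x + 'D_v g x).
  by apply: IH; [exact: Df|exact: Dg].
by apply/funext => x; apply: deriveD; exact: diff_derivable.
Qed.

Lemma CksM k f g : Cks k f -> Cks k g -> Cks k (fun x => f x * g x).
Proof.
elim: k f g => [|k IH] f g; first by move=> cf cg x; apply: cvgM; [exact: cf|exact: cg].
move=> Cf Cg; have [df Df] := Cf; have [dg Dg] := Cg.
split=> [x|v]; first exact: differentiableM.
rewrite (_ : 'D_v _ = fun x => f x * 'D_v g x + g x * 'D_v f x); last first.
  by apply/funext => x; rewrite -[RHS]/(f x *: _ + g x *: _) -deriveM//; exact: diff_derivable.
by apply: CksD; apply: IH; [exact: CksS|exact: Dg|exact: CksS|exact: Df].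
Qed.

Lemma CksZ k (c : R) f : Cks k f -> Cks k (fun x => c * f x).
Proof. by move=> Cf; apply: CksM => //; exact: Cks_cst. Qed.

Lemma CksN k f : Cks k f -> Cks k (fun x => - f x).
Proof.
move=> Cf; rewrite (_ : (fun x => _) = fun x => -1 * f x); first exact: CksZ.
by apply/funext => x; rewrite mulN1r.
Qed.

Lemma CksB k f g : Cks k f -> Cks k g -> Cks k (fun x => f x - g x).
Proof. by move=> Cf Cg; apply: CksD => //; exact: CksN. Qed.

Lemma CksX k f m : Cks k f -> Cks k (fun x => f x ^+ m).
Proof.
move=> Cf; elim: m => [|m IH]; first exact: Cks_cst.
rewrite (_ : (fun x => _) = fun x => f x * f x ^+ m); first exact: CksM.
by apply/funext => x; rewrite exprS.
Qed.

Lemma Cks_sum k (I : Type) (s : seq I) (P : pred I) (F : I -> V -> R) :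
  (forall i, P i -> Cks k (F i)) -> Cks k (fun x => \sum_(i <- s | P i) F i x).
Proof.
move=> CF; elim: s => [|i s IH].
  rewrite (_ : (fun x => _) = fun=> 0); first exact: Cks_cst.
  by apply/funext => x; rewrite big_nil.
have [Pi|Pi] := boolP (P i); last first.
  rewrite (_ : (fun x => _) = fun x => \sum_(i <- s | P i) F i x)//.
  by apply/funext => x; rewrite big_cons (negPf Pi).
rewrite (_ : (fun x => _) = fun x => F i x + \sum_(i <- s | P i) F i x).
  by apply: CksD => //; exact: CF.
by apply/funext => x; rewrite big_cons Pi.
Qed.

Lemma Cks_prod k (I : Type) (s : seq I) (P : pred I) (F : I -> V -> R) :
  (forall i, P i -> Cks k (F i)) -> Cks k (fun x => \prod_(i <- s | P i) F i x).
Proof.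
move=> CF; elim: s => [|i s IH].
  rewrite (_ : (fun x => _) = fun=> 1); first exact: Cks_cst.
  by apply/funext => x; rewrite big_nil.
have [Pi|Pi] := boolP (P i); last first.
  rewrite (_ : (fun x => _) = fun x => \prod_(i <- s | P i) F i x)//.
  by apply/funext => x; rewrite big_cons (negPf Pi).
rewrite (_ : (fun x => _) = fun x => F i x * \prod_(i <- s | P i) F i x).
  by apply: CksM => //; exact: CF.
by apply/funext => x; rewrite big_cons Pi.
Qed.

Lemma differentiable_chain f (phi : R -> R) (x : V) (d : R) :
  differentiable f x -> is_derive (f x) (1 : R) phi d -> differentiable (phi \o f) x.
Proof.
move=> df [dphi _]; apply: differentiable_comp => //.
by apply/derivable1_diffP.
Qed.

Lemma derive_chain f (phi : R -> R) (x v : V) (d : R) :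
  differentiable f x -> is_derive (f x) (1 : R) phi d ->
  'D_v (phi \o f) x = d * 'D_v f x.
Proof.
move=> df dphi; have dd : differentiable phi (f x).
  by apply/derivable1_diffP; case: dphi.
rewrite deriveE; last exact: differentiable_comp.
rewrite diff_comp// deriveE//= diff1E// derive1E derive_val.
by rewrite -[LHS]/(_ * _) mulrC.
Qed.

(** The derivative of the outer function is often expressed by the function itself, as for the
    exponential, the inverse, the square root and [cap_inv]. The second hypothesis therefore grants
    the regularity of [phi \o f] when that of [dphi \o f] is asked for, and the induction closes. *)
Lemma Cks_comp (phi dphi : R -> R) f :
  (forall x, is_derive (f x) (1 : R) phi (dphi (f x))) ->
  (forall k, Cks k f -> Cks k (phi \o f) -> Cks k (dphi \o f)) ->
  forall k, Cks k f -> Cks k (phi \o f).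
Proof.
move=> dphiE H; elim=> [|k IH].
  move=> cf x; apply: continuous_comp; first exact: cf.
  by apply: differentiable_continuous; apply/derivable1_diffP; case: (dphiE x).
move=> Cf; have [df Df] := Cf; split=> [x|v].
  exact: differentiable_chain.
rewrite (_ : 'D_v _ = fun x => (dphi \o f) x * 'D_v f x).
  apply: (@CksM _ (dphi \o f)); last exact: Df.
  by apply: H; [exact: CksS|apply: IH; exact: CksS].
by apply/funext => x; exact: derive_chain.
Qed.

Lemma CksV k f : (forall x, f x != 0) -> Cks k f -> Cks k (fun x => (f x)^-1).
Proof.
move=> f0; apply: (@Cks_comp _ (fun y => - (y^-1 ^+ 2))).
  move=> x; have := @is_deriveV R id (f x) 1 1 (f0 x) (is_derive_id _ _).
  by move/is_derive_eq; apply; rewrite exprVn -[LHS]/(_ * _) mulr1.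
by move=> {}k Cf CV; apply: CksN; apply: CksX.
Qed.

Lemma Cks_exp k f : Cks k f -> Cks k (fun x => expR (f x)).
Proof. move=> Cf; apply: (@Cks_comp expR expR) Cf => // x; exact: is_derive_expR. Qed.

Lemma Cks_ln k f : (forall x, 0 < f x) -> Cks k f -> Cks k (fun x => ln (f x)).
Proof.
move=> f0; apply: (@Cks_comp _ (fun y => y^-1)) => [x|{}k Cf _].
  exact: is_derive1_ln.
by apply: CksV => // x; rewrite gt_eqF.
Qed.

Lemma Cks_sqrt k f : (forall x, 0 < f x) -> Cks k f -> Cks k (fun x => Num.sqrt (f x)).
Proof.
move=> f0; apply: (@Cks_comp _ (fun y => (2 * Num.sqrt y)^-1)) => [x|{}k Cf Cs].
  exact: is_derive1_sqrt.
apply: CksV; last exact: CksZ.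
by move=> x; rewrite mulf_neq0// gt_eqF// sqrtr_gt0.
Qed.

End ScalarCk.

Lemma differentiable_coord_row (R : realType) (n : nat) (f : 'rV[R]_n.+1 -> 'rV[R]_n.+1) x :
  (forall i, differentiable (fun x => f x 0 i) x) -> differentiable f x.
Proof.
move=> df.
have -> : f = \sum_(i < n.+1) (fun x => f x 0 i *: delta_mx 0 i).
  apply/funext => y; rewrite fct_sumE; apply/rowP => j; rewrite summxE (bigD1 j)//=.
  rewrite !mxE !eqxx mulr1 big1 ?addr0// => i ij.
  by rewrite !mxE eq_sym (negPf ij) andbF mulr0.
by apply: differentiable_sum => i; exact: differentiableZl.
Qed.

Lemma Ck_coord (R : realType) (n k : nat) (xi : 'rV[R]_n.+1 -> 'rV[R]_n.+1) :
  (forall i, Cks k (fun x => xi x 0 i)) -> Ck k xi.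
Proof.
elim: k xi => [|k IH] xi h.
  suff H (x : 'rV[R]_n.+1) : xi y @[y --> x] --> xi x by move=> x; exact: H.
  have FF := @nbhs_filter _ x.
  apply/cvgrPdist_lt => e e0; near=> y.
  rewrite -[ltLHS]/(mx_norm _) mx_normrE; apply: bigmax_lt => // -[i j] _ /=.
  rewrite ord1 !mxE; move: j; near: y; apply: filter_forall => j.
  by have /cvgrPdist_lt /(_ e e0) := h j x.
split=> [x|v].
  by apply: differentiable_coord_row => i; have [] := h i.
apply: IH => i; have [_ /(_ v)] := h i.
rewrite (_ : 'D_v (fun x => xi x 0 i) = fun x => ('D_v xi) x 0 i)//.
apply/funext => x; rewrite derive_mx ?mxE//.
by apply: diff_derivable; apply: differentiable_coord_row => j; have [] := h j.
Unshelve. all: by end_near. Qed.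

Lemma derive_coord (R : realType) (n : nat) (xi : 'rV[R]_n.+1 -> 'rV[R]_n.+1) (x v : 'rV[R]_n.+1) i :
  differentiable xi x -> ('D_v xi x) 0 i = 'D_v (fun y => xi y 0 i) x.
Proof. by move=> dxi; rewrite derive_mx ?mxE//; exact: diff_derivable. Qed.

Lemma Cks_coord_fun (R : realType) (n k : nat) (i : 'I_n.+1) :
  Cks k (fun x : 'rV[R]_n.+1 => x 0 i).
Proof.
case: k => [|k]; first by move=> x; exact: coord_continuous.
split=> [x|v]; first exact: differentiable_coord.
rewrite (_ : 'D_v _ = fun=> v 0 i); first exact: Cks_cst.
apply/funext => x; rewrite -(@derive_coord _ _ id); last exact: ex_diff.
by rewrite derive_id.
Qed.

Section SmoothStep.
Variable R : realType.
Implicit Types s : R.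

(** The classical flat function, multiplied by powers of 1 / s so that the span of the family is
    closed under differentiation. *)
Definition flat (j : nat) s : R := if 0 < s then s^-1 ^+ j * expR (- s^-1) else 0.

Lemma flat_ge0 j s : 0 <= flat j s.
Proof.
by rewrite /flat; case: ifPn => // s0; rewrite mulr_ge0 ?expR_ge0// exprn_ge0// invr_ge0 ltW.
Qed.

Lemma flat_gt0 j s : 0 < s -> 0 < flat j s.
Proof. by move=> s0; rewrite /flat s0 mulr_gt0 ?expR_gt0// exprn_gt0// invr_gt0. Qed.

Lemma flat_le0 j s : s <= 0 -> flat j s = 0.
Proof. by rewrite /flat ltNge => ->. Qed.

(** Write exp(1 / s) as the m-th power of exp(1 / (m s)) and bound the base from below by 1 / (m s);
    with m = j + 2 two powers of [s] are left over. *)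
Lemma flat_le_sqr j : exists2 K : R, 0 < K & forall s, flat j s <= K * s ^+ 2.
Proof.
pose m := j.+2.
exists (m%:R ^+ m); first by rewrite exprn_gt0.
move=> s; have [s0|s0] := ltP 0 s; last by rewrite flat_le0// mulr_ge0 ?sqr_ge0.
rewrite /flat s0 mulrC exprVn ler_pdivrMr ?exprn_gt0// -mulrA -exprD add2n -/m -exprMn.
have ms : 0 < m%:R * s by rewrite mulr_gt0.
rewrite expRN invf_ple ?posrE ?expR_gt0 ?exprn_gt0// -exprVn.
have -> : s^-1 = m%:R * (m%:R * s)^-1 by rewrite invfM mulrA divff ?mul1r// gt_eqF.
rewrite expRM_natl lerXn2r ?nnegrE ?expR_ge0// ?invr_ge0 ?(ltW ms)//.
by apply: le_trans (expR_ge1Dx _); rewrite lerDr.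
Qed.

Lemma is_derive_flat j s :
  is_derive s (1 : R) (flat j) (- j%:R * flat j.+1 s + flat j.+2 s).
Proof.
have [s0|s0|<-] := ltgtP 0 s.
- have H : is_derive s (1 : R) (fun t => t^-1 ^+ j * expR (- t^-1))
     (- j%:R * flat j.+1 s + flat j.+2 s).
    have sn0 : s != 0 by rewrite gt_eqF.
    have dV : is_derive s (1 : R) (fun t : R => t^-1) (- s^-1 ^+ 2).
      have := @is_deriveV R id s 1 1 sn0 (is_derive_id _ _).
      by move/is_derive_eq; apply; rewrite exprVn -[LHS]/(_ * _) mulr1.
    have dE : is_derive s (1 : R) (fun t : R => expR (- t^-1)) (expR (- s^-1) * s^-1 ^+ 2).
      apply: is_derive1_comp; have := is_deriveN dV.
      by move/is_derive_eq; apply; rewrite opprK.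
    have dX : is_derive s (1 : R) (fun t : R => t^-1 ^+ j) (- j%:R * s^-1 ^+ j.+1).
      case: (j) => [|i]; first by rewrite oppr0 mul0r; exact: is_derive_cst.
      have := is_deriveX i.+1 dV; rewrite exprfctE.
      by move/is_derive_eq; apply; rewrite -[LHS]/(_ * _) !exprS; ring.
    have := is_deriveM dX dE.
    move/is_derive_eq; apply.
    rewrite -[X in X + _ = _]/(_ * _) -[X in _ + X = _]/(_ * _) /flat s0 !exprS; ring.
  apply: near_eq_is_derive H.
  near=> t; rewrite /flat ifT//; near: t; exact: lt_nbhsr.
- rewrite !flat_le0 ?ltW// mulr0 addr0.
  apply: (@near_eq_is_derive _ _ _ (cst 0)).
  near=> t; rewrite flat_le0//; near: t; apply: filterS (lt_nbhsl s0) => t; exact: ltW.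
- rewrite !flat_le0// mulr0 addr0.
  have [K K0 HK] := flat_le_sqr j.
  (* At 0 the difference quotient of [flat j] is [flat j.+1], which tends to 0 by its quadratic
     bound. *)
  apply/is_derive1_caratheodory; exists (fun t => t^-1 * flat j t); split.
  + move=> t; rewrite (@flat_le0 _ 0)// !subr0 mulrAC.
    have [->|t0] := eqVneq t 0; first by rewrite flat_le0// mulr0.
    by rewrite mulVf// mul1r.
  + have [K' K'0 HK'] := flat_le_sqr j.+1.
    have E t : t^-1 * flat j t = flat j.+1 t.
      by rewrite /flat; case: ifP => _; rewrite ?mulr0// mulrA -exprS.
    apply/cvgrPdist_lt => e e0; near=> t.
    rewrite !E (@flat_le0 _ 0)// sub0r normrN ger0_norm ?flat_ge0//.
    apply: le_lt_trans (HK' t) _.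
    have t1 : `|t| < 1 by near: t; apply: (@nbhs0_lt _ R).
    have te : `|t| < e / K' by near: t; apply: (@nbhs0_lt _ R); rewrite divr_gt0.
    rewrite mulrC -ltr_pdivlMr//; apply: le_lt_trans te.
    rewrite -real_normK ?num_real// expr2 -[leRHS]mul1r.
    by rewrite ler_wpM2r// ltW.
  + by rewrite flat_le0// mulr0.
Unshelve. all: by end_near. Qed.

Definition smooth_step s := flat 0 s / (flat 0 s + flat 0 (1 - s)).

Definition smooth_step' s :=
  (flat 2 s * flat 0 (1 - s) + flat 0 s * flat 2 (1 - s)) /
    (flat 0 s + flat 0 (1 - s)) ^+ 2.

Lemma smooth_step_den_gt0 s : 0 < flat 0 s + flat 0 (1 - s).
Proof.
have [s0|s0] := ltP 0 s; first by rewrite ltr_wpDr ?flat_ge0// flat_gt0.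
by rewrite ltr_wpDl ?flat_ge0// flat_gt0//; lra.
Qed.

Lemma is_derive_smooth_step s : is_derive s (1 : R) smooth_step (smooth_step' s).
Proof.
have d0 := smooth_step_den_gt0 s.
have df t : is_derive t (1 : R) (flat 0) (flat 2 t).
  by have := is_derive_flat 0 t; rewrite mulr0n oppr0 mul0r add0r.
have dg : is_derive s (1 : R) (fun t => flat 0 (1 - t)) (- flat 2 (1 - s)).
  rewrite -mulrN1; apply: is_derive1_comp.
  have := is_deriveB (is_derive_cst (1 : R) s (1 : R)) (is_derive_id s (1 : R)).
  by move/is_derive_eq; apply; rewrite sub0r.
have dden := is_deriveD (df s) dg.
have := is_deriveM (df s) (@is_deriveV _ (fun t => flat 0 t + flat 0 (1 - t)) s _ 1 (lt0r_neq0 d0) dden).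
move/is_derive_eq; apply.
rewrite /smooth_step' -[X in X + _ = _]/(_ * (_ * _)) -[X in _ + X = _]/(_ * _) /=.
by field; rewrite gt_eqF.
Qed.

Lemma smooth_step_ge0 s : 0 <= smooth_step s.
Proof. by rewrite divr_ge0 ?flat_ge0// ltW// smooth_step_den_gt0. Qed.

Lemma smooth_step_le1 s : smooth_step s <= 1.
Proof. by rewrite ler_pdivrMr ?smooth_step_den_gt0// mul1r lerDl flat_ge0. Qed.

Lemma smooth_step_le0 s : s <= 0 -> smooth_step s = 0.
Proof. by move=> s0; rewrite /smooth_step (flat_le0 _ s0) mul0r. Qed.

Lemma smooth_step_ge1 s : 1 <= s -> smooth_step s = 1.
Proof.
move=> s1; rewrite /smooth_step (@flat_le0 _ (1 - s)) ?subr_le0// addr0 divff// gt_eqF//.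
by rewrite flat_gt0// (lt_le_trans ltr01).
Qed.

Lemma smooth_step'_ge0 s : 0 <= smooth_step' s.
Proof. by rewrite divr_ge0 ?sqr_ge0// addr_ge0// mulr_ge0// flat_ge0. Qed.

Lemma continuous_flat j : continuous (flat j).
Proof.
move=> s; apply: differentiable_continuous; apply/derivable1_diffP.
by have [] := is_derive_flat j s.
Qed.

Lemma smooth_step'_bounded : exists2 K : R, 0 < K & forall s, smooth_step' s <= K.
Proof.
have c : continuous smooth_step'.
  have c1 j : continuous (fun t : R => flat j (1 - t)).
    move=> x; apply: (@continuous_comp _ _ _ (fun t : R => 1 - t)).
      by apply: cvgB; [exact: cvg_cst|exact: cvg_id].
    exact: continuous_flat.
  move=> x; apply: cvgM.
    by apply: cvgD; apply: cvgM; (exact: continuous_flat || exact: c1).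
  apply: cvgV; first by rewrite expf_neq0// gt_eqF// smooth_step_den_gt0.
  apply: (@continuous_comp _ _ _ (fun s => flat 0 s + flat 0 (1 - s)) (fun y => y ^+ 2)).
    by apply: cvgD; [exact: continuous_flat|exact: c1].
  exact: exprn_continuous.
have [c01 _ h] := EVT_max (@ler01 R) (continuous_subspaceT (A := `[0 : R, 1]%classic) c).
exists (smooth_step' c01 + 1).
  by rewrite ltr_wpDl// smooth_step'_ge0.
move=> s; have [s01|s01] := boolP (s \in `[0, 1]).
  by apply: le_trans (h _ s01) _; rewrite lerDl.
rewrite [leLHS](_ : _ = 0) ?addr_ge0 ?smooth_step'_ge0//.
rewrite in_itv/= negb_and -!ltNge in s01; case/orP: s01 => s01.
  by rewrite /smooth_step' !(@flat_le0 _ s) ?ltW// !mul0r addr0 mul0r.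
by rewrite /smooth_step' !(@flat_le0 _ (1 - s)) ?mulr0 ?addr0 ?mul0r//; lra.
Qed.


End SmoothStep.

Section SmoothCompositions.
Variables (R : realType) (V : normedModType R).
Implicit Types (f : V -> R) (k : nat).

Lemma Cks_flat k j f : Cks k f -> Cks k (fun x => flat j (f x)).
Proof.
elim: k j => [|k IH] j.
  by move=> cf x; apply: continuous_comp; [exact: cf|exact: continuous_flat].
move=> Cf; have [df Df] := Cf; split=> [x|v].
  exact: (differentiable_chain (df x) (is_derive_flat j (f x))).
rewrite (_ : 'D_v _ = fun x => (- j%:R * flat j.+1 (f x) + flat j.+2 (f x)) * 'D_v f x).
  apply: CksM; last exact: Df.
  by apply: CksD; [apply: CksZ|]; apply: IH; exact: CksS.
by apply/funext => x; exact: (derive_chain _ (df x) (is_derive_flat j (f x))).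
Qed.

Lemma Cks_smooth_step k f : Cks k f -> Cks k (fun x => smooth_step (f x)).
Proof.
move=> Cf; apply: CksM; first exact: Cks_flat.
apply: CksV; first by move=> x; rewrite gt_eqF// smooth_step_den_gt0.
apply: CksD; apply: Cks_flat => //.
by apply: CksB => //; exact: Cks_cst.
Qed.

End SmoothCompositions.

(** * The Knothe map *)

Section CapInverse.
Variables (R : realType) (e : nat) (b : R).
Hypotheses (b_ge0 : 0 <= b) (b_le1 : b <= 1).
Implicit Types s t u : R.

Let b_gtN1 : -1 < b. Proof. by apply: lt_le_trans b_ge0; rewrite ltrN10. Qed.

Lemma cap_density_gt0 s : -1 < s -> s < 1 -> 0 < cap_density e s.
Proof.
move=> s1 s2; rewrite exprn_gt0// sqrtr_gt0.
have -> : 1 - s ^+ 2 = (1 - s) * (1 + s) by ring.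
by rewrite mulr_gt0//; lra.
Qed.

Lemma cap_prim_lt s t : -1 <= s -> s < t -> t <= 1 -> cap_prim e s < cap_prim e t.
Proof.
move=> s1 st t1; rewrite -subr_gt0.
have [||c] := @MVT R (cap_prim e) (cap_density e) s t st.
- by move=> x; rewrite in_itv/= => /andP[? ?]; apply: is_derive_cap_prim; lra.
- apply: continuous_in_subspaceT => x; rewrite inE/= in_itv/= => /andP[sx _].
  by apply: continuous_cap_prim; lra.
rewrite in_itv/= => /andP[sc ct] ->.
by rewrite mulr_gt0 ?subr_gt0//; apply: cap_density_gt0; lra.
Qed.

Definition cap_mass := cap_prim e b - cap_prim e (-1).

Lemma cap_mass_gt0 : 0 < cap_mass.
Proof. by rewrite subr_gt0; apply: cap_prim_lt. Qed.

Definition cap_cdf s := (cap_prim e s - cap_prim e (-1)) / cap_mass.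

(** The quantile function of the normalized density on [-1, b]. The default value 0 is taken only
    outside ]0, 1[. *)
Definition cap_inv u : R := xget 0 [set s | (-1 < s < b) /\ cap_cdf s = u].

Lemma cap_invP u : 0 < u -> u < 1 -> -1 < cap_inv u < b /\ cap_cdf (cap_inv u) = u.
Proof.
move=> u0 u1; have c0 := cap_mass_gt0.
have b1 : -1 <= b := ltW b_gtN1.
have Gb : cap_prim e (-1) < cap_prim e b by move: c0; rewrite subr_gt0.
have [||s] := @IVT R (cap_prim e) (-1) b (cap_prim e (-1) + u * cap_mass) b1.
- apply: continuous_in_subspaceT => x; rewrite inE/= in_itv/= => /andP[sx _].
  by apply: continuous_cap_prim; lra.
- have -> : Num.min (cap_prim e (-1)) (cap_prim e b) = cap_prim e (-1) by rewrite min_l// ltW.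
  have -> : Num.max (cap_prim e (-1)) (cap_prim e b) = cap_prim e b by rewrite max_r// ltW.
  have uc : u * cap_mass <= cap_mass by rewrite ger_pMl// ltW.
  rewrite lerDl mulr_ge0 ?(ltW u0) ?(ltW c0)//=.
  by move: uc; rewrite {2}/cap_mass; lra.
rewrite in_itv/= => /andP[s1 sb] sE.
apply: (@xgetPex _ 0 [set s | (-1 < s < b) /\ cap_cdf s = u]); exists s; split.
  rewrite !lt_neqAle s1 sb !andbT; apply/andP; split.
    apply: contra_neq (lt0r_neq0 (mulr_gt0 u0 c0)) => s1E.
    by move: sE; rewrite -s1E; lra.
  have : (1 - u) * cap_mass != 0 by rewrite gt_eqF// mulr_gt0// subr_gt0.
  by apply: contra_neq => sbE; move: sE; rewrite sbE mulrBl mul1r {2}/cap_mass; lra.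
rewrite /cap_cdf sE addrAC subrr add0r mulfK// gt_eqF//.
Qed.

Lemma cap_cdfK s : -1 < s -> s < b -> cap_inv (cap_cdf s) = s.
Proof.
move=> s1 sb; have c0 := cap_mass_gt0.
have cdf01 : 0 < cap_cdf s < 1.
  rewrite divr_gt0//=; last first.
    by rewrite subr_gt0 cap_prim_lt// ltW// (lt_le_trans sb).
  by rewrite ltr_pdivrMr// mul1r /cap_mass ltrD2r cap_prim_lt// ltW.
have /andP[u0 u1] := cdf01.
have [/andP[t1 tb] tE] := cap_invP u0 u1.
move: tE; rewrite {1 3}/cap_cdf => /(mulIf (invr_neq0 (lt0r_neq0 c0))) tE.
set t := cap_inv _ in t1 tb tE *.
have [st|st|//] := ltgtP s t.
- by have := @cap_prim_lt s t (ltW s1) st (le_trans (ltW tb) b_le1); lra.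
- by have := @cap_prim_lt t s (ltW t1) st (le_trans (ltW sb) b_le1); lra.
Qed.

Lemma is_derive_cap_inv u : 0 < u -> u < 1 ->
  is_derive u (1 : R) cap_inv (cap_mass / cap_density e (cap_inv u)).
Proof.
move=> u0 u1; have c0 := cap_mass_gt0.
have [/andP[t1 tb] tE] := cap_invP u0 u1.
set t := cap_inv u in t1 tb tE *.
have dF s : -1 < s -> is_derive s (1 : R) cap_cdf (cap_density e s / cap_mass).
  move=> s1.
  have s2 : -2 < s by lra.
  have := is_deriveZ cap_mass^-1 (is_deriveB (is_derive_cap_prim e s2)
    (is_derive_cst (cap_prim e (-1)) s (1 : R))).
  rewrite (_ : _ \*: _ = cap_cdf); last by apply/funext => y; rewrite /cap_cdf mulrC.
  by move/is_derive_eq; apply; rewrite subr0 mulrC.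
have d0 : 0 < cap_density e t by apply: cap_density_gt0 => //; exact: lt_le_trans tb b_le1.
have := @is_derive_inverse R cap_cdf cap_inv _ t _ _ (dF t t1) _.
rewrite tE invf_div; apply.
- near=> s; apply: cap_cdfK; near: s.
    exact: lt_nbhsr.
  exact: lt_nbhsl.
- near=> s; apply: differentiable_continuous; apply/derivable1_diffP.
  have s1 : -1 < s by near: s; exact: lt_nbhsr.
  by case: (dF s s1).
- by rewrite mulf_neq0// ?invr_eq0 gt_eqF.
Unshelve. all: by end_near. Qed.

End CapInverse.

Lemma derive_line (R : realType) (V : normedModType R) (f : V -> R) (x v : V) (d : R) :
  is_derive (0 : R) (1 : R) (fun t : R => f (t *: v + x)) d -> 'D_v f x = d.
Proof.
case=> _ <-; rewrite /derive.
set g1 := fun h => h^-1 *: _; set g2 := fun h => h^-1 *: _.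
suff -> : g1 = g2 by [].
apply/funext => h; rewrite /g1 /g2 /=.
by rewrite addr0 scale0r add0r [_%:A]mulr1.
Qed.

Section Knothe.
Variables (R : realType) (n m : nat).
Local Notation N := n.+2.
Local Notation V := 'rV[R]_n.+2.
Implicit Types (x : V) (i l : nat) (s t : R).

(* The source measure has density [\sum_k \prod_i phi k i x_i], where [phi k i]
   has primitive [Phi k i] and mass [W k i]; [cdf i] is the distribution function
   of [x_i] conditioned on the previous coordinates. The target is the half ball
   [x_0 <= 0]: [b i] is the upper end of the range of the i-th coordinate, in
   units of the radius [r i] left by the previous ones, and [e i] is the
   dimension of the slices at fixed i-th coordinate. *)
Variables (phi Phi : 'I_m.+1 -> nat -> R -> R) (W : 'I_m.+1 -> nat -> R).
Hypothesis phi_gt0 : forall k i s, 0 < phi k i s.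
Hypothesis Phi_gt0 : forall k i s, 0 < Phi k i s.
Hypothesis Phi_lt : forall k i s, Phi k i s < W k i.
Hypothesis is_derive_Phi : forall k i s, is_derive s (1 : R) (Phi k i) (phi k i s).
Hypothesis Cks_phi : forall k i j (f : V -> R), Cks j f -> Cks j (fun x => phi k i (f x)).
Hypothesis Cks_Phi : forall k i j (f : V -> R), Cks j f -> Cks j (fun x => Phi k i (f x)).

Let y i x : R := x 0 (inord i).
Let A k i x : R := (\prod_(0 <= l < i) phi k l (y l x)) * \prod_(i.+1 <= l < N) W k l.
(** The density of the first [i] coordinates with the others integrated out: the total mass for
    [i = 0], the full density for [i = N]. *)
Let marginal i x : R :=
  \sum_(k < m.+1) (\prod_(0 <= l < i) phi k l (y l x)) * \prod_(i <= l < N) W k l.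
Let cumul i x : R := \sum_(k < m.+1) A k i x * Phi k i (y i x).
Let cdf i x : R := cumul i x / marginal i x.
Let b i : R := (0 < i)%N%:R.
Let e i : nat := (n.+1 - i)%N.
Let u i x : R := cap_inv (e i) (b i) (cdf i x).
Let q i x : R := Num.sqrt (1 - u i x ^+ 2).
Let r i x : R := \prod_(0 <= l < i) q l x.

Definition knothe x : V := \row_i (r i x * u i x).

Definition knothe_density x : R := \sum_(k < m.+1) \prod_(0 <= l < N) phi k l (y l x).

Definition knothe_mass : R := \sum_(k < m.+1) \prod_(0 <= l < N) W k l.

Let W_gt0 k i : 0 < W k i.
Proof. by apply: lt_trans (Phi_lt k i 0). Qed.

Let A_gt0 k i x : 0 < A k i x.
Proof. by rewrite mulr_gt0// prodr_gt0. Qed.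

Let marginalE i x : (i < N)%N -> marginal i x = \sum_(k < m.+1) A k i x * W k i.
Proof.
move=> iN; apply: eq_bigr => k _; rewrite (@big_ltn _ _ _ i)// /A -mulrA.
by congr (_ * _); rewrite mulrC.
Qed.

Let marginalSE i x : (i < N)%N ->
  marginal i.+1 x = \sum_(k < m.+1) A k i x * phi k i (y i x).
Proof.
move=> iN; apply: eq_bigr => k _; rewrite big_nat_recr//= /A -!mulrA.
by congr (_ * _); rewrite mulrC.
Qed.

Let marginal_gt0 i x : 0 < marginal i x.
Proof.
rewrite /marginal (bigD1 ord0)//= ltr_wpDr//; last by rewrite mulr_gt0// prodr_gt0.
by apply: sumr_ge0 => k _; rewrite mulr_ge0 ?prodr_ge0// => l _; exact: ltW.
Qed.

Let b_ge0 i : 0 <= b i. Proof. by rewrite /b. Qed.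
Let b_le1 i : b i <= 1. Proof. by rewrite /b; case: (0 < i)%N. Qed.

Let cdf_gt0 i x : 0 < cdf i x.
Proof.
rewrite divr_gt0//; rewrite /cumul (bigD1 ord0)//= ltr_wpDr//; last by rewrite mulr_gt0.
by apply: sumr_ge0 => k _; rewrite mulr_ge0// ltW.
Qed.

Let cdf_lt1 i x : (i < N)%N -> cdf i x < 1.
Proof.
move=> iN; rewrite ltr_pdivrMr// mul1r marginalE// /cumul.
rewrite (bigD1 ord0)//= [ltRHS](bigD1 ord0)//= ltr_leD//; first by rewrite ltr_pM2l.
by apply: ler_sum => k _; rewrite ler_pM2l// ltW.
Qed.

Let u_gtN1 i x : (i < N)%N -> -1 < u i x.
Proof. by move=> iN; have [/andP[]] := cap_invP (e i) (b_ge0 i) (b_le1 i) (cdf_gt0 i x) (cdf_lt1 x iN). Qed.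

Let u_ltb i x : (i < N)%N -> u i x < b i.
Proof. by move=> iN; have [/andP[]] := cap_invP (e i) (b_ge0 i) (b_le1 i) (cdf_gt0 i x) (cdf_lt1 x iN). Qed.

Let usqr_gt0 i x : (i < N)%N -> 0 < 1 - u i x ^+ 2.
Proof.
move=> iN; have -> : 1 - u i x ^+ 2 = (1 - u i x) * (1 + u i x) by ring.
rewrite mulr_gt0//; first by rewrite subr_gt0; exact: lt_le_trans (u_ltb x iN) (b_le1 i).
by rewrite -ltrBlDl sub0r u_gtN1.
Qed.

Let q_gt0 i x : (i < N)%N -> 0 < q i x.
Proof. by move=> iN; rewrite sqrtr_gt0 usqr_gt0. Qed.

Let r_gt0 i x : (i <= N)%N -> 0 < r i x.
Proof.
move=> iN; rewrite /r big_nat_cond prodr_gt0// => l /andP[/andP[_ li] _].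
by apply: q_gt0; exact: leq_trans li iN.
Qed.

(** Since [r i.+1 ^+ 2] equals [r i ^+ 2] times [1 - u i ^+ 2], the squared coordinates
    telescope. *)
Let knothe_sqr i x : (i <= N)%N ->
  \sum_(0 <= l < i) (r l x * u l x) ^+ 2 = 1 - r i x ^+ 2.
Proof.
elim: i => [|i IH] iN; first by rewrite big_geq// /r big_geq// expr1n subrr.
rewrite big_nat_recr//= IH 1?ltnW// /r big_nat_recr//= -/(r i x).
rewrite !exprMn /q sqr_sqrtr ?ltW ?usqr_gt0//; ring.
Qed.

Lemma enorm_knothe x : enorm (knothe x) <= 1.
Proof.
rewrite -[leRHS]sqrtr1 ler_wsqrtr// /dotp.
apply: le_trans (_ : 1 - r N x ^+ 2 <= 1); last by rewrite lerBlDr lerDl sqr_ge0.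
rewrite -knothe_sqr// big_mkord le_eqVlt; apply/orP; left; apply/eqP.
by apply: eq_bigr => i _; rewrite !mxE -expr2.
Qed.

Lemma knothe0_le0 x : knothe x 0 0 <= 0.
Proof.
rewrite mxE /r big_geq// mul1r ltW//.
by have := u_ltb x (ltn0Sn n.+1); rewrite /b.
Qed.

Let Cks_y j i : Cks j (y i). Proof. exact: Cks_coord_fun. Qed.

Let Cks_marginal j i : Cks j (marginal i).
Proof.
apply: Cks_sum => k _; apply: CksM; last exact: Cks_cst.
by apply: Cks_prod => l _; exact: Cks_phi.
Qed.

Let Cks_cdf j i : Cks j (cdf i).
Proof.
apply: CksM; last by apply: CksV => // x; rewrite gt_eqF.
apply: Cks_sum => k _; apply: CksM; last exact: Cks_Phi.
apply: CksM; last exact: Cks_cst.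
by apply: Cks_prod => l _; exact: Cks_phi.
Qed.

Let Cks_u j i : (i < N)%N -> Cks j (u i).
Proof.
move=> iN; apply: (@Cks_comp _ _ (cap_inv (e i) (b i))
  (fun s => cap_mass (e i) (b i) / cap_density (e i) (cap_inv (e i) (b i) s)) (cdf i)) => //.
  by move=> x; apply: is_derive_cap_inv => //; exact: cdf_lt1.
move=> k _ Cu; apply: CksZ; apply: CksV.
  by move=> x; rewrite expf_neq0// gt_eqF// q_gt0.
apply: CksX; apply: Cks_sqrt; first by move=> x; exact: usqr_gt0.
by apply: CksB; [exact: Cks_cst|exact: CksX].
Qed.

Lemma Cks_knothe j (i : 'I_N) : Cks j (fun x => knothe x 0 i).
Proof.
rewrite (_ : (fun x => _) = fun x => r i x * u i x); last by apply/funext => x; rewrite mxE.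
apply: CksM; last exact: Cks_u.
rewrite /r (_ : (fun x => _) = fun x => \prod_(l < i) q l x); last first.
  by apply/funext => x; rewrite big_mkord.
have lN (l : 'I_i) : (l < N)%N by exact: ltn_trans (ltn_ord l) (ltn_ord i).
apply: Cks_prod => l _; apply: Cks_sqrt; first by move=> x; exact: usqr_gt0.
by apply: CksB; [exact: Cks_cst|apply: CksX; exact: Cks_u].
Qed.

Let d i x : R := r i x * (cap_mass (e i) (b i) / cap_density (e i) (u i x) *
   (marginal i.+1 x / marginal i x)).

Let y_line i l x t : (i < N)%N -> (l < N)%N ->
  y l (t *: delta_mx 0 (inord i) + x) = (if l == i then t else 0) + y l x.
Proof.
move=> iN lN; rewrite /y !mxE eqxx /= -(inj_eq val_inj)/= !inordK//.
by case: eqP => _; rewrite ?mulr1 ?mulr0.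
Qed.

(** The radius [r i] and the conditional masses depend only on the coordinates before [i]; moving
    coordinate [i] alone acts through [Phi k i] inside [cap_inv]. *)
Let derive_knothe x (i : 'I_N) :
  'D_(delta_mx 0 i) (fun z => knothe z 0 i) x = d i x.
Proof.
have iN := ltn_ord i; rewrite -[i in delta_mx _ i]inord_val.
have prodE (F : nat -> R -> R) t : \prod_(0 <= l < i) F l (y l (t *: delta_mx 0 (inord i) + x)) =
    \prod_(0 <= l < i) F l (y l x).
  rewrite big_nat_cond [RHS]big_nat_cond; apply: eq_bigr => l /andP[/andP[_ li] _].
  by rewrite y_line ?(ltn_trans li)// (ltn_eqF li) add0r.
have AE k t : A k i (t *: delta_mx 0 (inord i) + x) = A k i x.
  by rewrite /A (prodE (phi k)).
have mE l t : (l <= i)%N -> marginal l (t *: delta_mx 0 (inord i) + x) = marginal l x.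
  move=> li; apply: eq_bigr => k _; congr (_ * _).
  rewrite big_nat_cond [RHS]big_nat_cond; apply: eq_bigr => l' /andP[/andP[_ ll] _].
  have l'i := leq_trans ll li.
  by rewrite y_line ?(ltn_trans l'i)// (ltn_eqF l'i) add0r.
have rE t : r i (t *: delta_mx 0 (inord i) + x) = r i x.
  rewrite /r big_nat_cond [RHS]big_nat_cond; apply: eq_bigr => l /andP[/andP[_ li] _].
  congr (Num.sqrt (1 - cap_inv _ _ _ ^+ 2)); congr (_ / _); last by rewrite mE// ltnW.
  apply: eq_bigr => k _; congr (_ * _ * Phi _ _ _); last first.
    by rewrite y_line ?(ltn_trans li)// (ltn_eqF li) add0r.
  rewrite big_nat_cond [RHS]big_nat_cond; apply: eq_bigr => l' /andP[/andP[_ ll] _].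
  have l'i := ltn_trans ll li.
  by rewrite y_line ?(ltn_trans l'i)// (ltn_eqF l'i) add0r.
apply: derive_line.
rewrite (_ : (fun t => _) = fun t => r i x * cap_inv (e i) (b i)
   ((marginal i x)^-1 * \sum_(k < m.+1) A k i x * Phi k i (t + y i x))); last first.
  apply/funext => t; rewrite mxE rE /u /cdf mE// /cumul; congr (_ * cap_inv _ _ _).
  rewrite mulrC; congr (_ * _); apply: eq_bigr => k _.
  by rewrite AE y_line// eqxx.
have dPhi k : is_derive (0 : R) (1 : R) (fun t => A k i x * Phi k i (t + y i x))
    (A k i x * phi k i (y i x)).
  have h : is_derive (0 : R) (1 : R) (fun t => Phi k i (t + y i x)) (phi k i (y i x)).
    have h1 : is_derive (0 : R) (1 : R) (fun t : R => t + y i x) 1.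
      have := is_deriveD (is_derive_id (0 : R) (1 : R)) (is_derive_cst (y i x) (0 : R) (1 : R)).
      by move/is_derive_eq; apply; rewrite addr0.
    have h2 : is_derive (0 + y i x) (1 : R) (Phi k i) (phi k i (y i x)).
      by rewrite add0r.
    by have := @is_derive1_comp R (Phi k i) (fun t => t + y i x) 0 _ _ h2 h1; rewrite mulr1.
  exact: (is_deriveZ (A k i x) h).
have dsum : is_derive (0 : R) (1 : R) (fun t => \sum_(k < m.+1) A k i x * Phi k i (t + y i x))
    (marginal i.+1 x).
  rewrite marginalSE//; have := is_derive_sum dPhi.
  by rewrite (_ : \sum_(k < m.+1) _ = fun t => \sum_(k < m.+1) A k i x * Phi k i (t + y i x))//;
    apply/funext => t; rewrite fct_sumE.
have dcdf := is_deriveZ (marginal i x)^-1 dsum.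
have E0 : (marginal i x)^-1 * (\sum_(k < m.+1) A k i x * Phi k i (0 + y i x)) = cdf i x.
  by rewrite add0r mulrC.
have dh : is_derive ((marginal i x)^-1 * (\sum_(k < m.+1) A k i x * Phi k i (0 + y i x))) (1 : R)
    (cap_inv (e i) (b i)) (cap_mass (e i) (b i) / cap_density (e i) (u i x)).
  by rewrite E0; apply: is_derive_cap_inv => //; exact: cdf_lt1.
have := is_deriveZ (r i x) (@is_derive1_comp R (cap_inv (e i) (b i)) (fun t => (marginal i x)^-1 * \sum_(k < m.+1) A k i x * Phi k i (t + y i x)) 0 _ _ dh dcdf).
move/is_derive_eq; apply.
by rewrite /d -[LHS]/(_ * (_ * (_ * _))) [marginal _ _ / _]mulrC.
Qed.

Lemma divergence_knothe x : divergence knothe x = \sum_(i < N) d i x.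
Proof.
apply: eq_bigr => i _; rewrite derive_coord ?derive_knothe//.
have C1 : Ck 1 knothe by apply: Ck_coord => j; exact: Cks_knothe.
by have [] := C1.
Qed.

Let d_gt0 i x : (i < N)%N -> 0 < d i x.
Proof.
move=> iN; rewrite mulr_gt0 ?r_gt0 1?ltnW//.
rewrite mulr_gt0 ?divr_gt0//; first exact: cap_mass_gt0.
by apply: cap_density_gt0; [exact: u_gtN1|exact: lt_le_trans (u_ltb x iN) (b_le1 i)].
Qed.

Lemma divergence_knothe_ge0 x : 0 <= divergence knothe x.
Proof. by rewrite divergence_knothe; apply: sumr_ge0 => i _; rewrite ltW// d_gt0. Qed.

(** The factor [q l] occurs in [r i] for every [i > l]. For [j = N] the resulting exponent is that
    of [cap_density (e l)], so these factors cancel in the Jacobian. *)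
Let prod_r x j : \prod_(0 <= i < j) r i x = \prod_(0 <= l < j) q l x ^+ (j - l.+1).
Proof.
elim: j => [|j IH]; first by rewrite !big_geq.
rewrite big_nat_recr//= IH [RHS]big_nat_recr//= subnn expr0 mulr1 /r -big_split/=.
rewrite big_nat_cond [RHS]big_nat_cond; apply: eq_bigr => l /andP[/andP[_ lj] _].
by rewrite -exprSr subnS subSn// -subnS -subSn// subnS.
Qed.

Lemma prod_cap_mass : \prod_(0 <= i < N) cap_mass (e i) (b i) = half_ball_const R n.
Proof.
rewrite big_ltn// /half_ball_const /e subn0 /b; congr (_ * _).
rewrite big_add1/= big_mkord /ball_const (reindex_inj rev_ord_inj)/=.
by apply: eq_bigr => i _; rewrite /cap_mass /cap_full /= mulr1n !subSS subKn// -ltnS.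
Qed.

(** The Jacobian determinant of the Knothe map: the marginals telescope from the total mass to the
    full density, and the masses of the caps multiply to that of the half ball. *)
Let prod_d x : \prod_(i < N) d i x = half_ball_const R n * (knothe_density x / knothe_mass).
Proof.
rewrite -(big_mkord xpredT (fun i => d i x)) /d big_split/= prod_r big_split/=.
rewrite big_split/= prod_cap_mass prodfV.
have -> : \prod_(0 <= i < N) cap_density (e i) (u i x) = \prod_(0 <= l < N) q l x ^+ (N - l.+1).
  by apply: eq_bigr => i _.
have Q0 : \prod_(0 <= l < N) q l x ^+ (N - l.+1) != 0.
  rewrite big_nat_cond gt_eqF// prodr_gt0// => l /andP[/andP[_ lN] _].
  by rewrite exprn_gt0// q_gt0.
have M0 : marginal 0 x = knothe_mass.
  by apply: eq_bigr => k _; rewrite big_geq// mul1r.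
have MN : marginal N x = knothe_density x.
  by apply: eq_bigr => k _; rewrite [X in _ * X]big_geq// mulr1.
have -> : \prod_(0 <= i < N) (marginal i.+1 x / marginal i x) = knothe_density x / knothe_mass.
  rewrite telescope_prodf//; first by rewrite M0 MN.
  by move=> i _; rewrite gt_eqF.
by rewrite mulrA; congr (_ * _); rewrite mulrCA divff// mulr1.
Qed.

Lemma knothe_mass_gt0 : 0 < knothe_mass.
Proof.
rewrite (_ : knothe_mass = marginal 0 0); first exact: marginal_gt0.
by apply: eq_bigr => k _; rewrite [X in X * _]big_geq// mul1r.
Qed.

(* The Jacobian of the Knothe map is triangular, so the AM-GM inequality bounds
   its determinant by its trace. *)
Lemma knothe_AMGM x : half_ball_const R n * knothe_density x <=
  knothe_mass * (divergence knothe x / N%:R) ^+ N.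
Proof.
have := @leif_AGM R 'I_N predT (fun i : 'I_N => d i x); rewrite /= cardT size_enum_ord => h.
have {h}/leifP := h (fun (i : 'I_N) _ => ltW (d_gt0 x (ltn_ord i))).
rewrite prod_d -divergence_knothe mulrA => h.
have {}h : half_ball_const R n * knothe_density x / knothe_mass <=
    (divergence knothe x / N%:R) ^+ N.
  by move: h; case: ifP => _ => [/eqP ->|/ltW].
by move: h; rewrite ler_pdivrMr ?knothe_mass_gt0// [leRHS]mulrC.
Qed.

End Knothe.

(** * Test fields from the Knothe map *)

Section Logistic.
Variable R : realType.
Implicit Types (s t d : R).

(** A primitive of [logistic]; its closed form gives the primitives [Phi] of the Knothe map without
    integrals. *)
Definition softplus s : R := ln (1 + expR s).
Definition logistic s : R := expR s / (1 + expR s).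

Let den_gt0 s : 0 < 1 + expR s. Proof. by rewrite addr_gt0// expR_gt0. Qed.

Lemma is_derive_softplus s : is_derive s (1 : R) softplus (logistic s).
Proof.
have h := is_deriveD (is_derive_cst (1 : R) s (1 : R)) (is_derive_expR s).
rewrite add0r in h.
have := @is_derive1_comp R (@ln R) (fun t => 1 + expR t) s _ _ (is_derive1_ln (den_gt0 s)) h.
by move/is_derive_eq; apply; rewrite mulrC.
Qed.

Lemma logisticE s : logistic s = 1 - (1 + expR s)^-1.
Proof.
by rewrite /logistic; field; rewrite gt_eqF.
Qed.

Lemma logistic_lt s t : s < t -> logistic s < logistic t.
Proof.
move=> st; rewrite !logisticE ltrD2l ltrN2 ltf_pV2 ?posrE ?den_gt0//.
by rewrite ltrD2l ltr_expR.
Qed.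

Lemma logistic_ge s : 0 < s -> 1 - s^-1 <= logistic s.
Proof.
move=> s0; rewrite logisticE lerD2l lerN2 lef_pV2 ?posrE ?den_gt0//.
by have := expR_ge1Dx s; lra.
Qed.

Lemma logistic_le s : 0 < s -> logistic (- s) <= s^-1.
Proof.
move=> s0; rewrite /logistic expRN ler_pdivrMr; last by rewrite addr_gt0// invr_gt0 expR_gt0.
apply: (@le_trans _ _ s^-1).
  by rewrite lef_pV2 ?posrE ?expR_gt0//; have := expR_ge1Dx s; lra.
by rewrite ler_peMr ?invr_ge0 ?(ltW s0)// lerDl invr_ge0 expR_ge0.
Qed.

Lemma softplus_lt s t : s < t -> softplus s < softplus t.
Proof. by move=> st; rewrite ltr_ln ?posrE ?den_gt0// ltrD2l ltr_expR. Qed.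

Lemma softplus_ltD s d : 0 < d -> softplus (s + d) < softplus s + d.
Proof.
move=> d0; rewrite -{2}(expRK d) -lnM ?posrE ?den_gt0 ?expR_gt0//.
rewrite ltr_ln ?posrE ?mulr_gt0 ?den_gt0 ?expR_gt0//.
by rewrite mulrDl mul1r -expRD ltrD2r expR_gt1.
Qed.

Variables (M a w : R).
Hypotheses (M0 : 0 < M) (w0 : 0 < w).

(* An everywhere positive smoothing of the indicator function of [a, a + w]. *)
Definition bump s := logistic (M * (s - a)) - logistic (M * (s - a - w)).
Definition bump_prim s := M^-1 * (softplus (M * (s - a)) - softplus (M * (s - a - w))).

Lemma bump_gt0 s : 0 < bump s.
Proof. by rewrite subr_gt0 logistic_lt// ltr_pM2l// gtrBl. Qed.

Lemma bump_prim_gt0 s : 0 < bump_prim s.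
Proof. by rewrite mulr_gt0 ?invr_gt0// subr_gt0 softplus_lt// ltr_pM2l// gtrBl. Qed.

(** Together with [bump_prim_gt0] this keeps the conditional distribution functions strictly between
    0 and 1, where [cap_inv] is smooth. *)
Lemma bump_prim_lt s : bump_prim s < w.
Proof.
rewrite /bump_prim mulrC ltr_pdivrMr// ltrBlDl.
have -> : M * (s - a) = M * (s - a - w) + w * M by ring.
by apply: softplus_ltD; rewrite mulr_gt0.
Qed.

Lemma is_derive_bump_prim s : is_derive s (1 : R) bump_prim (bump s).
Proof.
have h c : is_derive s (1 : R) (fun t => softplus (M * (t - c))) (logistic (M * (s - c)) * M).
  apply: (@is_derive1_comp R softplus (fun t => M * (t - c))); first exact: is_derive_softplus.
  have := is_deriveZ M (is_deriveB (is_derive_id s (1 : R)) (is_derive_cst c s (1 : R))).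
  by move/is_derive_eq; apply; rewrite subr0 -[LHS]/(_ * _) mulr1.
have h2 : is_derive s (1 : R) (fun t => softplus (M * (t - a - w))) (logistic (M * (s - a - w)) * M).
  have E t : t - (a + w) = t - a - w by ring.
  have := h (a + w); rewrite E.
  rewrite (_ : (fun t => _) = fun t => softplus (M * (t - a - w)))//.
  by apply/funext => t; rewrite E.
have := is_deriveZ M^-1 (is_deriveB (h a) h2).
move/is_derive_eq; apply.
by rewrite -[LHS]/(_ * _) -mulrBl mulrCA mulVf ?mulr1// gt_eqF.
Qed.

(** At distance [t] from both edges, each of the two logistic functions costs at most 1 / (M t). *)
Lemma bump_ge s t : a + t <= s -> s <= a + w - t -> 0 < t -> 1 - 2 / (M * t) <= bump s.
Proof.
move=> s1 s2 t0; have Mt : 0 < M * t by rewrite mulr_gt0.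
have mono x y : x <= y -> logistic x <= logistic y.
  by rewrite le_eqVlt => /orP[/eqP->//|/logistic_lt/ltW].
have h1 : 1 - (M * t)^-1 <= logistic (M * (s - a)).
  by apply: le_trans (logistic_ge Mt) _; apply: mono; rewrite ler_pM2l//; lra.
have h2 : logistic (M * (s - a - w)) <= (M * t)^-1.
  apply: le_trans (logistic_le Mt); apply: mono.
  by rewrite -mulrN ler_pM2l//; lra.
by rewrite /bump; lra.
Qed.

Lemma Cks_bump (V : normedModType R) k (f : V -> R) : Cks k f -> Cks k (fun x => bump (f x)).
Proof.
move=> Cf.
have Cl (g : V -> R) : Cks k g -> Cks k (fun x => logistic (g x)).
  move=> Cg; apply: CksM; first exact: Cks_exp.
  apply: CksV; first by move=> x; rewrite gt_eqF.
  by apply: CksD; [exact: Cks_cst|exact: Cks_exp].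
apply: CksB; apply: Cl; apply: CksZ; repeat (apply: CksB => //); exact: Cks_cst.
Qed.

Lemma Cks_bump_prim (V : normedModType R) k (f : V -> R) :
  Cks k f -> Cks k (fun x => bump_prim (f x)).
Proof.
move=> Cf.
have Cl (g : V -> R) : Cks k g -> Cks k (fun x => softplus (g x)).
  move=> Cg; apply: Cks_ln => //.
  by apply: CksD; [exact: Cks_cst|exact: Cks_exp].
apply: CksZ; apply: CksB; apply: Cl; apply: CksZ; repeat (apply: CksB => //); exact: Cks_cst.
Qed.

End Logistic.

(** * Cut-offs in radius and height *)

Section CutOff.
Variables (R : realType) (n : nat).
Local Notation V := 'rV[R]_n.+1.
Implicit Types (x v : V).

(** For positive [r], equal to 1 on the ball of radius [r] and to 0 where the squared norm exceeds
    [2 * r ^+ 2]. The squared norm is used because it is smooth at the origin. *)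
Definition radial_cut (r : R) x : R := smooth_step (2 - r ^- 2 * dotp x x).

Lemma Cks_dotpp k : Cks k (fun x : V => dotp x x).
Proof. by apply: Cks_sum => i _; apply: CksM; exact: Cks_coord_fun. Qed.

Lemma derive_dotpp x i : 'D_(delta_mx 0 i) (fun x : V => dotp x x) x = 2 * x 0 i.
Proof.
apply: derive_line.
rewrite (_ : (fun t => _) = fun t : R => t ^+ 2 + (2 * x 0 i) *: t + dotp x x); last first.
  apply/funext => t; rewrite dotpDl !dotpDr !dotpZl !dotpZr !dotp_delta dotpC dotp_delta.
  by rewrite !mxE !eqxx -[X in _ = _ + X + _]/(_ * _) /=; ring.
have h1 := is_deriveX 2 (is_derive_id (0 : R) (1 : R)).
have h2 := is_deriveZ (2 * x 0 i) (is_derive_id (0 : R) (1 : R)).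
have := is_deriveD (is_deriveD h1 h2) (is_derive_cst (dotp x x) (0 : R) (1 : R)).
move/is_derive_eq; apply.
by rewrite addr0 -[X in X + _]/(_ * _) -[X in _ + X = _]/(_ * _) expr1 mulr0 mul0r add0r mulr1.
Qed.

Lemma Cks_radial_cut k r : Cks k (radial_cut r).
Proof.
apply: Cks_smooth_step; apply: CksB; first exact: Cks_cst.
by apply: CksZ; exact: Cks_dotpp.
Qed.

Lemma derive_radial_cut r x i : 'D_(delta_mx 0 i) (radial_cut r) x =
  smooth_step' (2 - r ^- 2 * dotp x x) * (- (r ^- 2) * (2 * x 0 i)).
Proof.
have C1 : Cks 1 (fun x : V => 2 - r ^- 2 * dotp x x).
  by apply: CksB; [exact: Cks_cst|apply: CksZ; exact: Cks_dotpp].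
have d1 : differentiable (fun x : V => dotp x x) x by have [] := @Cks_dotpp 1.
rewrite (derive_chain _ (C1.1 x) (is_derive_smooth_step _)); congr (_ * _).
rewrite (_ : (fun x : V => _) = (fun=> 2) - (r ^- 2 \*: (fun x : V => dotp x x))) //.
rewrite deriveB; last 2 first.
- exact: derivable_cst.
- by apply: derivableZ; exact: diff_derivable.
rewrite deriveZ ?derive_dotpp; last exact: diff_derivable.
by rewrite (@derive_cst _ _ _ (2 : R)) sub0r mulNr.
Qed.

(** For positive [h], equal to 1 where [x 0 0 <= - h] and to 0 where [x 0 0 >= - (h / 2)]; it keeps
    supports inside the open half-space. *)
Definition height_cut (h : R) x : R := smooth_step (- (2 / h) * x 0 0 - 1).

Lemma Cks_height_cut k h : Cks k (height_cut h).
Proof.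
apply: Cks_smooth_step; apply: CksB; last exact: Cks_cst.
by apply: CksZ; exact: Cks_coord_fun.
Qed.

Lemma derive_height_cut h x i : 'D_(delta_mx 0 i) (height_cut h) x =
  smooth_step' (- (2 / h) * x 0 0 - 1) * (- (2 / h) * (i == 0)%:R).
Proof.
have C1 : Cks 1 (fun x : V => - (2 / h) * x 0 0 - 1).
  by apply: CksB; [apply: CksZ; exact: Cks_coord_fun|exact: Cks_cst].
rewrite (derive_chain _ (C1.1 x) (is_derive_smooth_step _)); congr (_ * _).
have d1 : differentiable (fun x : V => x 0 0) x by exact: differentiable_coord.
rewrite (_ : (fun x : V => _) = (- (2 / h) \*: (fun x : V => x 0 0)) - (fun=> 1)) //.
rewrite deriveB; last 2 first.
- by apply: derivableZ; exact: diff_derivable.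
- exact: derivable_cst.
rewrite deriveZ; last exact: diff_derivable.
rewrite (@derive_cst _ _ _ (1 : R)) subr0 -[LHS]/(_ * _); congr (_ * _).
rewrite -(@derive_coord _ _ id); last exact: ex_diff.
by rewrite derive_id mxE eqxx /= eq_sym.
Qed.

Lemma smooth_step'_le0 (s : R) : s <= 0 -> smooth_step' s = 0.
Proof. by move=> s0; rewrite /smooth_step' !(@flat_le0 _ _ s)// !mul0r addr0 mul0r. Qed.

Lemma smooth_step'_ge1 (s : R) : 1 <= s -> smooth_step' s = 0.
Proof.
by move=> s1; rewrite /smooth_step' !(@flat_le0 _ _ (1 - s)) ?mulr0 ?addr0 ?mul0r// subr_le0.
Qed.

Lemma divergence_cut (r h : R) (T : V -> V) x : Ck 1 T ->
  divergence (fun x => (radial_cut r x * height_cut h x) *: T x) x =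
  radial_cut r x * height_cut h x * divergence T x
  + radial_cut r x * (smooth_step' (- (2 / h) * x 0 0 - 1) * (- (2 / h) * T x 0 0))
  + height_cut h x * (smooth_step' (2 - r ^- 2 * dotp x x) * (- (r ^- 2) * (2 * dotp x (T x)))).
Proof.
move=> [dT _].
have dr : differentiable (@radial_cut r) x by have [] := Cks_radial_cut 1 r.
have dh : differentiable (@height_cut h) x by have [] := Cks_height_cut 1 h.
have dTi i : differentiable (fun y => T y 0 i) x.
  by apply: (@differentiable_comp _ _ _ _ T (fun z : V => z 0 i)) => //; exact: differentiable_coord.
have drh : differentiable (radial_cut r * height_cut h) x by exact: differentiableM.
have term i : ('D_(delta_mx 0 i) (fun x => (radial_cut r x * height_cut h x) *: T x) x) 0 i =
    radial_cut r x * height_cut h x * ('D_(delta_mx 0 i) T x) 0 i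
    + radial_cut r x * (smooth_step' (- (2 / h) * x 0 0 - 1) * (- (2 / h) * (T x 0 i * (i == 0)%:R)))
    + height_cut h x * (smooth_step' (2 - r ^- 2 * dotp x x) * (- (r ^- 2) * (2 * (x 0 i * T x 0 i)))).
  rewrite derive_coord; last first.
    apply: differentiable_coord_row => j.
    rewrite (_ : (fun y => _) = (radial_cut r * height_cut h) * (fun y => T y 0 j)).
      exact: differentiableM.
    by apply/funext => y; rewrite mxE.
  rewrite (_ : (fun y => _) = (radial_cut r * height_cut h) * (fun y => T y 0 i)); last first.
    by apply/funext => y; rewrite mxE.
  rewrite deriveM; [|exact: diff_derivable|exact: diff_derivable].
  rewrite deriveM; [|exact: diff_derivable|exact: diff_derivable].
  rewrite derive_radial_cut derive_height_cut -derive_coord//.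
  rewrite -[X in X + _ = _]/(_ * _ * _) -[X in _ + X = _]/(_ * (_ * _ + _ * _)).
  ring.
rewrite /divergence (eq_bigr _ (fun i _ => term i)) !big_split/= -!mulr_sumr.
congr (_ + _ * (_ * (_ * _)) + _).
rewrite (bigD1 0)//= mulr1 big1 ?addr0// => i i0.
by rewrite (negPf i0) mulr0.
Qed.

End CutOff.

Section HalfSpaceField.
Variables (R : realType) (n : nat).
Local Notation N := n.+2.
Local Notation V := 'rV[R]_n.+2.
Implicit Types (x : V).

Lemma cut_test_field (r h : R) (T : V -> V) : 0 < r -> 0 < h ->
  (forall k i, Cks k (fun x => T x 0 i)) -> (forall x, enorm (T x) <= 1) ->
  test_field [set x : V | x 0 0 <= 0] (fun x => (radial_cut r x * height_cut h x) *: T x).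
Proof.
move=> r0 h0 CT T1.
pose A : set V := [set x : V | x 0 0 <= - (h / 2)] `&` eclosed_ball (0 : V) (2 * r).
have cA : closed A.
  apply: closedI; last exact: closed_eclosed_ball.
  rewrite (_ : [set x : V | x 0 0 <= - (h / 2)] = (fun x : V => x 0 0) @^-1` [set t | t <= - (h / 2)])//.
  by apply: closed_comp => [x _|]; [exact: coord_continuous|exact: closed_le].
have suppA : closure [set x | (radial_cut r x * height_cut h x) *: T x != 0] `<=` A.
  rewrite [X in _ `<=` X](closure_id A).1//; apply: closure_subset => x /=.
  move=> xi0; split.
    rewrite /= leNgt; apply: contra xi0 => xh; rewrite /height_cut smooth_step_le0 ?mulr0 ?scale0r//.
    have : h / 2 * (2 / h) = 1 by field; rewrite gt_eqF.
    have h2 : 0 < 2 / h by rewrite divr_gt0.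
    by rewrite -(ltr_pM2r h2) in xh; rewrite subr_le0 => E; lra.
  rewrite /eclosed_ball/= subr0 leNgt; apply: contra xi0 => xr.
  rewrite /radial_cut smooth_step_le0 ?mul0r ?scale0r//.
  rewrite subr_le0 mulrC ler_pdivlMr ?exprn_gt0// -enormE.
  have : (2 * r) ^+ 2 <= enorm x ^+ 2.
    by rewrite ler_sqr ?nnegrE ?enorm_ge0 ?mulr_ge0 ?(ltW r0) ?(ltW xr).
  by rewrite exprMn; have := sqr_ge0 r; lra.
split.
- move=> k; apply: Ck_coord => i.
  rewrite (_ : (fun x => _) = fun x => radial_cut r x * height_cut h x * T x 0 i).
    by apply: CksM => //; apply: CksM; [exact: Cks_radial_cut|exact: Cks_height_cut].
  by apply/funext => x; rewrite mxE.
- apply: subclosed_compact suppA => //; first exact: closed_closure.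
  by apply: bounded_closed_compact => //; apply: (@enorm_bounded _ _ _ (2 * r)) => x [_];
    rewrite /eclosed_ball/= subr0.
- apply: subset_trans suppA _ => x [xh _].
  have : open [set z : V | z 0 0 < 0].
    rewrite (_ : [set z : V | z 0 0 < 0] = (fun x : V => x 0 0) @^-1` [set t | t < 0])//.
    by apply: open_comp => [z _|]; [exact: coord_continuous|exact: open_lt].
  rewrite openE => /(_ x); have x0 : x 0 0 < 0.
    by apply: le_lt_trans xh _; rewrite oppr_lt0 divr_gt0.
  by move=> /(_ x0); apply: interiorS => z /=; exact: ltW.
- move=> x; have c1 : 0 <= radial_cut r x by exact: smooth_step_ge0.
  have c2 : 0 <= height_cut h x by exact: smooth_step_ge0.
  have c3 : radial_cut r x <= 1 by exact: smooth_step_le1.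
  have c4 : height_cut h x <= 1 by exact: smooth_step_le1.
  have c12 : 0 <= radial_cut r x * height_cut h x by exact: mulr_ge0.
  rewrite enormZ ger0_norm//; apply: mulr_ile1 => //; first exact: enorm_ge0.
  exact: mulr_ile1.
Qed.

(** The field is the Knothe map, cut off. Its uncut divergence is nonnegative, and at least N / rho
    on the shrunken boxes by [knothe_AMGM]; the height cut-off contributes with the good sign; the
    radial one costs at most [eps] because its gradient is of order 1 / r. *)
Lemma half_space_field (m : nat) (a w : 'I_m.+1 -> V) (rho eta eps : R) :
  (forall k i, 0 <= w k 0 i) -> 0 < rho -> 0 < eta -> 0 < eps ->
  \sum_k \prod_i w k 0 i < half_ball_const R n * rho ^+ N ->
  exists xi, [/\ test_field [set x : V | x 0 0 <= 0] xi,
    forall x, - eps <= divergence xi x &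
    forall x, x 0 0 <= - eta -> enorm x <= eta^-1 ->
      (exists k, forall i, a k 0 i + eta <= x 0 i <= a k 0 i + w k 0 i) ->
      N%:R / rho <= divergence xi x].
Proof.
move=> w0 rho0 eta0 eps0 mass_lt; set kappa := half_ball_const R n in mass_lt *.
(* Widening the boxes by [t] and lowering the guaranteed density to [1 - t] must not exhaust the
   strict inequality on the masses: this is [P t < 0]. *)
pose P t := \sum_k \prod_i (w k 0 i + t) - kappa * rho ^+ N * (1 - t) ^+ N.
have P0 : P 0 < 0.
  rewrite /P subr0 expr1n mulr1 subr_lt0; apply: le_lt_trans mass_lt.
  by apply: ler_sum => k _; rewrite le_eqVlt; apply/orP; left; apply/eqP/eq_bigr => i _; rewrite addr0.
have cP : continuous P.
  move=> t; apply: cvgB.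
    apply: continuous_sumr => k _; apply: continuous_prodr => i _ s.
    by apply: cvgD; [exact: cvg_cst|exact: cvg_id].
  apply: cvgM; first exact: cvg_cst.
  apply: (@continuous_comp _ _ _ (fun t : R => 1 - t) (fun y => y ^+ N)).
    by apply: cvgB; [exact: cvg_cst|exact: cvg_id].
  exact: exprn_continuous.
have [|d d0 hd] := @continuous_eventually_le _ P (- P 0 / 2) (cP 0); first by lra.
pose t := Num.min (d / 2) (Num.min eta (1 / 2)).
have t0 : 0 < t by rewrite !lt_min eta0 !divr_gt0.
have td : t < d.
  have : t <= d / 2 by rewrite ge_min lexx.
  by lra.
have teta : t <= eta by rewrite !ge_min lexx orbT.
have t1 : t < 1.
  have : t <= 1 / 2 by rewrite !ge_min lexx !orbT.
  by lra.
have Pt : P t < 0 by have := hd t (ltW t0) td; lra.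
(* Steep enough for the loss [2 / (M * t)] in [bump_ge] to equal [t]. *)
pose M := 2 / (t * t).
have M0 : 0 < M by rewrite divr_gt0// mulr_gt0.
have Mt : 2 / (M * t) = t by rewrite /M; field; rewrite gt_eqF.
(* Widening to the right by [t], together with [t <= eta], puts [a + eta, a + w] at distance at
   least [t] from both edges of the bump. *)
pose W k (l : nat) : R := w k 0 (inord l) + t.
have W0 k l : 0 < W k l by rewrite ltr_wpDl.
pose phi k l := bump M (a k 0 (inord l)) (W k l).
pose Phi k l := bump_prim M (a k 0 (inord l)) (W k l).
pose T : V -> V := knothe phi Phi W.
have phi0 k l s : 0 < phi k l s by apply: bump_gt0.
have Phi0 k l s : 0 < Phi k l s by apply: bump_prim_gt0.
have PhiW k l s : Phi k l s < W k l by apply: bump_prim_lt.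
have dPhi k l s : is_derive s (1 : R) (Phi k l) (phi k l s) by apply: is_derive_bump_prim.
have Cphi k l j (f : V -> R) : Cks j f -> Cks j (fun x => phi k l (f x)) by apply: Cks_bump.
have CPhi k l j (f : V -> R) : Cks j f -> Cks j (fun x => Phi k l (f x)) by apply: Cks_bump_prim.
have CT k i : Cks k (fun x => T x 0 i) by apply: Cks_knothe.
have T1 x : enorm (T x) <= 1 by apply: enorm_knothe.
have T0 x : T x 0 0 <= 0 by apply: knothe0_le0.
have divT0 x : 0 <= divergence T x by apply: divergence_knothe_ge0.
have AMGM x : kappa * @knothe_density R n m phi x <=
  @knothe_mass R n m W * (divergence T x / N%:R) ^+ N by apply: knothe_AMGM.
have mass0 : 0 < @knothe_mass R n m W by apply: (@knothe_mass_gt0 R n m phi Phi).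
have massP : @knothe_mass R n m W < kappa * rho ^+ N * (1 - t) ^+ N.
  rewrite -subr_lt0; apply: le_lt_trans Pt; rewrite lerD2r /knothe_mass.
  apply: ler_sum => k _; rewrite big_mkord le_eqVlt; apply/orP; left; apply/eqP.
  by apply: eq_bigr => i _; rewrite /W inord_val.
have t1N : 0 < (1 - t) ^+ N by rewrite exprn_gt0// subr_gt0.
have kappa0 : 0 < kappa.
  have := lt_trans mass0 massP; rewrite pmulr_lgt0// pmulr_lgt0//.
  exact: exprn_gt0.
have C1T : Ck 1 T by apply: Ck_coord => i.
have [K K0 HK] := smooth_step'_bounded R.
(* The first summand keeps the radial cut-off equal to 1 on the ball of radius [eta^-1]; the second
   makes its contribution, at most [4 * K / r] in size, smaller than [eps]. *)
pose r := eta^-1 + 4 * K / eps.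
have r0 : 0 < r by rewrite ltr_wpDr ?invr_gt0// !mulr_ge0 ?invr_ge0 ?ltW.
have rK : 4 * K <= eps * r.
  have : 0 < eps * eta^-1 by rewrite mulr_gt0// invr_gt0.
  have -> : eps * r = eps * eta^-1 + 4 * K by rewrite /r; field; rewrite !gt_eqF.
  by lra.
(* The Knothe map takes values in [T x 0 0 <= 0], and the height cut-off decreases in the first
   coordinate. *)
have second x : 0 <= radial_cut r x * (smooth_step' (- (2 / eta) * x 0 0 - 1) * (- (2 / eta) * T x 0 0)).
  rewrite mulr_ge0 ?smooth_step_ge0// mulr_ge0 ?smooth_step'_ge0//.
  by rewrite mulNr oppr_ge0 mulr_ge0_le0// divr_ge0// ltW.
exists (fun x => (radial_cut r x * height_cut eta x) *: T x); split.
- exact: cut_test_field.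
- move=> x; rewrite divergence_cut//.
  have first : 0 <= radial_cut r x * height_cut eta x * divergence T x.
    by rewrite mulr_ge0// mulr_ge0// smooth_step_ge0.
  suff third : - eps <= height_cut eta x * (smooth_step' (2 - r ^- 2 * dotp x x) *
      (- (r ^- 2) * (2 * dotp x (T x)))).
    by have := second x; lra.
  have [xr|xr] := leP (2 - r ^- 2 * dotp x x) 0.
    by rewrite smooth_step'_le0// mul0r mulr0 oppr_le0 ltW.
  have x2r : enorm x <= 2 * r.
    rewrite -ler_sqr ?nnegrE ?enorm_ge0 ?mulr_ge0 ?(ltW r0)// enormE exprMn.
    rewrite subr_gt0 mulrC ltr_pdivrMr ?exprn_gt0// in xr.
    by have := sqr_ge0 r; lra.
  have xT : `|dotp x (T x)| <= 2 * r.
    apply: le_trans (normr_dotp_le _ _) _; apply: le_trans x2r.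
    by rewrite ler_piMr ?enorm_ge0.
  pose c := height_cut eta x * smooth_step' (2 - r ^- 2 * dotp x x).
  have c0 : 0 <= c by rewrite mulr_ge0 ?smooth_step_ge0 ?smooth_step'_ge0.
  have cK : c <= K.
    by rewrite -[leRHS]mul1r ler_pM ?smooth_step_ge0 ?smooth_step_le1 ?smooth_step'_ge0.
  have -> : height_cut eta x * (smooth_step' (2 - r ^- 2 * dotp x x) *
      (- (r ^- 2) * (2 * dotp x (T x)))) = - (c * (r ^- 2 * (2 * dotp x (T x)))).
    by rewrite /c; ring.
  rewrite lerN2; apply: (@le_trans _ _ (K * (4 / r))).
    apply: le_trans (ler_norm _) _; rewrite normrM ger0_norm// ler_pM//.
    rewrite normrM ger0_norm ?invr_ge0 ?sqr_ge0// normrM ger0_norm//.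
    have -> : 4 / r = r ^- 2 * (2 * (2 * r)) by field; rewrite gt_eqF.
    by rewrite ler_wpM2l ?invr_ge0 ?sqr_ge0// ler_wpM2l.
  by rewrite mulrA ler_pdivrMr// mulrC.
- move=> x xeta xr [k xk]; rewrite divergence_cut//.
  have arg1 : 1 <= 2 - r ^- 2 * dotp x x.
    have : r ^- 2 * dotp x x <= 1.
      rewrite mulrC ler_pdivrMr ?exprn_gt0// mul1r -enormE.
      rewrite ler_sqr ?nnegrE ?enorm_ge0 ?(ltW r0)//; apply: le_trans xr _.
      by rewrite lerDl !mulr_ge0 ?invr_ge0 ?ltW.
    by lra.
  have arg2 : 1 <= - (2 / eta) * x 0 0 - 1.
    have : (2 / eta) * eta <= (2 / eta) * (- x 0 0).
      by rewrite ler_wpM2l ?divr_ge0 ?(ltW eta0)//; lra.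
    by rewrite divfK ?gt_eqF//; lra.
  rewrite (smooth_step'_ge1 arg1) mul0r mulr0 addr0.
  rewrite {1}/radial_cut {1}/height_cut !smooth_step_ge1// !mul1r.
  suff : N%:R / rho <= divergence T x by have := second x; lra.
  have dens : (1 - t) ^+ N <= @knothe_density R n m phi x.
    rewrite /knothe_density (bigD1 k)//= -[leLHS]addr0 lerD//.
      rewrite big_mkord (_ : (1 - t) ^+ N = \prod_(i < N) (1 - t)); last first.
        by rewrite prodr_const card_ord.
      apply: ler_prod => i _; rewrite subr_ge0 (ltW t1)/= -{1}Mt.
      have /andP[x1 x2] := xk i.
      by apply: bump_ge => //; rewrite /W inord_val//; lra.
    by apply: sumr_ge0 => j _; apply: prodr_ge0 => l _; exact: ltW.
  have E4 (X1 X2 X3 X4 : R) : X1 * X2 * X3 * X4 = X1 * X3 * (X2 * X4) by ring.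
  have := AMGM x; set D := divergence T x / N%:R => amgm.
  have D0 : 0 <= D by rewrite divr_ge0.
  have h1 : kappa * (1 - t) ^+ N <= kappa * (1 - t) ^+ N * (rho * D) ^+ N.
    apply: le_trans (_ : kappa * @knothe_density R n m phi x <= _).
      by rewrite ler_pM2l.
    apply: le_trans amgm _.
    apply: le_trans (_ : kappa * rho ^+ N * (1 - t) ^+ N * D ^+ N <= _).
      by apply: ler_wpM2r; [exact: exprn_ge0|exact: ltW].
    rewrite [(rho * D) ^+ N]exprMn le_eqVlt; apply/orP; left; apply/eqP.
    exact: E4.
  have h2 : 1 <= (rho * D) ^+ N.
    by rewrite -(ler_pMr _ (mulr_gt0 kappa0 t1N)).
  have h3 : 1 <= rho * D.
    rewrite leNgt; apply/negP => rD.
    have : (rho * D) ^+ N < 1.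
      by rewrite exprn_ilt1// mulr_ge0// ltW.
    by rewrite ltNge h2.
  have -> : divergence T x = D * N%:R by rewrite divfK// pnatr_eq0.
  rewrite ler_pdivrMr// (_ : D * N%:R * rho = N%:R * (rho * D)); last by ring.
  by rewrite -[leLHS]mulr1 ler_pM2l.
Qed.

End HalfSpaceField.

(** * Isoperimetry in half-spaces *)

Section TestFields.
Variables (R : realType) (n : nat).
Local Notation V := 'rV[R]_n.+1.
Local Notation mu := (lebesgue R n).
Implicit Types (x v : V) (xi : V -> V) (A C E G : set V).

Lemma Ck_coordP k xi : Ck k xi -> forall i, Cks k (fun x => xi x 0 i).
Proof.
elim: k xi => [|k IH] xi.
  move=> cxi i x; apply: (@continuous_comp _ _ _ xi (fun z : V => z 0 i)); first exact: cxi.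
  exact: coord_continuous.
move=> [dxi Dxi] i; split=> [x|v].
  by apply: (@differentiable_comp _ _ _ _ xi (fun z : V => z 0 i)) => //; exact: differentiable_coord.
rewrite (_ : 'D_v _ = fun x => 'D_v xi x 0 i); first by apply: IH; exact: Dxi.
by apply/funext => x; rewrite derive_coord.
Qed.

Lemma continuous_divergence xi : Ck 1 xi -> continuous (divergence xi).
Proof.
move=> [_ Dxi]; apply: continuous_sumr => i _ x.
apply: (@continuous_comp _ _ _ ('D_(delta_mx 0 i) xi) (fun z : V => z 0 i)); first exact: Dxi.
exact: coord_continuous.
Qed.

Lemma divergence_out_support xi x : ~ closure [set x | xi x != 0] x -> divergence xi x = 0.
Proof.
move=> nx; apply: big1 => i _.
rewrite (@near_eq_derive _ _ _ xi (cst 0)) ?derive_cst ?mxE//.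
have : nbhs x (~` closure [set x | xi x != 0]).
  by apply: open_nbhs_nbhs; split=> //; apply: closed_openC; exact: closed_closure.
apply: filterS => y ny; apply: contra_notP ny => /eqP xi0.
exact: subset_closure.
Qed.

Lemma divergence_bounded xi : Ck 1 xi -> compact (closure [set x | xi x != 0]) ->
  exists2 B : R, 0 <= B & forall x, `|divergence xi x| <= B.
Proof.
move=> C1 cxi; set S := closure _ in cxi.
have [S0|S0] := pselect (S !=set0); last first.
  exists 0 => // x; rewrite divergence_out_support ?normr0// => Sx.
  by apply: S0; exists x.
have cd : continuous (fun x => `|divergence xi x|).
  move=> x; apply: (@continuous_comp _ _ _ (divergence xi) Num.norm).
    exact: continuous_divergence.
  exact: norm_continuous.
have [c _ h] := EVT_max_rV S0 cxi (continuous_subspaceT cd).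
exists `|divergence xi c|; first exact: normr_ge0.
move=> x.
have [Sx|Sx] := pselect (S x); first by apply: h; exact/mem_set.
by rewrite divergence_out_support ?normr0.
Qed.

Lemma measurable_divergence xi : Ck 1 xi ->
  measurable_fun setT (divergence xi : lebesgue_space R n -> R).
Proof. by move=> C1; apply: continuous_lebesgue_measurable; exact: continuous_divergence. Qed.

Lemma integrable_bounded E (f : V -> R) (B : R) : lebesgue_measurable E ->
  (mu E < +oo)%E -> measurable_fun setT (f : lebesgue_space R n -> R) ->
  (forall x, `|f x| <= B) -> mu.-integrable E (EFin \o f).
Proof.
move=> mE Efin mf fB; apply: measurable_bounded_integrable => //.
  exact: measurable_funTS.
by exists B; split; [exact: num_real|move=> M BM x _; apply: le_trans (fB x) (ltW BM)].
Qed.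

(** After adding [eps] the integrand is nonnegative and, on [E], above [c] times the indicator of
    [G]. *)
Lemma integral_ge_on E G (f : V -> R) (B c eps : R) :
  lebesgue_measurable E -> lebesgue_measurable G -> G `<=` E -> (mu E < +oo)%E ->
  measurable_fun setT (f : lebesgue_space R n -> R) -> (forall x, `|f x| <= B) ->
  0 <= c -> 0 <= eps -> (forall x, - eps <= f x) -> (forall x, G x -> c <= f x) ->
  (c%:E * mu G - eps%:E * mu E <= \int[mu]_(x in E) (f x)%:E)%E.
Proof.
move=> mE mG GE Efin mf fB c0 eps0 feps fG.
have Ef : mu E \is a fin_num by rewrite ge0_fin_numE.
have mfE : measurable_fun (E : set (lebesgue_space R n)) (f : lebesgue_space R n -> R) by exact: measurable_funTS.
have If := integrable_bounded mE Efin mf fB.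
have Ie : mu.-integrable E (EFin \o cst eps) by apply: (@integrable_bounded E (fun=> eps) `|eps|) => //; exact: measurable_cst.
rewrite leeBlDr ?fin_numM//.
have -> : (eps%:E * mu E = \int[mu]_(x in E) (cst eps%:E) x)%E by rewrite integral_cst.
rewrite -(integralD mE If Ie).
rewrite -[X in (_ * mu X)%E](setIidl GE) -integral_indic//.
rewrite -ge0_integralZl//; last by apply/measurable_EFinP; exact: measurable_indic.
apply: ge0_le_integral; first exact: mE.
- by move=> x _; rewrite mule_ge0// lee_fin.
- by apply: measurable_funeM; apply/measurable_EFinP; exact: measurable_indic.
- by apply/measurable_EFinP; apply: measurable_funD => //; exact: measurable_cst.
- move=> x Ex; rewrite -EFinM -EFinD lee_fin indicE /=; case: (boolP (x \in G)) => [/set_mem Gx|_].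
    by rewrite mulr1; have := fG x Gx; lra.
  by rewrite mulr0; have := feps x; lra.
Qed.

End TestFields.

(** * Transport of test fields by isometries *)

Section Isometry.
Variables (R : realType) (n : nat) (O : 'M[R]_n.+1) (c : 'rV[R]_n.+1).
Hypothesis O_refl : reflection_mx O.
Local Notation V := 'rV[R]_n.+1.
Implicit Types (x v : V) (xi : V -> V) (A C E G : set V).

Let psi x : V := (x - c) *m O.

Let psi_line x v (t : R) : psi (t *: v + x) = t *: (v *m O) + psi x.
Proof. by rewrite /psi -addrA mulmxDl scalemxAl. Qed.

Lemma derive_isometry (f : V -> R) x v :
  'D_v (fun x => f ((x - c) *m O)) x = 'D_(v *m O) f ((x - c) *m O).
Proof.
rewrite /derive.
set g1 := fun h => h^-1 *: _; set g2 := fun h => h^-1 *: _.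
suff -> : g1 = g2 by [].
by apply/funext => h; rewrite /g1 /g2 /= -/(psi _) psi_line.
Qed.

Lemma Cks_isometry k (f : V -> R) : Cks k f -> Cks k (fun x => f ((x - c) *m O)).
Proof.
have Cpsi j i : Cks j (fun x => psi x 0 i).
  rewrite (_ : (fun x => _) = fun x => \sum_l (x 0 l - c 0 l) * O l i).
    apply: Cks_sum => l _; apply: CksM; last exact: Cks_cst.
    by apply: CksB; [exact: Cks_coord_fun|exact: Cks_cst].
  by apply/funext => x; rewrite mxE; apply: eq_bigr => l _; rewrite !mxE.
have C1 : Ck 1 psi by apply: Ck_coord => i.
elim: k f => [|k IH] f Cf.
  move=> x; apply: (@continuous_comp _ _ _ psi f); last exact: Cf.
  by apply: differentiable_continuous; have [] := C1.
have [df Df] := Cf; split=> [x|v].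
  by apply: (@differentiable_comp _ _ _ _ psi f) => //; have [] := C1.
rewrite (_ : 'D_v _ = fun x => 'D_(v *m O) f ((x - c) *m O)).
  by apply: (IH ('D_(v *m O) f)); exact: Df.
by apply/funext => x; exact: derive_isometry.
Qed.

Lemma continuous_isometry : continuous psi.
Proof.
have C1 : Ck 0 psi.
  apply: Ck_coord => i.
  exact: (Cks_isometry (Cks_coord_fun _ 0 i)).
exact: C1.
Qed.

Definition pullback xi x : V := xi ((x - c) *m O) *m O.

Lemma pullback_coord xi x i : pullback xi x 0 i = \sum_l O l i * xi ((x - c) *m O) 0 l.
Proof. by rewrite mxE; apply: eq_bigr => l _; rewrite mulrC. Qed.

(** The differential is conjugated by [O], and [O] being an involution preserves its trace. *)
Lemma divergence_pullback xi x : Ck 1 xi ->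
  divergence (pullback xi) x = divergence xi ((x - c) *m O).
Proof.
move=> C1; have Ci := Ck_coordP C1.
have Cp i : Cks 1 (fun x => xi ((x - c) *m O) 0 i) by exact: (Cks_isometry (Ci i)).
have dxi y l : differentiable (fun z => xi z 0 l) y by have [] := Ci l.
have dp : differentiable (pullback xi) x.
  have [] // : Ck 1 (pullback xi).
  apply: Ck_coord => i.
  rewrite (_ : (fun x => _) = fun x => \sum_l O l i * xi ((x - c) *m O) 0 l).
    by apply: Cks_sum => l _; apply: CksZ.
  by apply/funext => y; exact: pullback_coord.
have term i : ('D_(delta_mx 0 i) (pullback xi) x) 0 i =
    \sum_l \sum_k (O l i * O i k) * 'D_(delta_mx 0 k) (fun y => xi y 0 l) ((x - c) *m O).
  rewrite derive_coord//.
  rewrite (_ : (fun y => _) = \sum_(l < n.+1) (O l i \*: (fun y => xi ((y - c) *m O) 0 l))); last first.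
    by apply/funext => y; rewrite fct_sumE pullback_coord.
  rewrite derive_sum; last first.
    by move=> l; apply: derivableZ; apply: diff_derivable; have [] := Cp l.
  apply: eq_bigr => l _; rewrite deriveZ; last first.
    by apply: diff_derivable; have [] := Cp l.
  rewrite (derive_isometry (fun z : V => xi z 0 l)) deriveE//.
  have -> : delta_mx 0 i *m O = \sum_k O i k *: (delta_mx 0 k : V).
    rewrite -rowE; apply/rowP => k; rewrite summxE (bigD1 k)//= !mxE !eqxx mulr1.
    by rewrite big1 ?addr0// => j jk; rewrite !mxE [k == j]eq_sym (negPf jk) andbF mulr0.
  rewrite linear_sum/= scaler_sumr; apply: eq_bigr => k _.
  by rewrite linearZ/= -deriveE// scalerA.
rewrite /divergence (eq_bigr _ (fun i _ => term i)) exchange_big/=.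
apply: eq_bigr => l _; rewrite exchange_big/= (bigD1 l)//=.
have OO k : \sum_i O l i * O i k = (l == k)%:R.
  by have := O_refl.2; move/matrixP => /(_ l k); rewrite !mxE.
rewrite -mulr_suml OO eqxx mul1r big1 ?addr0.
  by rewrite derive_coord//; have [] := C1.
by move=> k kl; rewrite -mulr_suml OO eq_sym (negPf kl) mul0r.
Qed.

Lemma test_field_pullback C xi : test_field C xi ->
  test_field [set x | C ((x - c) *m O)] (pullback xi).
Proof.
move=> [sxi cxi suppC xi1].
set S := closure _ in cxi suppC.
have cS : closed S by exact: closed_closure.
have clS : closed (psi @^-1` S).
  by apply: closed_comp => // x _; exact: continuous_isometry.
have supp : closure [set x | pullback xi x != 0] `<=` psi @^-1` S.
  rewrite [X in _ `<=` X](closure_id _).1//; apply: closure_subset => x /= px.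
  apply: subset_closure => /=; apply: contra px => /eqP px.
  by rewrite /pullback -/(psi x) px mul0mx.
split.
- move=> k; apply: Ck_coord => i.
  rewrite (_ : (fun x => _) = fun x => \sum_l O l i * xi ((x - c) *m O) 0 l).
    apply: Cks_sum => l _; apply: CksZ.
    exact: (Cks_isometry (Ck_coordP (sxi k) l)).
  by apply/funext => y; exact: pullback_coord.
- apply: (@subclosed_compact _ _ (psi @^-1` S)) => //; first exact: closed_closure.
  apply: bounded_closed_compact => //.
  have [r hr] := bounded_enorm (compact_bounded cxi).
  apply: (@enorm_bounded _ _ _ (r + enorm c)) => x /hr; rewrite /psi enorm_reflection//.
  by have := enorm_trans c x 0; rewrite !subr0; lra.
- move=> x /supp /suppC => Cx.
  have : open (psi @^-1` C°).
    by apply: open_comp => [y _|]; [exact: continuous_isometry|exact: open_interior].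
  rewrite openE => /(_ x Cx); apply: interiorS => y; exact: interior_subset.
- by move=> x; rewrite /pullback enorm_reflection.
Qed.

Lemma outer_lebesgue_isometry A :
  outer_lebesgue [set (x - c) *m O | x in A] = outer_lebesgue A.
Proof.
rewrite -(outer_lebesgue_translate (- c) A) -(outer_lebesgue_reflection O_refl (translate (- c) A)).
congr outer_lebesgue; apply/seteqP; split=> [_ [x Ax <-]|_ [_ [x Ax <-] <-]].
  by exists (- c + x); [exists x|rewrite addrC].
by exists x; rewrite // addrC.
Qed.

End Isometry.

Section HalfSpaceLowerBound.
Variables (R : realType) (n : nat).
Local Notation N := n.+2.
Local Notation V := 'rV[R]_n.+2.
Local Notation mu := (lebesgue R n.+1).
Implicit Types (x y a : V) (A E : set V).

Lemma outer_lebesgue_bigcup0 A (F : nat -> set V) : A `<=` \bigcup_k F k ->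
  (forall k, outer_lebesgue (F k) = 0%E) -> outer_lebesgue A = 0%E.
Proof.
move=> AF F0; apply/eqP; rewrite eq_le outer_lebesgue_ge0 andbT.
apply: le_trans (le_outer_lebesgue AF) _.
apply: le_trans (outer_lebesgue_sigma_subadditive _) _.
by rewrite eseries0.
Qed.

(** Slabs of thickness 0 over balls. The region where [half_space_field] gives a large divergence
    stays away from the boundary, so the boundary must be negligible. *)
Lemma outer_lebesgue_hyperplane : outer_lebesgue [set x : V | x 0 0 = 0] = 0%E.
Proof.
pose F (k : nat) := [set x : V | x 0 0 = 0] `&` eclosed_ball (0 : V) k.+1%:R.
apply: (@outer_lebesgue_bigcup0 _ F).
  move=> x x0; exists (Num.trunc (enorm x)) => //; split=> //.
  by rewrite /eclosed_ball/= subr0; apply: ltW; exact: truncnS_gt.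
move=> k; apply/eqP; rewrite eq_le outer_lebesgue_ge0 andbT.
apply: le_trans (@outer_lebesgue_closed_slab _ _ _ (eclosed_ball 0 k.+1%:R) 0 0
  (k.+1%:R ^+ n.+1 * ball_const R n) (lexx _) _ _) _.
- rewrite eclosed_ball_dilate// outer_lebesgue_dilate// EFinM lee_pmul2l ?lte_fin ?exprn_gt0//.
  exact: outer_lebesgue_unit_ball.
- move=> x [x0 xk]; split; first by rewrite x0 lexx.
  move: xk; rewrite /eclosed_ball/= !subr0; apply: le_trans.
  by rewrite /enorm ler_wsqrtr// [leRHS]dotp_behead lerDr sqr_ge0.
- by rewrite subrr mul0r.
Qed.

Lemma closed_slab_box (l u : 'I_N -> R) : closed [set x : V | forall i, l i <= x 0 i <= u i].
Proof.
rewrite (_ : [set x : V | _] = \bigcap_i ((fun x : V => x 0 i) @^-1` [set t | l i <= t <= u i])).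
  apply: closed_bigI => i _; apply: closed_comp => [x _|]; first exact: coord_continuous.
  rewrite (_ : [set t | _] = [set t | l i <= t] `&` [set t | t <= u i]); last first.
    by apply/seteqP; split=> t /=; [move/andP|move/andP].
  by apply: closedI; [exact: closed_ge|exact: closed_le].
by apply/seteqP; split=> x /= h i; [move=> _; exact: h|exact: h].
Qed.

(** Only the part of [E] in [H] counts, so that the whole space can be treated through half-spaces
    containing most of [E]. The definition of the outer measure supplies boxes covering this part,
    of total volume still below the half ball. With more and more of them and [eta] tending to 0,
    the regions of large divergence exhaust the part up to a null set. *)
Lemma half_space_perimeter E a (b r c : R) :
  lebesgue_measurable E -> (mu E < +oo)%E -> a != 0 -> 0 < r ->
  let H := [set x | dotp a x <= b] in
  (mu (E `&` H) < (half_ball_const R n * r ^+ N)%:E)%E ->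
  (c%:E < (N%:R / r)%:E * mu (E `&` H))%E ->
  exists2 xi, test_field H xi & (c%:E <= \int[mu]_(x in E) (divergence xi x)%:E)%E.
Proof.
move=> mE Efin a0 r0 H vr cv.
have a_gt0 : 0 < enorm a by rewrite enorm_gt0.
pose e := (enorm a)^-1 *: a.
have e1 : enorm e = 1 by rewrite enormZ ger0_norm ?invr_ge0 ?enorm_ge0// mulVf// gt_eqF.
have [Q QR eQ] := householder e1.
(* The point of the boundary hyperplane nearest to the origin. The isometry [psi] moves it to 0 and
   carries [H] to the half-space [x 0 0 <= 0]. *)
pose c0 := (b / enorm a) *: e.
pose psi x := (x - c0) *m Q.
have psi0 x : psi x 0 0 = (dotp a x - b) / enorm a.
  rewrite -dotp_delta -eQ dotp_reflection// dotpBl dotpZl -enormE e1 expr1n mulr1.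
  by rewrite dotpZr dotpC mulrBl; congr (_ - _); rewrite mulrC.
have HE x : H x <-> psi x 0 0 <= 0.
  by rewrite psi0 pmulr_lle0 ?invr_gt0// subr_le0.
have cH : closed H.
  rewrite (_ : H = dotp a @^-1` [set t | t <= b])//.
  by apply: closed_comp => [x _|]; [exact: continuous_dotpl|exact: closed_le].
pose E1 := E `&` H.
have mE1 : lebesgue_measurable E1.
  by apply: measurableI => //; exact: closed_lebesgue_measurable.
have E1fin : mu E1 \is a fin_num.
  rewrite ge0_fin_numE//; apply: le_lt_trans Efin.
  by apply: (@le_outer_lebesgue R n.+1) => x [].
have Ef : mu E \is a fin_num by rewrite ge0_fin_numE.
set v := fine (mu E1).
have vE : mu E1 = v%:E by rewrite /v fineK.
have v0 : 0 <= v by rewrite /v fine_ge0.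
rewrite -/E1 vE lte_fin in vr; rewrite -/E1 vE -EFinM lte_fin in cv.
have muX : outer_lebesgue (psi @` E1) = v%:E.
  by rewrite -vE; exact: outer_lebesgue_isometry.
have [_ [q qX <-] qv] : exists2 z, [set (\sum_(k <oo) (box_volume (q k))%:E)%E |
    q in box_cover (psi @` E1)] z & (z < v%:E + (half_ball_const R n * r ^+ N - v)%:E)%E.
  rewrite -muX; apply: lb_ereal_inf_adherent; first by rewrite subr_gt0.
  by rewrite -/(outer_lebesgue _) muX.
rewrite -EFinD addrC subrK in qv.
pose al (k : nat) : V := (q k).1.
pose w (k : nat) : V := \row_i Num.max 0 ((q k).2 0 i - (q k).1 0 i).
pose eta (j : nat) : R := j.+1%:R^-1.
have eta0 j : 0 < eta j by rewrite invr_gt0.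
(* The part of the [k]-th box where the field of parameter [eta j] is controlled: away from the
   boundary hyperplane, in a bounded ball and off the left faces. *)
pose Z j k : set V := [set y : V | y 0 0 <= - eta j] `&` eclosed_ball (0 : V) (eta j)^-1 `&`
  [set y : V | forall i, al k 0 i + eta j <= y 0 i <= al k 0 i + w k 0 i].
have cZ j k : closed (Z j k).
  apply: closedI; last exact: closed_slab_box.
  apply: closedI; last exact: closed_eclosed_ball.
  rewrite (_ : [set y : V | y 0 0 <= - eta j] = (fun x : V => x 0 0) @^-1` [set t | t <= - eta j])//.
  by apply: closed_comp => [x _|]; [exact: coord_continuous|exact: closed_le].
pose G j := E1 `&` \bigcup_(k in [set k | (k <= j)%N]) (psi @^-1` Z j k).
have mG j : lebesgue_measurable (G j).
  apply: measurableI => //; apply: bigcup_measurable => k _.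
  apply: closed_lebesgue_measurable; apply: closed_comp => // x _.
  exact: continuous_isometry.
have eta_le i j : (i <= j)%N -> eta j <= eta i.
  by move=> ij; rewrite lef_pV2 ?posrE// ler_nat.
have G_mono : {homo G : i j / (i <= j)%N >-> (i <= j)%O}.
  move=> i j ij; apply/subsetPset => x [E1x [k /= ki [[h1 h2] h3]]]; split=> //.
  have eij := eta_le _ _ ij.
  exists k => /=; first exact: leq_trans ki ij.
  split; [split|].
  - by rewrite /= (le_trans h1)// lerN2.
  - by rewrite /eclosed_ball/= (le_trans h2)// lef_pV2 ?posrE.
  - by move=> l; have /andP[h3l ->] := h3 l; rewrite andbT (le_trans _ h3l)// lerD2l.
have G_cover : E1 `&` [set x | psi x 0 0 < 0] `<=` \bigcup_j G j.
  move=> x [E1x px0].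
  have [k _ xk] : (\bigcup_k box (q k)) (psi x) by apply: qX; exists x.
  have H1 : \forall j \near \oo, forall i, eta j <= psi x 0 i - al k 0 i.
    apply: filter_forall => i.
    have p : 0 < psi x 0 i - al k 0 i by rewrite subr_gt0; have /andP[] := xk i.
    by apply: filterS (near_infty_natSinv_lt (PosNum p)) => j; exact: ltW.
  have H2 : \forall j \near \oo, eta j <= - psi x 0 0.
    have p : 0 < - psi x 0 0 by rewrite oppr_gt0.
    by apply: filterS (near_infty_natSinv_lt (PosNum p)) => j; exact: ltW.
  have H3 : \forall j \near \oo, eta j <= (enorm (psi x) + 1)^-1.
    have p : 0 < (enorm (psi x) + 1)^-1 by rewrite invr_gt0 ltr_wpDl// enorm_ge0.
    by apply: filterS (near_infty_natSinv_lt (PosNum p)) => j; exact: ltW.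
  have H4 : \forall j \near \oo, (k <= j)%N by exact: nbhs_infty_ge.
  have [j [[[h1 h2] h3] h4]] := filter_ex (filterI (filterI (filterI H1 H2) H3) H4).
  exists j => //; split=> //; exists k => //; split; [split|].
  - by rewrite /= lerNr.
  - rewrite /eclosed_ball/= subr0 -[leLHS]invrK.
    have [->|px] := eqVneq (enorm (psi x)) 0; first by rewrite invr0 invr0 invr_ge0 ltW.
    have px' : 0 < enorm (psi x) by rewrite lt_def px enorm_ge0.
    rewrite lef_pV2 ?posrE ?invr_gt0//; apply: le_trans h3 _.
    have px1 : 0 < enorm (psi x) + 1 by rewrite ltr_wpDr.
    by rewrite lef_pV2 ?posrE// lerDl.
  - move=> i; have /andP[x1 x2] := xk i; have := h1 i => h1i.
    apply/andP; split; first by lra.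
    rewrite -lerBlDl [leRHS]mxE le_max; apply/orP; right.
    by rewrite lerD2r.
have G_E1 : (outer_lebesgue E1 <= outer_lebesgue (\bigcup_j G j))%E.
  apply: le_trans (le_outer_lebesgue (y := (\bigcup_j G j) `|` [set x | psi x 0 0 = 0]) _) _.
    move=> x E1x; have := (HE x).1 E1x.2; rewrite le_eqVlt => /orP[/eqP|] px.
      by right.
    by left; apply: G_cover; split.
  apply: le_trans (outer_measureU2 _ _ _) _.
  rewrite [X in (_ + X <= _)%E](_ : _ = 0%E) ?adde0//.
  rewrite -[LHS](outer_lebesgue_isometry c0 QR).
  apply/eqP; rewrite eq_le outer_lebesgue_ge0 andbT -outer_lebesgue_hyperplane.
  by apply: le_outer_lebesgue => _ [x px <-].
have muG : mu (\bigcup_j G j) = v%:E.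
  rewrite -vE; apply/eqP; rewrite eq_le; apply/andP; split; last exact: G_E1.
  by apply: (@le_outer_lebesgue R n.+1) => x [j _ []].
have mUG : lebesgue_measurable (\bigcup_j G j) by apply: bigcupT_measurable.
have K0 : 0 < N%:R / r by rewrite divr_gt0.
(* Half of the gap pays for the portion missed by [G j], the other half for the lower bound [- eps]
   of the divergence on all of [E]. *)
pose gap := N%:R / r * v - c.
have gap0 : 0 < gap by rewrite subr_gt0.
pose d := gap / (2 * (N%:R / r)).
have d0 : 0 < d by rewrite divr_gt0// mulr_gt0.
have [j Gj] : exists j, ((v - d)%:E < mu (G j))%E.
  have cvgG := @nondecreasing_cvg_mu _ _ _ mu G mG mUG G_mono.
  have : nbhs (mu (\bigcup_j G j)) [set z | ((v - d)%:E < z)%E].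
    apply: open_nbhs_nbhs; split; first exact: open_ereal_gt_ereal.
    have vd : v - d < v by lra.
    by move: vd; rewrite -lte_fin -muG.
  by move=> /cvgG [j _ hj]; exists j; apply: hj => /=.
have Gjfin : mu (G j) \is a fin_num.
  rewrite ge0_fin_numE//; apply: le_lt_trans (_ : mu E1 < +oo)%E; last by rewrite vE ltry.
  by apply: (@le_outer_lebesgue R n.+1) => x [].
pose eps := gap / (2 * (fine (mu E) + 1)).
have fE0 : 0 <= fine (mu E) by rewrite fine_ge0.
have eps0 : 0 < eps by rewrite divr_gt0// mulr_gt0//; lra.
have mass : \sum_(k < j.+1) \prod_i w k 0 i < half_ball_const R n * r ^+ N.
  rewrite -lte_fin; apply: le_lt_trans qv; rewrite -sumEFin.
  apply: le_trans (nneseries_lim_ge (P := xpredT) (m := 0%N) j.+1 _) => //=; last first.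
    by move=> k _ _; rewrite lee_fin box_volume_ge0.
  rewrite big_mkord; apply: lee_sum => k _; rewrite lee_fin le_eqVlt; apply/orP; left; apply/eqP.
  by apply: eq_bigr => i _; rewrite mxE.
have w_ge0 (k : 'I_j.+1) i : 0 <= w k 0 i by rewrite mxE le_max lexx.
have [xi [xiT xieps xigood]] :=
  @half_space_field R n j (fun k => al k) (fun k => w k) r (eta j) eps w_ge0 r0 (eta0 j) eps0 mass.
have [sxi cxi _ _] := xiT.
have C1 : Ck 1 xi := sxi 1%N.
have := test_field_pullback c0 QR xiT.
have -> : [set x | [set y : V | y 0 0 <= 0] ((x - c0) *m Q)] = H.
  by apply/seteqP; split=> x hx; apply/HE.
move=> pT; exists (pullback Q c0 xi) => //.
have [spT cpT _ _] := pT.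
have [B B0 HB] := divergence_bounded (spT 1%N) cpT.
apply: le_trans (integral_ge_on (c := N%:R / r) (eps := eps) mE (mG j) _ Efin
  (measurable_divergence (spT 1%N)) HB (ltW K0) (ltW eps0) _ _).
- rewrite -(fineK Gjfin) -(fineK Ef) -!EFinM -EFinB lee_fin.
  rewrite -(fineK Gjfin) lte_fin in Gj.
  have h1 : N%:R / r * (v - d) <= N%:R / r * fine (mu (G j)) by rewrite ler_pM2l// ltW.
  have h2 : N%:R / r * d = gap / 2 by rewrite /d; field; rewrite !gt_eqF//= pnatr_eq0.
  have h3 : eps * fine (mu E) <= gap / 2.
    rewrite /eps mulrAC ler_pdivrMr; last by lra.
    by rewrite mulrA divfK// ler_pM2l//; lra.
  by rewrite mulrBr in h1; rewrite /gap in h2 h3; lra.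
- by move=> x [[]].
- by move=> x; rewrite divergence_pullback.
- move=> x [E1x [k /= kj [[z1 z2] z3]]]; rewrite divergence_pullback//.
  apply: xigood => //; first by move: z2; rewrite /eclosed_ball/= subr0.
  by exists (Ordinal (kj : (k < j.+1)%N)).
Qed.

End HalfSpaceLowerBound.

(** * Perimeter of ball sections *)

Section Integration.
Variables (R : realType) (n : nat).
Local Notation V := 'rV[R]_n.+1.
Local Notation mu := (lebesgue R n).
Implicit Types (x v w : V) (f : V -> R).

Lemma eclosed_ball_translate c (r : R) :
  eclosed_ball c r = translate c (eclosed_ball (0 : V) r).
Proof.
apply/seteqP; split=> [x xr|_ [x xr <-]]; last by move: xr; rewrite /eclosed_ball/= subr0 addrC addKr.
by exists (x - c); rewrite ?/eclosed_ball/= ?subr0// addrC subrK.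
Qed.

Lemma outer_lebesgue_ball_le (c : V) (r : R) : 0 < r ->
  (outer_lebesgue (eclosed_ball c r) <= (r ^+ n.+1 * ball_const R n)%:E)%E.
Proof.
move=> r0; rewrite eclosed_ball_translate outer_lebesgue_translate eclosed_ball_dilate//.
rewrite outer_lebesgue_dilate// EFinM lee_pmul2l ?lte_fin ?exprn_gt0//.
exact: outer_lebesgue_unit_ball.
Qed.

Lemma outer_lebesgue_ball_fin (c : V) (r : R) : (outer_lebesgue (eclosed_ball c r) < +oo)%E.
Proof.
apply: (@le_lt_trans _ _ (outer_lebesgue (eclosed_ball c (`|r| + 1)))).
  apply: le_outer_lebesgue => x; rewrite /eclosed_ball/= => h; apply: (le_trans h).
  by have := ler_norm r; lra.
by apply: le_lt_trans (outer_lebesgue_ball_le _ _) _; rewrite ?ltry// ltr_wpDl.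
Qed.

Lemma lebesgue_measurable_translate w (A : set V) : lebesgue_measurable A ->
  lebesgue_measurable (translate w A).
Proof.
move=> mA; have cA : (@outer_lebesgue R n).-caratheodory A := mA.
suff cwA : (@outer_lebesgue R n).-caratheodory (translate w A) by [].
move=> X; have h := cA (translate (- w) X).
have X1 : X `&` translate w A = translate w (translate (- w) X `&` A).
  apply/seteqP; split=> [y [Xy [x Ax xy]]|_ [_ [[x Xx <-] Ax] <-]].
    by exists x => //; split=> //; exists y; rewrite // -xy addKr.
  by rewrite addrA subrr add0r; split=> //; exists (- w + x) => //; rewrite addrA subrr add0r.
have X2 : X `&` ~` translate w A = translate w (translate (- w) X `&` ~` A).
  apply/seteqP; split=> [x [Xx Ax]|_ [_ [[x Xx <-] Ax] <-]].
    exists (- w + x); last by rewrite addrA subrr add0r.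
    split; first by exists x.
    by move=> Ax'; apply: Ax; exists (- w + x) => //; rewrite addrA subrr add0r.
  rewrite addrA subrr add0r; split=> // -[y Ay yx]; apply: Ax.
  by rewrite -yx addKr.
by rewrite X1 X2 !outer_lebesgue_translate -h outer_lebesgue_translate.
Qed.

Lemma measurable_fun_translate w :
  measurable_fun setT (fun x : lebesgue_space R n => (w + x : lebesgue_space R n)).
Proof.
move=> _ A mA; rewrite setTI.
rewrite (_ : _ @^-1` A = translate (- w) A); first exact: lebesgue_measurable_translate.
apply/seteqP; split=> [x Ax|_ [x Ax <-]]; first by exists (w + x); rewrite ?addKr.
by rewrite /preimage/= addrA subrr add0r.
Qed.

Lemma continuous_translate w : continuous (fun x : V => w + x).
Proof.
apply: (@Ck_coord R n 0 (fun x : V => w + x)) => i.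
rewrite (_ : (fun x : V => _) = fun x : V => w 0 i + x 0 i); last by apply/funext => y; rewrite mxE.
by apply: (@CksD _ _ 0); [exact: Cks_cst|exact: Cks_coord_fun].
Qed.

Lemma continuous_support_bounded f c (r : R) : continuous f ->
  (forall x, r < enorm (x - c) -> f x = 0) -> exists2 B, 0 <= B & forall x, `|f x| <= B.
Proof.
move=> cf f0.
have [S0|S0] := pselect (eclosed_ball c r !=set0); last first.
  exists 0 => // x; rewrite f0 ?normr0// ltNge; apply/negP => xr.
  by apply: S0; exists x.
have cd : continuous (fun x => `|f x|).
  by move=> x; apply: (@continuous_comp _ _ _ f Num.norm); [exact: cf|exact: norm_continuous].
have [y _ h] := EVT_max_rV S0 (@compact_eclosed_ball _ _ c r) (continuous_subspaceT cd).
exists `|f y|; first exact: normr_ge0.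
move=> x; have [xr|xr] := leP (enorm (x - c)) r; first by apply: h; exact/mem_set.
by rewrite f0 ?normr0.
Qed.

Lemma integral_support f c (r : R) : (forall x, r < enorm (x - c) -> f x = 0) ->
  (\int[mu]_(x in eclosed_ball c r) (f x)%:E = \int[mu]_x (f x)%:E)%E.
Proof.
move=> f0; rewrite integral_mkcond; apply: eq_integral => x _.
rewrite patchE; case: ifPn => // /negP xr.
rewrite f0// ltNge; apply/negP => h; apply: xr; exact/mem_set.
Qed.

Lemma integrable_support f c (r : R) : continuous f ->
  (forall x, r < enorm (x - c) -> f x = 0) -> mu.-integrable setT (EFin \o f).
Proof.
move=> cf f0; have [B B0 fB] := continuous_support_bounded cf f0.
have mb : lebesgue_measurable (eclosed_ball c r).
  by apply: closed_lebesgue_measurable; exact: closed_eclosed_ball.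
have := integrable_bounded mb (outer_lebesgue_ball_fin _ _) (continuous_lebesgue_measurable cf) fB.
rewrite integrable_mkcond// (_ : _ \_ _ = EFin \o f)//.
apply/funext => x; rewrite patchE; case: ifPn => // /negP xr /=.
by rewrite f0// ltNge; apply/negP => h; apply: xr; exact/mem_set.
Qed.

Lemma integral_measure_preserving d (T : measurableType d)
    (nu : {measure set T -> \bar R}) (phi : T -> T) (g : T -> \bar R) :
  measurable_fun setT phi -> (forall A, measurable A -> nu (phi @^-1` A) = nu A) ->
  measurable_fun setT g -> nu.-integrable setT (g \o phi) ->
  (\int[nu]_x (g \o phi) x = \int[nu]_x g x)%E.
Proof.
move=> mphi nuphi mg ig.
have := @integral_pushforward _ _ _ _ R phi mphi nu setT g mg _ measurableT.
rewrite preimage_setT => <- //.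
by apply: eq_measure_integral => A mA _; exact: nuphi.
Qed.

Lemma integral_translate f w r : continuous f -> (forall x, r < enorm x -> f x = 0) ->
  (\int[mu]_x (f (w + x))%:E = \int[mu]_x (f x)%:E)%E.
Proof.
move=> cf f0.
have cfw : continuous (fun x => f (w + x)).
  move=> x; apply: (@continuous_comp _ _ _ (fun y : V => w + y) f); last exact: cf.
  exact: continuous_translate.
apply: (@integral_measure_preserving _ (lebesgue_space R n) mu
  (fun x => (w + x : lebesgue_space R n)) (EFin \o f)).
- exact: measurable_fun_translate.
- move=> A mA; rewrite -[RHS](@outer_lebesgue_translate _ _ (- w)); congr (outer_lebesgue _).
  apply/seteqP; split=> [x Ax|_ [x Ax <-]]; first by exists (w + x); rewrite ?addKr.
  by rewrite /preimage/= addrA subrr add0r.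
- apply/measurable_EFinP; exact: continuous_lebesgue_measurable.
- apply: (@integrable_support _ (- w) r) => // x.
  by rewrite opprK addrC; exact: f0.
Qed.

Lemma is_derive_line f x v (t : R) : differentiable f (t *: v + x) ->
  is_derive t (1 : R) (fun s : R => f (s *: v + x)) ('D_v f (t *: v + x)).
Proof.
move=> df.
have E s : (fun h : R => h^-1 *: (f ((h *: (1 : R) + t) *: v + x) - f (t *: v + x))) s
   = s^-1 *: (f (s *: v + (t *: v + x)) - f (t *: v + x)).
  by rewrite /= [_%:A]mulr1 scalerDl addrA.
have D : derivable f (t *: v + x) v by exact: diff_derivable.
have EE : (fun h : R => h^-1 *: (f ((h *: (1 : R) + t) *: v + x) - f (t *: v + x)))
   = fun s : R => s^-1 *: (f (s *: v + (t *: v + x)) - f (t *: v + x)).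
  by apply/funext => s; exact: E.
by split; rewrite /derivable /derive EE.
Qed.

Lemma difference_quotient_bound f v (B h : R) x : 0 < h -> Cks 1 f ->
  (forall x, `|'D_v f x| <= B) -> `|h^-1 * (f (h *: v + x) - f x)| <= B.
Proof.
move=> h0 [df _] fB.
have [||s s01 hs] := @MVT_segment R (fun s : R => f (s *: v + x))
    (fun s => 'D_v f (s *: v + x)) 0 h (ltW h0).
- by move=> s _; exact: is_derive_line.
- apply: derivable_within_continuous => s _.
  by have [] := @is_derive_line f x v s (df _).
rewrite scale0r add0r subr0 in hs.
by rewrite hs mulrC mulfK ?gt_eqF.
Qed.

(** Difference quotients have integral 0 by translation invariance, are bounded by the maximum of
    the derivative and vanish outside a common ball; dominated convergence concludes. *)
Lemma integral_derive f v r : Cks 1 f -> (forall x, r < enorm x -> f x = 0) ->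
  (\int[mu]_x ('D_v f x)%:E = 0)%E.
Proof.
move=> Cf f0; have cf : continuous f by exact: Cks_continuous Cf.
have cD : continuous ('D_v f) by have [_ h] := Cf; exact: h.
have D0 x : r < enorm x -> 'D_v f x = 0.
  move=> xr; rewrite (@near_eq_derive _ _ _ f (cst 0)) ?derive_cst//.
  have o : open [set y : V | r < enorm y].
    apply: (@open_comp _ _ (@enorm R n) [set t | r < t]); last exact: open_gt.
    by move=> y _; exact: continuous_enorm.
  by have := open_nbhs_nbhs (conj o xr); apply: filterS => y /f0.
have [B B0 DB] : exists2 B, 0 <= B & forall x, `|'D_v f x| <= B.
  by apply: (@continuous_support_bounded _ 0 r) => // x; rewrite subr0; exact: D0.
pose h (k : nat) : R := k.+1%:R^-1.
have h0 k : 0 < h k by rewrite invr_gt0.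
have h1 k : h k <= 1 by rewrite invf_le1// ler1n.
pose q k x := (h k)^-1 * (f (h k *: v + x) - f x).
(* The steps [h k] are at most 1, so the ball of radius [rho] contains the supports of all the
   difference quotients. *)
pose rho := r + enorm v.
have q0 k x : rho < enorm (x - 0) -> q k x = 0.
  rewrite /rho subr0 => xr; have v0 := enorm_ge0 v.
  rewrite /q !f0 ?subrr ?mulr0//; first by lra.
  have : enorm x <= enorm (h k *: v + x) + enorm (h k *: v).
    by have := enormD (h k *: v + x) (- (h k *: v)); rewrite enormN addrAC subrr add0r.
  rewrite enormZ gtr0_norm//.
  have : h k * enorm v <= enorm v by rewrite ler_piMl.
  lra.
have cfv k : continuous (fun x => f (h k *: v + x)).
  move=> x; apply: (@continuous_comp _ _ _ (fun y : V => h k *: v + y) f); last exact: cf.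
  exact: continuous_translate.
have cq k : continuous (q k).
  apply: (@CksM _ _ 0); first exact: Cks_cst.
  by apply: (@CksB _ _ 0); [exact: cfv|exact: cf].
have mb : lebesgue_measurable (eclosed_ball (0 : V) rho).
  by apply: closed_lebesgue_measurable; exact: closed_eclosed_ball.
have bfin := outer_lebesgue_ball_fin 0 rho.
have q_int k : (\int[mu]_(x in eclosed_ball 0%R rho) (q k x)%:E = 0)%E.
  rewrite integral_support; last exact: q0.
  have i1 : mu.-integrable setT (EFin \o f).
    by apply: (@integrable_support _ 0 r) => // x; rewrite subr0; exact: f0.
  have i2 : mu.-integrable setT (EFin \o (fun x => f (h k *: v + x))).
    apply: (@integrable_support _ (- (h k *: v)) r) => // x.
    by rewrite opprK addrC; exact: f0.
  under eq_integral do rewrite EFinM EFinB.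
  rewrite integralZl//; last exact: (integrableB _ i2 i1).
  rewrite (integralB _ i2 i1)// (integral_translate _ cf f0) subee ?mule0//.
  exact: (integrable_fin_num _ i1).
have q_cvg x : q k x @[k --> \oo] --> 'D_v f x.
  have dfx : derivable f x v by apply: diff_derivable; case: Cf.
  have F := (@cvgr_dnbhsP R (fun t : R => t^-1 *: (f (t *: v + x) - f x)) 0 ('D_v f x)).1 dfx h.
  apply: F.
  split=> [k|]; first by rewrite gt_eqF.
  exact: cvg_harmonic.
have [|||_ _] := @dominated_convergence _ _ _ mu _ mb (fun k x => (q k x)%:E)
  (fun x => ('D_v f x)%:E) (fun=> B%:E)
  (fun k => measurable_funTS ((measurable_EFinP _ _).2 (continuous_lebesgue_measurable (cq k))))
  (measurable_funTS ((measurable_EFinP _ _).2 (continuous_lebesgue_measurable cD))) _ _ _.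
- by apply: aeW => x _; apply/fine_cvgP; split; [exact: nearW|exact: q_cvg].
- by apply: (@integrable_bounded _ _ _ (fun=> B) B) => //= x; rewrite ger0_norm.
- by apply: aeW => x k _; rewrite lee_fin; exact: difference_quotient_bound.
rewrite (integral_support (c := 0) (r := rho)) => [h2|x xr]; last first.
  apply: D0; have := enorm_ge0 v; rewrite /rho subr0 in xr; lra.
apply: (cvg_unique _ h2) => //.
by rewrite /= (_ : (fun k => _) = cst 0%E); [exact: cvg_cst|apply/funext => k; exact: q_int].
Qed.
End Integration.

(** * A cut-off with almost optimal slope *)

Section Ramp.
Variables (R : realType) (d l : R).
Hypotheses (d_gt0 : 0 < d) (l_gt0 : 0 < l).
Implicit Types s t : R.

Lemma continuous_max0 : continuous (fun t => Num.max 0 t).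
Proof.
by move=> t; apply: (@continuous_max R _ (cst 0) id); [exact: cvg_cst|exact: cvg_id].
Qed.

(** Its shifted copies build a cut-off of class C^1. This regularity suffices in
    [ball_section_shell], where the cut field is only integrated and does not serve as a test
    field. *)
Definition pos_sqr t : R := Num.max 0 t ^+ 2.

Lemma is_derive_pos_sqr t : is_derive t (1 : R) pos_sqr (2 * Num.max 0 t).
Proof.
have [t0|t0|<-] := ltgtP 0 t.
- have H := is_deriveX 2 (is_derive_id t (1 : R)).
  apply: (@near_eq_is_derive _ _ _ (fun s : R => s ^+ 2)) => //.
    near=> s; rewrite /pos_sqr max_r// ltW//; near: s; exact: lt_nbhsr.
  by apply: is_derive_eq; rewrite /= ?max_r ?(ltW t0)// expr1 -[X in _ *: X]/(1 : R) [LHS]mulr1 mulr_natl.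
- apply: (@near_eq_is_derive _ _ _ (cst (0 : R))) => //.
    near=> s; rewrite /pos_sqr max_l ?expr0n// ltW//; near: s; exact: lt_nbhsl.
  by rewrite mulr0; exact: is_derive_cst.
- apply/is_derive1_caratheodory; exists (fun t => Num.max 0 t); split.
  + move=> z; rewrite /pos_sqr maxxx expr0n/= !subr0.
    by case: (lerP 0 z); rewrite ?expr0n ?mul0r// expr2.
  + exact: continuous_max0.
  + by rewrite maxxx mulr0.
Unshelve. all: by end_near. Qed.

(* Since [- ramp'] is the convolution of the uniform densities on [0, d] and
   [0, l], the slope is at most 1 / l, which is optimal as d tends to 0. *)
Definition ramp s : R :=
  1 - (pos_sqr s - pos_sqr (s - d) - pos_sqr (s - l) + pos_sqr (s - l - d)) / (2 * d * l).

Definition ramp' s : R := - ((Num.max 0 s - Num.max 0 (s - d) - Num.max 0 (s - l) + Num.max 0 (s - l - d)) / (d * l)).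

Lemma ramp_le0 s : s <= 0 -> ramp s = 1.
Proof.
have := d_gt0; have := l_gt0 => l0 d0 s0; rewrite /ramp /pos_sqr !max_l ?expr0n/= ?subr0 ?addr0 ?mul0r ?subr0//; lra.
Qed.

Lemma ramp_ge s : d + l <= s -> ramp s = 0.
Proof.
have := d_gt0; have := l_gt0 => l0 d0 sl; rewrite /ramp /pos_sqr !max_r; try by lra.
by field; rewrite !gt_eqF.
Qed.

Lemma ramp'_le0 s : s <= 0 -> ramp' s = 0.
Proof.
have := d_gt0; have := l_gt0 => l0 d0 s0; rewrite /ramp' !max_l ?subr0 ?addr0 ?mul0r ?oppr0//; lra.
Qed.

Lemma ramp'_ge s : d + l <= s -> ramp' s = 0.
Proof.
have := d_gt0; have := l_gt0 => l0 d0 sl; rewrite /ramp' !max_r; lra.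
Qed.

Lemma ramp_itv s : 0 <= ramp s <= 1.
Proof.
have := d_gt0; have := l_gt0 => l0 d0.
have dl : 0 < 2 * d * l by rewrite !mulr_gt0.
rewrite /ramp lerBlDr lerDl subr_ge0 ler_pdivrMr// mul1r divr_ge0 ?(ltW dl) ?andbT//; last first.
  rewrite /pos_sqr; case: (lerP 0 s) => h1; case: (lerP 0 (s - d)) => h2;
  case: (lerP 0 (s - l)) => h3; case: (lerP 0 (s - l - d)) => h4; nra.
rewrite /pos_sqr; case: (lerP 0 s) => h1; case: (lerP 0 (s - d)) => h2;
  case: (lerP 0 (s - l)) => h3; case: (lerP 0 (s - l - d)) => h4; nra.
Qed.

Lemma normr_ramp' s : `|ramp' s| <= l^-1.
Proof.
have := d_gt0; have := l_gt0 => l0 d0.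
have dl : 0 < d * l by rewrite !mulr_gt0.
rewrite /ramp' normrN normrM [`|(d * l)^-1|]ger0_norm ?invr_ge0 ?(ltW dl)//.
rewrite ler_pdivrMr// mulrC mulfK ?gt_eqF// ler_norml.
case: (lerP 0 s) => h1; case: (lerP 0 (s - d)) => h2;
  case: (lerP 0 (s - l)) => h3; case: (lerP 0 (s - l - d)) => h4; lra.
Qed.

Lemma is_derive_shift (f : R -> R) (c s df : R) :
  is_derive (s - c) (1 : R) f df -> is_derive s (1 : R) (fun t => f (t - c)) df.
Proof.
move=> H.
have H2 : is_derive s (1 : R) (fun t : R => t - c) 1.
  have := is_deriveD (is_derive_id s (1 : R)) (is_derive_cst (- c) s (1 : R)).
  by move/is_derive_eq; apply; rewrite addr0.
have := @is_derive1_comp _ f (fun t : R => t - c) s df 1 H H2.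
by rewrite mulr1.
Qed.

Lemma is_derive_ramp s : is_derive s (1 : R) ramp (ramp' s).
Proof.
have D c := is_derive_shift (is_derive_pos_sqr (s - c)).
have D0 := is_derive_pos_sqr s.
have D3 := is_derive_shift (is_derive_shift (is_derive_pos_sqr (s - l - d))).
have := is_deriveB (is_derive_cst (1 : R) s (1 : R))
  (is_deriveZ (2 * d * l)^-1 (is_deriveD (is_deriveB (is_deriveB D0 (D d)) (D l)) D3)).
rewrite (_ : _ - _ = ramp); last first.
  by apply/funext => t; rewrite /ramp [in RHS]mulrC.
move/is_derive_eq; apply; rewrite sub0r -[X in - X]/(_ * _) /ramp'.
field; rewrite !gt_eqF//.
Qed.

Lemma continuous_ramp' : continuous ramp'.
Proof.
have C c : continuous (fun s => Num.max 0 (s - c)).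
  move=> s; apply: (@continuous_comp _ _ _ (fun t : R => t - c) (fun t => Num.max 0 t)).
    by apply: (@cvgD _ _ _ _ _ id (cst (- c))); [exact: cvg_id|exact: cvg_cst].
  exact: continuous_max0.
have C' : continuous (fun s => Num.max 0 (s - l - d)).
  rewrite (_ : (fun s => _) = fun s => Num.max 0 (s - (l + d))); first exact: C.
  by apply/funext => s; rewrite opprD addrA.
have C0 := continuous_max0.
move=> s; rewrite /ramp'; apply: cvgN; apply: cvgMl.
by apply: cvgD; [apply: cvgB; [apply: cvgB; [exact: C0|exact: C]|exact: C]|exact: C'].
Qed.

End Ramp.

Section BallSections.
Variables (R : realType) (n : nat).
Local Notation V := 'rV[R]_n.+1.
Local Notation mu := (lebesgue R n).
Implicit Types (x p v w : V) (f : V -> R) (xi : V -> V) (C : set V).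

Lemma Cks_sqdist k p (c : R) : Cks k (fun x => dotp (x - p) (x - p) - c).
Proof.
apply: CksB; last exact: Cks_cst.
rewrite (_ : (fun x => _) = fun x => dotp x x - 2 * dotp p x + dotp p p); last first.
  by apply/funext => x; rewrite dotpBl !dotpBr (dotpC x p); ring.
apply: CksD; last exact: Cks_cst.
apply: CksB; first exact: Cks_dotpp.
by apply: CksZ; apply: Cks_sum => i _; apply: CksZ; exact: Cks_coord_fun.
Qed.

Lemma derive_sqdist p (c : R) x i :
  'D_(delta_mx 0 i) (fun x => dotp (x - p) (x - p) - c) x = 2 * (x - p) 0 i.
Proof.
apply: derive_line.
rewrite (_ : (fun t => _) = fun t : R => t ^+ 2 + (2 * (x - p) 0 i) *: t + (dotp (x - p) (x - p) - c)); last first.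
  apply/funext => t; rewrite -[t *: _ + x - p]addrA; move: (x - p) => w; rewrite dotpDl !dotpDr !dotpZl !dotpZr !dotp_delta dotpC dotp_delta.
  by rewrite !mxE !eqxx -[X in _ = _ + X + _]/(_ * _) /=; ring.
have h1 := is_deriveX 2 (is_derive_id (0 : R) (1 : R)).
have h2 := is_deriveZ (2 * (x - p) 0 i) (is_derive_id (0 : R) (1 : R)).
have := is_deriveD (is_deriveD h1 h2) (is_derive_cst (dotp (x - p) (x - p) - c) (0 : R) (1 : R)).
move/is_derive_eq; apply.
by rewrite addr0 -[X in X + _]/(_ * _) -[X in _ + X = _]/(_ * _) expr1 mulr0 mul0r add0r mulr1.
Qed.

Lemma divergenceZ f xi x : differentiable f x -> Ck 1 xi ->
  divergence (fun y => f y *: xi y) x =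
  f x * divergence xi x + \sum_i 'D_(delta_mx 0 i) f x * xi x 0 i.
Proof.
move=> df [dT _].
have dTi i : differentiable (fun y => xi y 0 i) x.
  by apply: (@differentiable_comp _ _ _ _ xi (fun z : V => z 0 i)) => //; exact: differentiable_coord.
rewrite /divergence mulr_sumr -big_split/=; apply: eq_bigr => i _.
rewrite derive_coord; last first.
  apply: differentiable_coord_row => j.
  rewrite (_ : (fun y => _) = f * (fun y => xi y 0 j)); first exact: differentiableM.
  by apply/funext => y; rewrite mxE.
rewrite (_ : (fun y => _) = f * (fun y => xi y 0 i)); last by apply/funext => y; rewrite mxE.
rewrite deriveM; [|exact: diff_derivable|exact: diff_derivable].
by rewrite -derive_coord// -[X in X + _ = _]/(_ * _) -[X in _ + X = _]/(_ * _) [X in _ + X]mulrC.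
Qed.

Lemma integral_divergence xi r : Ck 1 xi -> (forall x, r < enorm x -> xi x = 0) ->
  (\int[mu]_x (divergence xi x)%:E = 0)%E.
Proof.
move=> C1 xi0; have Ci := Ck_coordP C1.
have i0 i x : r < enorm x -> xi x 0 i = 0 by move=> /xi0 ->; rewrite mxE.
have E x : (divergence xi x)%:E = (\sum_i ('D_(delta_mx 0 i) (fun y => xi y 0 i) x)%:E)%E.
  by rewrite sumEFin; congr EFin; apply: eq_bigr => i _; rewrite derive_coord//; case: C1.
under eq_integral do rewrite E.
rewrite integral_sum//; last first.
  move=> i; apply: (@integrable_support _ _ _ 0 r).
    by have [_] := Ci i; apply.
  move=> x; rewrite subr0 => xr.
  rewrite (@near_eq_derive _ _ _ _ (cst 0)) ?derive_cst//.
  have o : open [set y : V | r < enorm y].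
    apply: (@open_comp _ _ (@enorm R n) [set t | r < t]); last exact: open_gt.
    by move=> y _; exact: continuous_enorm.
  by have := open_nbhs_nbhs (conj o xr); apply: filterS => y /(i0 i).
by rewrite big1// => i _; exact: (integral_derive _ (Ci i) (i0 i)).
Qed.

(** Multiply [xi] by the ramp in |x - p|^2 - r^2, which is 1 on the inner section and 0 beyond the
    outer one. The divergence of the product has total integral 0, so the inner integral is minus
    the integral over the shell, where the ramp has a gradient of norm at most 2 r' / l. *)
Lemma ball_section_shell C p (r l r' d B : R) xi : closed C -> 0 < r -> 0 < d -> 0 < l -> 0 < r' ->
  d + l = r' ^+ 2 - r ^+ 2 -> test_field C xi -> 0 <= B -> (forall x, `|divergence xi x| <= B) ->
  (\int[mu]_(x in C `&` eclosed_ball p r) (divergence xi x)%:E <=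
   (B + 2 * r' / l)%:E * (mu (C `&` eclosed_ball p r') - mu (C `&` eclosed_ball p r)))%E.
Proof.
move=> cC r0 d0 l0 r'0 dl [sxi cxi suppC xi1] B0 HB.
have C1 : Ck 1 xi := sxi 1%N.
set E := C `&` _; set F := C `&` eclosed_ball p r'.
pose s x := dotp (x - p) (x - p) - r ^+ 2.
pose eta x := ramp d l (s x).
have Cs : Cks 1 s by exact: Cks_sqdist.
have deta x : differentiable eta x.
  exact: (differentiable_chain (Cs.1 x) (is_derive_ramp d0 l0 (s x))).
have Deta v x : 'D_v eta x = ramp' d l (s x) * 'D_v s x.
  exact: (derive_chain v (Cs.1 x) (is_derive_ramp d0 l0 (s x))).
have Ceta : Cks 1 eta.
  split=> // v; rewrite (_ : 'D_v eta = fun x => ramp' d l (s x) * 'D_v s x); last exact/funext.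
  apply: (@CksM _ _ 0); last by have [_] := Cs; apply.
  move=> x; apply: (@continuous_comp _ _ _ s (ramp' d l)); last exact: continuous_ramp'.
  exact: (Cks_continuous Cs).
pose g := divergence (fun y => eta y *: xi y).
have gE x : g x = eta x * divergence xi x + ramp' d l (s x) * (2 * dotp (x - p) (xi x)).
  rewrite /g divergenceZ//; congr (_ + _).
  rewrite mulr_sumr mulr_sumr; apply: eq_bigr => i _.
  by rewrite Deta derive_sqdist -!mulrA.
have sE x : s x = enorm (x - p) ^+ 2 - r ^+ 2 by rewrite /s enormE.
have g_out x : ~ F x -> g x = 0.
  move=> nF; have [Cx|nCx] := pselect (C x); last first.
    have nS : ~ closure [set x | xi x != 0] x.
      by move=> /suppC /interior_subset.
    rewrite gE divergence_out_support//.
    have -> : xi x = 0.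
      by apply: contra_notP nS => /eqP h; exact: subset_closure.
    by rewrite dotp0r !mulr0 addr0.
  have xr' : r' < enorm (x - p) by rewrite ltNge; apply/negP => h; apply: nF.
  have su : d + l <= s x by rewrite sE dl lerB// ler_sqr ?nnegrE ?enorm_ge0 ?(ltW r'0)// ltW.
  by rewrite gE /eta ramp_ge// ramp'_ge// !mul0r addr0.
have g_E x : E x -> g x = divergence xi x.
  move=> [_ xr]; have su : s x <= 0.
    by rewrite sE subr_le0 ler_sqr ?nnegrE ?enorm_ge0 ?(ltW r0).
  by rewrite gE /eta ramp_le0// ramp'_le0// mul1r mul0r addr0.
have g_F x : F x -> - (B + 2 * r' / l) <= g x.
  move=> [_ xr']; have /andP[e0 e1] := ramp_itv d0 l0 (s x).
  rewrite gE opprD lerD//.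
    rewrite lerNl -mulrN; apply: le_trans (ler_norm _) _.
    rewrite normrM normrN [`|eta x|]ger0_norm// -[leRHS]mul1r.
    by apply: ler_pM => //; exact: HB.
  rewrite lerNl; apply: le_trans (ler_norm _) _; rewrite normrN normrM normrM mulrC.
  apply: ler_pM => //; last exact: normr_ramp'.
  rewrite ger0_norm// ler_pM2l//; apply: le_trans (normr_dotp_le _ _) _.
  rewrite -[leRHS]mulr1; apply: ler_pM; rewrite ?enorm_ge0//; exact: xi1.
have Cg : Ck 1 (fun y => eta y *: xi y).
  apply: Ck_coord => i; rewrite (_ : (fun x => _) = fun x => eta x * xi x 0 i).
    by apply: CksM => //; exact: Ck_coordP.
  by apply/funext => x; rewrite mxE.
have mE : lebesgue_measurable E.
  by apply: closed_lebesgue_measurable; apply: closedI => //; exact: closed_eclosed_ball.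
have mF : lebesgue_measurable F.
  by apply: closed_lebesgue_measurable; apply: closedI => //; exact: closed_eclosed_ball.
have Ffin : (mu F < +oo)%E.
  apply: le_lt_trans (outer_lebesgue_ball_fin p r').
  by apply: le_outer_lebesgue => x [].
have rr' : r <= r'.
  by rewrite -ler_sqr ?nnegrE ?(ltW r0) ?(ltW r'0)// -subr_ge0 -dl addr_ge0// ltW.
have EF : E `<=` F by move=> x [Cx xr]; split=> //; exact: le_trans rr'.
have Efin : (mu E < +oo)%E by apply: le_lt_trans Ffin; exact: le_outer_lebesgue.
have Ef : mu E \is a fin_num by rewrite ge0_fin_numE.
have Ff : mu F \is a fin_num by rewrite ge0_fin_numE.
have cg : continuous g by exact: continuous_divergence.
have mg := continuous_lebesgue_measurable cg.
have mFE : lebesgue_measurable (F `\` E) by exact: measurableD.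
have muFE : (mu F - mu E = mu (F `\` E))%E.
  by rewrite [RHS]measureD// (setIidr EF).
have int0 : (\int[mu]_(x in F) (g x)%:E = 0)%E.
  have [rho hrho] := bounded_enorm (compact_bounded cxi).
  rewrite -(@integral_divergence _ rho Cg).
    rewrite integral_mkcond; apply: eq_integral => x _.
    rewrite patchE; case: ifPn => // /negP xF; rewrite -/(g x) g_out//.
    by move=> Fx; apply: xF; exact/mem_set.
  move=> x xr; have [->|xi0] := eqVneq (xi x) 0; first by rewrite scaler0.
  by have := hrho x (@subset_closure _ [set x | xi x != 0] x xi0); rewrite leNgt xr.
have FU : F = E `|` (F `\` E) by rewrite setDUK.
pose I1 := (\int[mu]_(x in E) (g x)%:E)%E; pose I2 := (\int[mu]_(x in F `\` E) (g x)%:E)%E.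
have I12 : (I1 + I2 = 0)%E.
  rewrite -int0 [in RHS]FU; apply/esym.
  apply: (@integral_setU _ _ R mu E (F `\` E) (EFin \o g) mE mFE).
    exact/measurable_EFinP/measurable_funTS.
  by apply/disj_setPS => x [Ex []].
have -> : (\int[mu]_(x in E) (divergence xi x)%:E = I1)%E.
  by apply: eq_integral => x /set_mem Ex; rewrite g_E.
have Ig : mu.-integrable setT (EFin \o g).
  apply: (@integrable_support _ _ _ p r') => // x xr'; apply: g_out => -[_].
  by rewrite /eclosed_ball/= leNgt xr'.
have IFE : mu.-integrable (F `\` E) (EFin \o g) by apply: integrableS Ig.
have I2f : I2 \is a fin_num by exact: (integrable_fin_num _ IFE).
have -> : I1 = (- I2)%E by rewrite -[LHS](addeK _ I2f) I12 add0e.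
have : ((- (B + 2 * r' / l))%:E * mu (F `\` E) <= I2)%E.
  rewrite -integral_cst//; apply: le_integral => //.
    apply: (@integrable_bounded _ _ _ (fun=> - (B + 2 * r' / l)) `|- (B + 2 * r' / l)|) => //.
    by rewrite -muFE; apply: le_lt_trans Ffin; rewrite leeBlDr// leeDl// outer_lebesgue_ge0.
  by move=> x /set_mem [Fx _]; rewrite lee_fin; exact: g_F.
by rewrite muFE EFinN mulNe leeNl.
Qed.

(** By convexity the homothety of center [p] and ratio [l^-1] maps the larger section into the
    smaller one. *)
Lemma ball_section_dilate C p (r l : R) : convex_set C -> C p -> 1 <= l -> 0 < r ->
  (mu (C `&` eclosed_ball p (l * r)) <= (l ^+ n.+1)%:E * mu (C `&` eclosed_ball p r))%E.
Proof.
move=> /convexE cC Cp l1 r0; have l0 : 0 < l by lra.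
set E := C `&` eclosed_ball p r.
rewrite -[mu E](outer_lebesgue_translate (- p) E) -outer_lebesgue_dilate//.
rewrite -(outer_lebesgue_translate p); apply: le_outer_lebesgue => x [Cx xr].
have Ex : E (l^-1 *: x + (1 - l^-1) *: p).
  split; first by apply: cC => //; rewrite ?invr_ge0 ?(ltW l0)//; rewrite invf_le1.
  rewrite /eclosed_ball/= (_ : _ - _ = l^-1 *: (x - p)); last first.
    by apply/rowP => i; rewrite !mxE; ring.
  by rewrite enormZ ger0_norm ?invr_ge0 ?(ltW l0)// mulrC ler_pdivrMr// mulrC.
exists (x - p); last by rewrite addrC subrK.
exists (- p + (l^-1 *: x + (1 - l^-1) *: p)).
  by exists (l^-1 *: x + (1 - l^-1) *: p).
apply/rowP => i; rewrite !mxE; field.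
by rewrite gt_eqF.
Qed.

Lemma ball_section_perimeter C p (r : R) : closed C -> convex_set C -> C p -> 0 < r ->
  (relative_perimeter C (C `&` eclosed_ball p r) <=
   (n.+1%:R / r)%:E * mu (C `&` eclosed_ball p r))%E.
Proof.
move=> cC cvC Cp r0; apply: ge_ereal_sup => _ [xi xiT <-].
have [sxi cxi _ _] := xiT.
have [B B0 HB] := divergence_bounded (sxi 1%N) cxi.
set E := C `&` _.
have Efin : mu E \is a fin_num.
  rewrite ge0_fin_numE//; apply: le_lt_trans (outer_lebesgue_ball_fin p r).
  by apply: le_outer_lebesgue => x [].
set v := fine (mu E); have vE : mu E = v%:E by rewrite /v fineK.
have v0 : 0 <= v by rewrite fine_ge0.
rewrite vE -EFinM; apply/lee_addgt0Pr => e e0; rewrite -EFinD.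
(* A bound for the shell of relative width [s]. As [s] tends to 0 the term with [B] disappears, and
   a slope of order 1 / (r s) against a shell volume of order N s v leaves N v / r. *)
pose f (s : R) := v * n.+1%:R * (1 + s) ^+ n * (B * s + (1 + s) ^+ 2 / r).
have f0 : f 0 = n.+1%:R / r * v.
  by rewrite /f addr0 !expr1n mulr0 add0r mulr1 mul1r -mulrA mulrC.
have cf : {for 0, continuous f}.
  have c1 : {for 0, continuous (fun s : R => 1 + s)}.
    by apply: (@continuousD R R R (fun=> 1) (fun s => s)); [exact: cst_continuous|exact: cvg_id].
  have cX k : {for 0, continuous (fun s : R => (1 + s) ^+ k)}.
    apply: (@continuous_comp _ _ _ (fun s : R => 1 + s) (fun t => t ^+ k)) => //.
    exact: exprn_continuous.
  have cc (a : R) : {for 0, continuous (fun _ : R => a)} by exact: cst_continuous.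
  have cid : {for 0, continuous (fun s : R => s)} by exact: cvg_id.
  have h1 : {for 0, continuous (fun s : R => v * n.+1%:R * (1 + s) ^+ n)}.
    exact: (continuousM (cc (v * n.+1%:R)) (cX n)).
  have h2 : {for 0, continuous (fun s : R => B * s)} by exact: (continuousM (cc B) cid).
  have h3 : {for 0, continuous (fun s : R => (1 + s) ^+ 2 / r)} by exact: (continuousM (cX 2%N) (cc r^-1)).
  exact: (continuousM h1 (continuousD h2 h3)).
have [d d0 fd] := continuous_eventually_le cf e0.
pose s := Num.min 1 (d / 2).
have s0 : 0 < s by rewrite lt_min ltr01 divr_gt0.
have s1 : s <= 1 by rewrite ge_min lexx.
have sd : s < d by rewrite gt_min ltr_pdivrMr// mulr2n mulrDr mulr1 ltrDl d0 orbT.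
apply: (@le_trans _ _ (f s)%:E); last first.
  by rewrite lee_fin -f0; apply: fd => //; exact: ltW.
(* Solves [l * s + l = ((1 + s) * r) ^+ 2 - r ^+ 2]: the smoothing width [l * s] of the ramp becomes
   negligible against [l]. *)
pose l := r ^+ 2 * s * (2 + s) / (1 + s).
have s10 : 0 < 1 + s by lra.
have s20 : 0 < 2 + s by lra.
have l0 : 0 < l by rewrite /l divr_gt0// !mulr_gt0// exprn_gt0.
have dl : l * s + l = ((1 + s) * r) ^+ 2 - r ^+ 2.
  by rewrite /l; field; rewrite gt_eqF.
have r'0 : 0 < (1 + s) * r by rewrite mulr_gt0.
apply: le_trans (ball_section_shell p cC r0 (mulr_gt0 l0 s0) l0 r'0 dl xiT B0 HB) _.
have F1 := ball_section_dilate cvC Cp (_ : 1 <= 1 + s) r0.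
have c0 : 0 <= B + 2 * ((1 + s) * r) / l.
  by rewrite addr_ge0// divr_ge0 ?(ltW l0)// mulr_ge0// ltW.
apply: (@le_trans _ _ ((B + 2 * ((1 + s) * r) / l) * (((1 + s) ^+ n.+1 - 1) * v))%:E).
  rewrite EFinM; apply: lee_wpmul2l; first by rewrite lee_fin.
  rewrite mulrBl mul1r EFinB EFinM -vE; apply: leeB => //; apply: F1; lra.
rewrite lee_fin subrX1 addrAC subrr add0r.
have S1 : \sum_(i < n.+1) (1 + s) ^+ i <= n.+1%:R * (1 + s) ^+ n.
  rewrite mulr_natl -[in leRHS](card_ord n.+1) -sumr_const; apply: ler_sum => i _.
  by rewrite ler_eXn2l// ?ltrDl// -ltnS.
set S := \sum_(i < _) _ in S1 *.
have S0 : 0 <= S by apply: sumr_ge0 => i _; rewrite exprn_ge0// ltW.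
have -> : (B + 2 * ((1 + s) * r) / l) * (s * S * v) =
  v * S * (B * s + 2 * (1 + s) ^+ 2 / (r * (2 + s))).
  by rewrite /l; field; rewrite !gt_eqF.
rewrite /f; apply: ler_pM.
- exact: mulr_ge0.
- apply: addr_ge0; first by rewrite mulr_ge0// ltW.
  by rewrite divr_ge0// ?mulr_ge0 ?exprn_ge0// ltW// ltW.
- by rewrite -mulrA ler_wpM2l.
- rewrite lerD2l invfM mulrA [leRHS]mulrC [X in X * _ <= _]mulrC -mulrA ler_wpM2l ?invr_ge0 ?(ltW r0)//.
  rewrite ler_pdivrMr// mulrC ler_wpM2l ?sqr_ge0//; lra.
Qed.

End BallSections.

(** * Convex bodies and asymptotic cylinders *)

Section ConvexGeometry.
Variables (R : realType) (n : nat).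
Local Notation V := 'rV[R]_n.+1.
Local Notation mu := (lebesgue R n).
Implicit Types (x y z c p a : V) (A C K : set V).

Lemma nearest_point K x : closed K -> K !=set0 ->
  exists2 y, K y & forall z, K z -> enorm (x - y) <= enorm (x - z).
Proof.
move=> cK [z0 Kz0].
pose A := K `&` eclosed_ball x (enorm (x - z0)).
have cA : compact A.
  apply: (@subclosed_compact _ _ (eclosed_ball x (enorm (x - z0)))).
  - by apply: closedI => //; exact: closed_eclosed_ball.
  - exact: compact_eclosed_ball.
  - by move=> y [].
have A0 : A !=set0 by exists z0; split=> //; rewrite /eclosed_ball/= enormB.
have [y /set_mem [Ky yx] ymin] := EVT_min_rV A0 cA (continuous_subspaceT (@continuous_enormB R n x)).
exists y => // z Kz; rewrite enormB [leRHS]enormB.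
have [zx|zx] := leP (enorm (z - x)) (enorm (x - z0)); first by apply: ymin; exact/mem_set.
by apply: le_trans yx _; exact: ltW.
Qed.

(** Moving from the nearest point [y] towards a [z] that makes an acute angle with [x - y] would
    reduce the distance to [x]. *)
Lemma separation K x : closed K -> convex_set K -> K !=set0 -> exists y,
  [/\ K y, forall z, K z -> enorm (x - y) <= enorm (x - z) &
      forall z, K z -> dotp (x - y) (z - y) <= 0].
Proof.
move=> cK /convexE cvK K0; have [y Ky ymin] := nearest_point x cK K0.
exists y; split=> // z Kz; rewrite leNgt; apply/negP => pos.
set a := x - y in pos *; set b := z - y in pos *.
have key t : 0 <= t -> t <= 1 -> 2 * t * dotp a b <= t ^+ 2 * dotp b b.
  move=> t0 t1; have := ymin _ (cvK z y t t0 t1 Kz Ky).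
  have -> : x - (t *: z + (1 - t) *: y) = a - t *: b.
    by apply/rowP => i; rewrite !mxE; ring.
  rewrite -/a => h.
  have : enorm a ^+ 2 <= enorm (a - t *: b) ^+ 2 by rewrite ler_sqr ?nnegrE ?enorm_ge0.
  by rewrite !enormE (dotpBl a) !(dotpBr _ a) !dotpZr !dotpZl (dotpC b a); lra.
have b0 : 0 <= dotp b b := dotpp_ge0 b.
(* Small enough for the first-order term [2 * t * dotp a b] to dominate [t ^+ 2 * dotp b b]. *)
pose t := Num.min 1 (dotp a b / (dotp b b + 1)).
have b1 : 0 < dotp b b + 1 by lra.
have t0 : 0 < t by rewrite lt_min ltr01 divr_gt0.
have t1 : t <= 1 by rewrite ge_min lexx.
have tb : t * (dotp b b + 1) <= dotp a b.
  by rewrite -ler_pdivlMr// ge_min lexx orbT.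
have h1 := key t (ltW t0) t1.
have h2 : 2 * dotp a b <= t * dotp b b.
  by rewrite -(ler_pM2l t0); move: h1; rewrite expr2; lra.
lra.
Qed.

Lemma bounded_seq_cluster c (r : R) (u : nat -> V) : (forall k, eclosed_ball c r (u k)) ->
  exists2 w, eclosed_ball c r w &
    forall (e : R) m, 0 < e -> exists2 k, (m <= k)%N & enorm (u k - w) < e.
Proof.
move=> ub.
have [|w [wr wc]] := @compact_eclosed_ball R n c r (u @ \oo) _.
  by exists 0%N => // k _; exact: ub.
exists w => // e m e0.
have [||y [[k /= mk <-]]] := wc [set u k | k in [set k | (m <= k)%N]] (eball w e).
- by exists m => // k mk; exists k.
- by apply/nbhs_eball; exists e.
by move=> h; exists k.
Qed.

Lemma outer_lebesgue_ball_ge c (r : R) : 0 < r ->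
  (((r / n.+1%:R) ^+ n.+1)%:E <= outer_lebesgue (eclosed_ball c r))%E.
Proof.
move=> r0; pose l := r / n.+1%:R; have l0 : 0 < l by rewrite divr_gt0.
rewrite eclosed_ball_translate outer_lebesgue_translate.
apply: (@le_trans _ _ (outer_lebesgue [set l *: x | x in [set x : V | forall i, 0 <= x 0 i <= 1]])).
  rewrite outer_lebesgue_dilate// -[X in (X <= _)%E]mule1; apply: lee_wpmul2l.
    by rewrite lee_fin exprn_ge0// ltW.
  exact: outer_lebesgue_unit_cube.
apply: le_outer_lebesgue => _ [x x01 <-]; rewrite /eclosed_ball/= subr0 enormZ gtr0_norm//.
have h : enorm x <= n.+1%:R * 1.
  apply: enorm_le_coord => i; have /andP[h0 h1] := x01 i; by rewrite ger0_norm.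
by rewrite /l mulrAC ler_pdivrMr// ler_pM2l//; rewrite mulr1 in h.
Qed.

Lemma outer_lebesgue_ball_gt0 c (r : R) : 0 < r -> (0 < outer_lebesgue (eclosed_ball c r))%E.
Proof.
move=> r0; apply: lt_le_trans (outer_lebesgue_ball_ge c r0).
by rewrite lte_fin exprn_gt0// divr_gt0.
Qed.

Lemma closed_translate c A : closed A -> closed (translate c A).
Proof.
move=> cA; rewrite (_ : translate c A = (fun x => - c + x) @^-1` A).
  by apply: closed_comp => // x _; exact: continuous_translate.
apply/seteqP; split=> [_ [x Ax <-]|x Ax]; first by rewrite /preimage/= addKr.
by exists (- c + x); rewrite // addrA subrr add0r.
Qed.

Lemma convex_translate c A : convex_set A -> convex_set (translate c A).
Proof.
move=> /convexE cA; apply/convexE => _ _ t t0 t1 [x Ax <-] [y Ay <-].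
exists (t *: x + (1 - t) *: y); first exact: cA.
by apply/rowP => i; rewrite !mxE; ring.
Qed.

Lemma ball_in_translate c p (r : R) A :
  (outer_lebesgue (translate (- p) A `&` eclosed_ball c r) =
   outer_lebesgue (A `&` eclosed_ball (p + c) r))%E.
Proof.
rewrite -(outer_lebesgue_translate (- p) (A `&` _)); congr outer_lebesgue.
apply/seteqP; split=> [_ [[x Ax <-] xr]|_ [x [Ax xr] <-]].
  exists x => //; split=> //; move: xr; rewrite /eclosed_ball/=.
  by rewrite opprD addrA [x - p]addrC.
split; first by exists x.
by move: xr; rewrite /eclosed_ball/= opprD addrA [x - p]addrC.
Qed.

End ConvexGeometry.

Section HalfBall.
Variables (R : realType) (n : nat).
Local Notation V := 'rV[R]_n.+2.

Lemma outer_lebesgue_half_ball_at (p a : V) (r : R) : a != 0 -> 0 < r ->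
  (outer_lebesgue ([set x | (dotp a x <= dotp a p)%R] `&` eclosed_ball p r)
    <= (half_ball_const R n * r ^+ n.+2)%:E)%E.
Proof.
move=> a0 r0; have a_gt0 : 0 < enorm a by rewrite enorm_gt0.
pose e := (enorm a)^-1 *: a.
have e1 : enorm e = 1 by rewrite enormZ ger0_norm ?invr_ge0 ?enorm_ge0// mulVf// gt_eqF.
have [Q QR eQ] := householder e1.
rewrite -(outer_lebesgue_isometry p QR).
apply: (@le_trans _ _ (outer_lebesgue [set r *: x | x in
    eclosed_ball (0 : V) 1 `&` [set x | x 0 0 <= 0]])); last first.
  have -> : (half_ball_const R n * r ^+ n.+2)%:E = ((r ^+ n.+2)%:E * (half_ball_const R n)%:E)%E.
    by rewrite -EFinM mulrC.
  rewrite outer_lebesgue_dilate// lee_pmul2l ?lte_fin ?exprn_gt0//.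
  exact: outer_lebesgue_half_ball.
apply: le_outer_lebesgue => _ [x [xa xr] <-].
exists (r^-1 *: ((x - p) *m Q)); last by rewrite scalerA divff ?scale1r ?gt_eqF.
split.
  rewrite /eclosed_ball/= subr0 enormZ enorm_reflection// ger0_norm ?invr_ge0 ?(ltW r0)//.
  by rewrite mulrC ler_pdivrMr// mul1r.
rewrite /= mxE pmulr_rle0 ?invr_gt0//.
rewrite -dotp_delta -eQ dotp_reflection// dotpZr pmulr_rle0 ?invr_gt0//.
by rewrite dotpC dotpBr subr_le0.
Qed.

End HalfBall.

(** * Local Hausdorff convergence of convex sets *)

Section LocalHausdorff.
Variables (R : realType) (n : nat).
Local Notation V := 'rV[R]_n.+1.
Implicit Types (x y z c p a : V) (A C K Y : set V).

(* Moving the nearby point [w] towards an interior point [z] of the ball brings it back into the ball. *)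
Lemma shrink_into_ball Y c z w y (r s e : R) : convex_set Y -> Y z -> Y w -> 0 < s -> 0 <= e ->
  enorm (z - c) <= r - s -> enorm (y - c) <= r -> enorm (w - y) <= e ->
  exists2 w', (Y `&` eclosed_ball c r) w' & enorm (w' - y) <= e + e / s * (2 * r + e).
Proof.
move=> /convexE cY Yz Yw s0 e0 zc yc wy.
have es : 0 < e + s by rewrite ltr_wpDl.
pose l := e / (e + s).
have l0 : 0 <= l by rewrite divr_ge0// ltW.
have l1 : l <= 1 by rewrite ler_pdivrMr// mul1r lerDl ltW.
have wc : enorm (w - c) <= r + e by have := enorm_trans y w c; lra.
exists (l *: z + (1 - l) *: w).
  split; first exact: cY.
  rewrite /eclosed_ball/= (_ : _ - c = l *: (z - c) + (1 - l) *: (w - c)); last first.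
    by apply/rowP => i; rewrite !mxE; ring.
  apply: le_trans (enormD _ _) _; rewrite !enormZ !ger0_norm ?subr_ge0//.
  have h1 : l * enorm (z - c) <= l * (r - s) by rewrite ler_wpM2l.
  have h2 : (1 - l) * enorm (w - c) <= (1 - l) * (r + e) by rewrite ler_wpM2l// subr_ge0.
  have h3 : l * (r - s) + (1 - l) * (r + e) = r by rewrite /l; field; rewrite gt_eqF.
  lra.
rewrite (_ : _ - y = (w - y) + l *: (z - w)); last first.
  by apply/rowP => i; rewrite !mxE; ring.
apply: le_trans (enormD _ _) _; rewrite enormZ ger0_norm//; apply: lerD => //.
apply: ler_pM => //; first exact: enorm_ge0.
  by rewrite ler_wpM2l// lef_pV2 ?posrE// lerDr.
by have := enorm_trans c z w; rewrite (enormB c w); lra.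
Qed.

(** For convex sets it suffices to approximate points of bounded norm by points that may leave the
    ball: [shrink_into_ball] pulls these back, using a point of each set well inside the ball. *)
Lemma local_hausdorff_cvgP (A_ : nat -> set V) K : (forall i, convex_set (A_ i)) -> convex_set K ->
  (forall r e : R, 0 < e -> \forall i \near \oo,
     forall y, K y -> enorm y <= r -> exists2 w, A_ i w & enorm (w - y) <= e) ->
  (forall r e : R, 0 < e -> \forall i \near \oo,
     forall y, A_ i y -> enorm y <= r -> exists2 w, K w & enorm (w - y) <= e) ->
  local_hausdorff_cvg A_ K.
Proof.
move=> cA cK KA AK c r [z [Kz zr]].
(* Half of the room around [z] is spent on approximating [z] by points of [A_ i]; the other half
   remains for the shrinking. *)
pose s := (r - enorm (z - c)) / 2.
have s0 : 0 < s by rewrite divr_gt0// subr_gt0.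
have rc : 0 < r by apply: le_lt_trans zr; exact: enorm_ge0.
move=> P hP; have /nbhs_ballP[e /= e0 he] : nbhs (0 : R) (fun t => P t%:E) := hP.
pose b := 1 + (2 * r + 1) / s.
have b0 : 0 < b by rewrite ltr_wpDr// divr_ge0 ?(ltW s0)//; lra.
pose eta := Num.min 1 (e / 2 / b).
have eta0 : 0 < eta by rewrite lt_min ltr01 !divr_gt0.
have eta1 : eta <= 1 by rewrite ge_min lexx.
have etae : eta + eta / s * (2 * r + eta) <= e / 2.
  have h : eta * b <= e / 2 by rewrite -ler_pdivlMr// ge_min lexx orbT.
  apply: le_trans h; rewrite /b [leRHS]mulrDr mulr1 lerD2l -mulrA ler_pM2l//.
  by rewrite mulrC ler_pM2r ?invr_gt0// lerD2l.
have near_c x : eclosed_ball c r x -> enorm x <= enorm c + r.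
  rewrite /eclosed_ball/= => xr; have := enorm_trans c x 0; rewrite !subr0; lra.
apply: filterS (filterI (KA (enorm z) s s0)
  (filterI (KA (enorm c + r) eta eta0) (AK (enorm c + r) eta eta0))) => i [hz [hK hA]].
have [zi Azi ziz] := hz z Kz (lexx _).
have zir : enorm (zi - c) <= r - s.
  by have := enorm_trans z zi c; rewrite /s in ziz *; lra.
have zr' : enorm (z - c) <= r - s by have := zr; rewrite /eball/= /s in s0 *; lra.
pose h := hausdorff_dist (A_ i `&` eclosed_ball c r) (K `&` eclosed_ball c r).
have h0 : (0 <= h)%E.
  by apply: le_ereal_inf_tmp => _ [t [t0 _ _] <-]; rewrite lee_fin.
have he2 : (h <= (e / 2)%:E)%E.
  apply: ereal_inf_lbound; exists (e / 2) => //; split; first by rewrite divr_ge0// ltW.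
    move=> x [Ax xr]; have [w Kw wx] := hA x Ax (near_c x xr).
    have [w' Kw' w'x] := shrink_into_ball cK Kz Kw s0 (ltW eta0) zr' xr wx.
    by exists w' => //; rewrite enormB; exact: le_trans etae.
  move=> x [Kx xr]; have [w Aw wx] := hK x Kx (near_c x xr).
  have [w' Aw' w'x] := shrink_into_ball (cA i) Azi Aw s0 (ltW eta0) zir xr wx.
  by exists w' => //; rewrite enormB; exact: le_trans etae.
change (P h); case: h h0 he2 => [t| |]//; rewrite !lee_fin => t0 te.
apply: he; rewrite /ball/= sub0r normrN ger0_norm//; lra.
Qed.

Lemma local_hausdorff_cvg_cst K : convex_set K -> local_hausdorff_cvg (fun=> K) K.
Proof.
move=> cK; apply: local_hausdorff_cvgP => // r e e0; apply: nearW => i y Ky _;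
  by exists y => //; rewrite subrr enorm0 ltW.
Qed.

End LocalHausdorff.

(** * Blaschke selection *)

Section Blaschke.
Variables (R : realType) (n : nat).
Local Notation V := 'rV[R]_n.+1.
Implicit Types (x y z c p a : V) (A C K Y : set V).

(** Tychonoff's theorem for the product of the intervals [0, M y]. The cluster point is approached
    on finite sets only; Lipschitz bounds make this uniform on balls in [blaschke]. *)
Lemma pointwise_cluster (u : nat -> V -> R) (M : V -> R) : (forall k y, 0 <= u k y <= M y) ->
  exists d : V -> R, forall (s : seq V) (e : R) m, 0 < e ->
    exists2 k, (m <= k)%N & forall y, y \in s -> `|u k y - d y| < e.
Proof.
move=> uM.
have cM := @tychonoff V (fun=> R) (fun y => `[0, M y]%classic) (fun y => @segment_compact R 0 (M y)).
have [|d [_ dc]] := cM (u @ \oo) _.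
  by exists 0%N => // k _ y; rewrite /= in_itv/=; exact: uM.
exists d => s e m e0.
have nd : nbhs d [set g : V -> R | forall y, y \in s -> `|g y - d y| < e].
  elim: s => [|y s IH]; first by apply: filterS filterT => g _ y.
  have yd : \forall g \near d, `|g y - d y| < e.
    have H : nbhs (d y) [set t : R | `|t - d y| < e].
      by apply/nbhs_ballP; exists e => // t; rewrite /ball/= distrC.
    exact: (@proj_continuous V (fun=> R) y d _ H).
  apply: filterS (filterI yd IH) => g [gy gs] x; rewrite inE => /orP[/eqP ->//|]; exact: gs.
have [|g [[k /= mk <-]]] := dc [set u k | k in [set k | (m <= k)%N]] _ _ nd.
  by exists m => // k mk; exists k.
by move=> h; exists k.
Qed.

Lemma finite_net c (r e : R) : 0 < e -> exists s : seq V,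
  forall x, eclosed_ball c r x -> exists2 y, y \in s & enorm (x - y) < e.
Proof.
move=> e0; have := @compact_eclosed_ball R n c r; rewrite compact_cover.
move=> /(_ V setT (fun y => eball y e)) [||D _ hD].
- by move=> y _; exact: open_eball.
- by move=> x _; exists x => //; rewrite /eball/= subrr enorm0.
- exists (finmap.enum_fset D) => x /hD [y /= yD xy]; by exists y.
Qed.

(** The translated bodies are encoded by their distance functions [u k], which are 1-Lipschitz,
    convex and at most [enorm]. A cluster point [d] inherits the Lipschitz bound and convexity, and
    its sublevel set at 0 is the limit. The approximation of points of [K] is part of the conclusion
    because it transfers balls from the limit to the bodies. *)
Lemma blaschke C (x_ : nat -> V) : closed C -> convex_set C -> (forall i, C (x_ i)) ->
  enorm (x_ i) @[i --> \oo] --> +oo ->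
  exists K (phi : nat -> nat), [/\ forall k, (k <= phi k)%N, asymptotic_cylinder C K, K 0 &
    forall r e : R, 0 < e -> \forall i \near \oo, forall y, K y -> enorm y <= r ->
      exists2 w, translate (- x_ (phi i)) C w & enorm (w - y) <= e].
Proof.
move=> cC cvC Cx xoo; have /convexE cvC' := cvC.
have C0 : C !=set0 by exists (x_ 0%N).
have [prj prjP] : {q : V -> V & forall x, C (q x) /\ forall z, C z -> enorm (x - q x) <= enorm (x - z)}.
  apply: (@choice _ _ (fun x y => C y /\ forall z, C z -> enorm (x - y) <= enorm (x - z))) => x.
  by have [y Cy h] := nearest_point x cC C0; exists y.
pose D x := enorm (x - prj x).
have D_le x z : C z -> D x <= enorm (x - z) by exact: (prjP x).2.
have D_lip x y : D x <= D y + enorm (x - y).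
  by have := D_le x _ (prjP y).1; have := enorm_trans y x (prj y); rewrite /D; lra.
have D_cvx x y t : 0 <= t -> t <= 1 -> D (t *: x + (1 - t) *: y) <= t * D x + (1 - t) * D y.
  move=> t0 t1; apply: le_trans (D_le _ _ (cvC' _ _ t t0 t1 (prjP x).1 (prjP y).1)) _.
  rewrite (_ : _ - _ = t *: (x - prj x) + (1 - t) *: (y - prj y)); last first.
    by apply/rowP => i; rewrite !mxE; ring.
  by apply: le_trans (enormD _ _) _; rewrite !enormZ !ger0_norm// subr_ge0.
pose u k y := D (x_ k + y).
have u_lip k x y : u k x <= u k y + enorm (x - y).
  by apply: le_trans (D_lip _ (x_ k + y)) _; rewrite opprD addrACA subrr add0r.
have u_C k y : translate (- x_ k) C y -> u k y = 0.
  move=> [x Cxx <-]; apply/eqP; rewrite eq_le enorm_ge0 andbT.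
  by apply: le_trans (D_le _ _ Cxx) _; rewrite addrA subrr add0r subrr enorm0.
have u_near k y : exists2 w, translate (- x_ k) C w & enorm (w - y) = u k y.
  exists (- x_ k + prj (x_ k + y)); first by exists (prj (x_ k + y)) => //; exact: (prjP _).1.
  by rewrite /u /D [RHS]enormB; congr enorm; apply/rowP => i; rewrite !mxE; ring.
have uM k y : 0 <= u k y <= enorm y.
  by rewrite enorm_ge0; have := D_le (x_ k + y) _ (Cx k); rewrite addrAC subrr add0r.
have [d dP] := pointwise_cluster uM.
have d_le0 y : (forall k, u k y = 0) -> d y <= 0.
  move=> u0; apply/ler_addgt0Pr => e e0; rewrite add0r.
  have [k _ /(_ y)] := dP [:: y] e 0%N e0.
  by rewrite inE eqxx u0 sub0r normrN => /(_ isT) /ltW; apply: le_trans; exact: ler_norm.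
have d_lip x y : d x <= d y + enorm (x - y).
  apply/ler_addgt0Pr => e e0; have e2 : 0 < e / 2 by rewrite divr_gt0.
  have [k _ h] := dP [:: x; y] (e / 2) 0%N e2.
  have := h x; have := h y; rewrite !inE !eqxx orbT => /(_ isT) hy /(_ isT) hx.
  move: hx hy; rewrite !ltr_norml => /andP[h1 h2] /andP[h3 h4].
  by have := u_lip k x y; lra.
have d_cvx x y t : 0 <= t -> t <= 1 -> d (t *: x + (1 - t) *: y) <= t * d x + (1 - t) * d y.
  move=> t0 t1; apply/ler_addgt0Pr => e e0; have e2 : 0 < e / 2 by rewrite divr_gt0.
  have [k _ h] := dP [:: x; y; t *: x + (1 - t) *: y] (e / 2) 0%N e2.
  have := h x; have := h y; have := h (t *: x + (1 - t) *: y).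
  rewrite !inE !eqxx !orbT => /(_ isT) hz /(_ isT) hy /(_ isT) hx.
  move: hx hy hz; rewrite !ltr_norml => /andP[h1 h2] /andP[h3 h4] /andP[h5 h6].
  have : u k (t *: x + (1 - t) *: y) <= t * u k x + (1 - t) * u k y.
    apply: le_trans (D_cvx _ _ t t0 t1); rewrite le_eqVlt; apply/orP; left; apply/eqP.
    by congr D; apply/rowP => i; rewrite !mxE; ring.
  have : t * u k x <= t * (d x + e / 2) by rewrite ler_wpM2l//; lra.
  have : (1 - t) * u k y <= (1 - t) * (d y + e / 2) by rewrite ler_wpM2l ?subr_ge0//; lra.
  by rewrite !mulrDr; lra.
(* On the ball of radius [k] a finite net of mesh 1 / (k + 1) suffices; the factor 3 counts the
   error on the net and one Lipschitz error for each of [u] and [d]. *)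
have [phi phiP] : {phi : nat -> nat & forall k, (k <= phi k)%N /\
    forall y, enorm y <= k%:R -> `|u (phi k) y - d y| <= 3 * k.+1%:R^-1}.
  apply: (@choice _ _ (fun k l => (k <= l)%N /\
    forall y, enorm y <= k%:R -> `|u l y - d y| <= 3 * k.+1%:R^-1)) => k.
  have e0 : 0 < k.+1%:R^-1 :> R by rewrite invr_gt0.
  set q : R := k.+1%:R^-1 in e0 *.
  have [s hs] := finite_net 0 k%:R e0.
  have [l kl hl] := dP s _ k e0; exists l; split=> // y yk.
  have [z zs yz] : exists2 z, z \in s & enorm (y - z) < q.
    by apply: hs; rewrite /eclosed_ball/= subr0.
  have := hl z zs; rewrite ltr_norml ler_norml => /andP[h1 h2].
  have := u_lip l y z; have := u_lip l z y; have := d_lip y z; have := d_lip z y.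
  by rewrite (enormB z y) => h3 h4 h5 h6; apply/andP; split; lra.
have unif (r e : R) : 0 < e -> \forall i \near \oo,
    forall y, enorm y <= r -> `|u (phi i) y - d y| <= e.
  move=> e0; have e3 : 0 < e / 3 by rewrite divr_gt0.
  apply: filterS (filterI (nbhs_infty_ger r) (near_infty_natSinv_lt (PosNum e3))) => i [ri ie] y yr.
  apply: le_trans ((phiP i).2 y (le_trans yr ri)) _.
  by rewrite mulrC -ler_pdivlMr//; exact: ltW.
(* So [d] bounds the distance to [K] from above: a cluster point of the nearest points [w_ k] in the
   translates lies in [K], at distance at most [d y] from [y]. *)
have K_near y : exists2 w, d w <= 0 & enorm (w - y) <= d y.
  pose nr k w := translate (- x_ (phi k)) C w /\ enorm (w - y) = u (phi k) y.
  have [w_ wP] : {w_ : nat -> V & forall k, nr k (w_ k)}.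
    by apply: (@choice _ _ nr) => k; have [w Aw wy] := u_near (phi k) y; exists w.
  have wb k : eclosed_ball y (enorm y) (w_ k).
    by rewrite /eclosed_ball/= (wP k).2; have /andP[] := uM (phi k) y.
  have [w wb' wc] := bounded_seq_cluster wb.
  have w2 k : enorm (w_ k) <= 2 * enorm y.
    have := enorm_trans y (w_ k) 0; rewrite !subr0; have := wb k; rewrite /eclosed_ball/=; lra.
  exists w; apply/ler_addgt0Pr => e e0; have e2 : 0 < e / 2 by rewrite divr_gt0.
    have [N _ hN] := unif (2 * enorm y) _ e2.
    have [k Nk kw] := wc _ N e2.
    have := hN k Nk (w_ k) (w2 k); rewrite (u_C _ _ (wP k).1) sub0r normrN.
    by move/(le_trans (ler_norm _)); have := d_lip w (w_ k); rewrite (enormB w); lra.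
  have [N _ hN] := unif (2 * enorm y) _ e2.
  have [k Nk kw] := wc _ N e2.
  have y2 : enorm y <= 2 * enorm y by have := enorm_ge0 y; lra.
  have := hN k Nk y y2; rewrite ler_norml => /andP[_ h].
  by have := enorm_trans (w_ k) w y; rewrite (wP k).2 (enormB w (w_ k)); lra.
pose K := [set y | d y <= 0].
have cvK : convex_set K.
  apply/convexE => x y t t0 t1; rewrite /K/= => dx dy.
  apply: le_trans (d_cvx x y t t0 t1) _.
  have : t * d x <= 0 by rewrite mulr_ge0_le0.
  have : (1 - t) * d y <= 0 by rewrite mulr_ge0_le0 ?subr_ge0.
  lra.
have cd : continuous d.
  move=> x; have FF := @nbhs_filter _ x.
  apply/cvgrPdist_lt => e e0; apply/nbhs_eball; exists e => // y yx.
  rewrite /eball/= in yx.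
  have := d_lip x y; have := d_lip y x; rewrite (enormB x y) ltr_norml => h1 h2.
  by apply/andP; split; lra.
have cK : closed K.
  rewrite (_ : K = d @^-1` [set t | t <= 0])//.
  by apply: closed_comp => [x _|]; [exact: cd|exact: closed_le].
have K0 : K 0.
  by apply: d_le0 => k; apply/eqP; rewrite eq_le; have := uM k 0; rewrite enorm0 andbC.
have KA (r e : R) : 0 < e -> \forall i \near \oo, forall y, K y -> enorm y <= r ->
    exists2 w, translate (- x_ (phi i)) C w & enorm (w - y) <= e.
  move=> e0; apply: filterS (unif r e e0) => i h y Ky yr.
  have [w Aw wy] := u_near (phi i) y; exists w => //; rewrite wy.
  by have := h y yr; rewrite ler_norml => /andP[_]; rewrite /K/= in Ky; lra.
exists K, phi; split=> //; first by move=> k; exact: (phiP k).1.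
split=> //; first by exists 0.
exists (x_ \o phi); split=> [i||]; first exact: Cx.
  have phioo : phi @ \oo --> \oo.
    move=> P [N _ h]; exists N => // k Nk; apply: h; exact: leq_trans (phiP k).1.
  exact: (cvg_comp _ _ phioo xoo).
apply: local_hausdorff_cvgP => // [i|r e e0]; first exact: convex_translate.
apply: filterS (unif r e e0) => i h y Ay yr.
have [w Kw wy] := K_near y; exists w => //; apply: le_trans wy _.
have := h y yr; rewrite (u_C _ _ Ay) sub0r normrN; exact: le_trans (ler_norm _).
Qed.

End Blaschke.

(** * Lower and upper control of the volumes of ball sections *)

Section UniformGeometry.
Variables (R : realType) (n : nat).
Local Notation V := 'rV[R]_n.+1.
Local Notation mu := (lebesgue R n).
Implicit Types (x y z c p a q : V) (A C K Y : set V).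

(** The ball inside [C], contracted towards [x] with ratio [t], stays in [C], and in the unit ball
    around [x] since [t^-1] bounds the distances from [x] to its points. Hence sections of vanishing
    volume have centers going to infinity. *)
Lemma ball_section_lower C q (s M : R) : convex_set C -> 0 < s -> eclosed_ball q s `<=` C ->
  exists2 c : R, 0 < c &
    forall x, C x -> enorm x <= M -> (c%:E <= mu (C `&` eclosed_ball x 1))%E.
Proof.
move=> /convexE cC s0 qC; pose b := `|M| + enorm q + s + 1.
have b0 : 0 < b by have := enorm_ge0 q; have := normr_ge0 M; rewrite /b; lra.
have b1 : 1 <= b by have := enorm_ge0 q; have := normr_ge0 M; rewrite /b; lra.
have [t [t0 t1 tE]] : exists t : R, [/\ 0 < t, t <= 1 & t^-1 = b].
  by exists b^-1; rewrite invr_gt0 b0 invf_le1// b1 invrK.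
exists ((t * s / n.+1%:R) ^+ n.+1); first by rewrite exprn_gt0// divr_gt0// mulr_gt0.
move=> x Cx xM; apply: le_trans (outer_lebesgue_ball_ge (x + t *: (q - x)) (mulr_gt0 t0 s0)) _.
apply: le_outer_lebesgue => y; rewrite /eclosed_ball/= => yr.
pose w := q + t^-1 *: (y - (x + t *: (q - x))).
have wq : enorm (w - q) <= s.
  rewrite /w addrAC subrr add0r enormZ ger0_norm ?invr_ge0 ?(ltW t0)//.
  by rewrite mulrC ler_pdivrMr// mulrC.
have yE : y = t *: w + (1 - t) *: x.
  by apply/rowP => i; rewrite !mxE; field; rewrite gt_eqF.
split; first by rewrite yE; apply: cC (ltW t0) t1 (qC _ wq) Cx.
rewrite /= (_ : y - x = t *: (w - x)); last by rewrite yE; apply/rowP => i; rewrite !mxE; ring.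
rewrite enormZ gtr0_norm// mulrC -ler_pdivlMr// mul1r tE.
have := enorm_trans q w x; have := enormD q (- x); rewrite enormN /b.
by have := ler_norm M; lra.
Qed.

Lemma convex_body_ball C : convex_body C ->
  exists q (s : R), [/\ 0 < s, C q & eclosed_ball q s `<=` C].
Proof.
move=> [_ _ [q qC]]; have /nbhs_eball[e e0 he] := qC.
exists q, (e / 2); split; first by rewrite divr_gt0.
  by apply: he; rewrite /eball/= subrr enorm0.
by move=> y; rewrite /eclosed_ball/= => yq; apply: he; rewrite /eball/=; lra.
Qed.

(* A point q of the smaller ball outside Y could be moved by r / 2 away from Y, and would still lie in K, hence close to Y. *)
Lemma ball_in_limit K Y y (r : R) : 0 < r -> eclosed_ball y r `<=` K ->
  closed Y -> convex_set Y -> Y !=set0 ->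
  (forall z, K z -> enorm z <= enorm y + r -> exists2 w, Y w & enorm (w - z) <= r / 4) ->
  eclosed_ball y (r / 2) `<=` Y.
Proof.
move=> r0 yK cY cvY Y0 KY q; rewrite /eclosed_ball/= => qy.
have [p [Yp _ pP]] := separation q cY cvY Y0.
apply: contrapT => nYq.
pose b := q - p; have b0 : b != 0.
  by rewrite subr_eq0; apply/eqP => qp; apply: nYq; rewrite qp.
have eb0 : 0 < enorm b by rewrite enorm_gt0.
pose z := q + (r / 2 / enorm b) *: b.
have zq : enorm (z - q) = r / 2.
  rewrite /z addrAC subrr add0r enormZ ger0_norm; first by rewrite divfK// gt_eqF.
  by rewrite !divr_ge0// ltW.
have zy : enorm (z - y) <= r by have := enorm_trans q z y; lra.
have [|w Yw wz] := KY z (yK z zy).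
  by have := enorm_trans y z 0; rewrite !subr0; lra.
have := pP w Yw.
rewrite (_ : w - p = (w - z) + ((r / 2 / enorm b) *: b + b)); last first.
  by apply/rowP => i; rewrite !mxE; ring.
rewrite -/b (dotpDr b (w - z)) (dotpDr b _ b) dotpZr.
have h1 : - (enorm b * (r / 4)) <= dotp b (w - z).
  have := normr_dotp_le b (w - z); rewrite ler_norml => /andP[h _].
  by apply: le_trans h; rewrite lerN2 ler_pM2l.
have h2 : r / 2 / enorm b * dotp b b = r / 2 * enorm b.
  by rewrite -enormE expr2 mulrA divfK// gt_eqF.
have h3 : 0 < dotp b b by rewrite dotpp_gt0.
have h4 : 0 < enorm b * r by rewrite mulr_gt0.
lra.
Qed.

Lemma half_space_or_setT_ball K : half_space K \/ K = setT -> K 0 ->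
  exists2 y, enorm y <= 1 / 2 & eclosed_ball y (1 / 2) `<=` K.
Proof.
move=> [[a [b [a0 ->]]]|->] K0; last by exists 0 => //; rewrite enorm0.
have ea : 0 < enorm a by rewrite enorm_gt0.
pose y := - ((1 / 2 / enorm a) *: a); exists y.
  rewrite enormN enormZ ger0_norm; first by rewrite divfK// gt_eqF.
  by rewrite !divr_ge0// ltW.
move=> x; rewrite /eclosed_ball/= => xy.
have b0 : 0 <= b by move: K0; rewrite /= dotp0r.
rewrite /= -[x](subrK y) (dotpDr a (x - y)) [in dotp a y]/y dotpNr dotpZr -enormE.
have h1 : dotp a (x - y) <= enorm a * (1 / 2).
  by apply: le_trans (dotp_le _ _) _; rewrite ler_pM2l.
have h2 : 1 / 2 / enorm a * enorm a ^+ 2 = 1 / 2 * enorm a.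
  by rewrite expr2 mulrA divfK// gt_eqF.
lra.
Qed.

Lemma cylinders_uniform_geometry C : convex_body C -> ~ bounded_set C ->
  (forall K, asymptotic_cylinder C K -> half_space K \/ K = setT) -> uniform_geometry C.
Proof.
move=> CB nbC cyl; split=> //; exists 1 => //.
have [cC cvC _] := CB.
rewrite ltNge; apply/negP => inf0.
have pick k : exists x, C x /\ (mu (C `&` eclosed_ball x 1) < (k.+1%:R^-1)%:E)%E.
  have : (ereal_inf [set mu (C `&` eclosed_ball x 1) | x in C] < (k.+1%:R^-1)%:E)%E.
    by apply: le_lt_trans inf0 _; rewrite lte_fin invr_gt0.
  by move=> /ereal_inf_lt[_ [x Cx <-] xk]; exists x.
have [x_ xP] := choice pick.
have Cx k := (xP k).1.
have [q [s [s0 _ qC]]] := convex_body_ball CB.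
have xoo : enorm (x_ k) @[k --> \oo] --> +oo.
  apply/cvgryPgt => M.
  have [c c0 hc] := ball_section_lower M cvC s0 qC.
  apply: filterS (near_infty_natSinv_lt (PosNum c0)) => k kc.
  rewrite ltNge; apply/negP => xM; have := hc _ (Cx k) xM.
  by rewrite leNgt (lt_trans (xP k).2)// lte_fin.
have [K [phi [phik Kcyl K0 KC]]] := blaschke cC cvC Cx xoo.
have [y y12 yK] := half_space_or_setT_ball (cyl K Kcyl) K0.
have r0 : 0 < 1 / 2 :> R by lra.
have e0 : 0 < 1 / 2 / 4 :> R by lra.
pose c : R := ((1 / 2 / 2) / n.+1%:R) ^+ n.+1.
have c0 : 0 < c by rewrite exprn_gt0// !divr_gt0.
(* The index makes 1 / (k + 1) smaller than [c]; since [phi k] is at least [k], the section around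
   [x_ (phi k)] is then too small. *)
have [k [kK kc]] := filter_ex (filterI (KC (enorm y + 1 / 2) _ e0)
  (near_infty_natSinv_lt (PosNum c0))).
have A0 : translate (- x_ (phi k)) C !=set0 by exists (- x_ (phi k) + x_ (phi k)), (x_ (phi k)).
have yA := ball_in_limit r0 yK (@closed_translate _ _ _ _ cC) (@convex_translate _ _ _ _ cvC) A0 kK.
have : (c%:E <= mu (C `&` eclosed_ball (x_ (phi k)) 1))%E.
  apply: (@le_trans _ _ (outer_lebesgue (eclosed_ball y (1 / 2 / 2)))).
    by apply: outer_lebesgue_ball_ge; lra.
  rewrite [leRHS](_ : _ = outer_lebesgue (translate (- x_ (phi k)) C `&` eclosed_ball 0 1)); last first.
    by rewrite ball_in_translate addr0.
  apply: le_outer_lebesgue => z zy; split; first exact: yA.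
  rewrite /eclosed_ball/= in zy *.
  by have := enorm_trans y z 0; rewrite !subr0; lra.
rewrite leNgt (lt_trans (xP _).2)// lte_fin; apply: le_lt_trans kc.
by rewrite lef_pV2 ?posrE// ler_nat ltnS.
Qed.

(** Since [C] is unbounded it has points farther than [r + r0] from [p]; the ball of radius [r0]
    around one of them is disjoint from the section already found and adds at least [c]. *)
Lemma ball_section_unbounded C p (B : R) : uniform_geometry C -> closed C ->
  exists2 r : R, 0 < r & (B%:E < mu (C `&` eclosed_ball p r))%E.
Proof.
move=> [nbC [r0 r00 inf0]] cC.
have [c c0 hc] : exists2 c : R, 0 < c & forall x, C x -> (c%:E <= mu (C `&` eclosed_ball x r0))%E.
  set I := ereal_inf _ in inf0.
  have Ix x : C x -> (I <= mu (C `&` eclosed_ball x r0))%E.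
    by move=> Cx; apply: ereal_inf_lbound; exists x.
  case: I inf0 Ix => [c| |]// c0 Ix; first by exists c.
  by exists 1 => // x /Ix; apply: le_trans; rewrite leey.
have mB x r : lebesgue_measurable (C `&` eclosed_ball x r).
  by apply: closed_lebesgue_measurable; apply: closedI => //; exact: closed_eclosed_ball.
have many (m : nat) : exists2 r : R, 0 < r & ((m%:R * c)%:E <= mu (C `&` eclosed_ball p r))%E.
  elim: m => [|m [r rpos hr]]; first by exists 1 => //; rewrite mul0r.
  have [x Cx xr] : exists2 x, C x & r + r0 < enorm (x - p).
    apply: contra_notP nbC => h; apply: (@enorm_bounded _ _ _ (r + r0 + enorm p)) => x Cx.
    have : enorm (x - p) <= r + r0 by rewrite leNgt; apply/negP => xr; apply: h; exists x.
    by have := enorm_trans p x 0; rewrite !subr0; lra.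
  exists (enorm (x - p) + r0); first by have := enorm_ge0 (x - p); lra.
  apply: (@le_trans _ _ (mu ((C `&` eclosed_ball p r) `|` (C `&` eclosed_ball x r0)))); last first.
    apply: le_outer_lebesgue => y [[Cy yr]|[Cy yr]]; split=> //; rewrite /eclosed_ball/= in yr *.
      lra.
    by have := enorm_trans x y p; lra.
  rewrite measureU; [|exact: mB|exact: mB|].
    by rewrite -natr1 mulrDl mul1r EFinD; apply: leeD => //; exact: hc.
  apply/seteqP; split=> // y [[_ yr] [_ yx]]; rewrite /eclosed_ball/= in yr yx.
  by have := enorm_trans y x p; rewrite (enormB x y); lra.
pose m := Num.trunc (`|B| / c).
have [r rpos hr] := many m.+1; exists r => //; apply: lt_le_trans hr; rewrite lte_fin.
apply: le_lt_trans (ler_norm B) _; rewrite -ltr_pdivrMr//.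
exact: truncnS_gt.
Qed.

End UniformGeometry.

Lemma exists_scaling (R : realType) (k : nat) (w z : R) : 0 < w -> w < z ->
  exists2 l : R, 1 < l & l ^+ k * w <= z.
Proof.
move=> w0 wz; have cf : {for 0, continuous (fun s : R => (1 + s) ^+ k)}.
  apply: (@continuous_comp _ _ _ (fun s : R => 1 + s) (fun t => t ^+ k)).
    by apply: (@continuousD R R R (fun=> 1) (fun s => s)); [exact: cst_continuous|exact: cvg_id].
  exact: exprn_continuous.
have e0 : 0 < z / w - 1 by rewrite subr_gt0 ltr_pdivlMr// mul1r.
have [d d0 hd] := continuous_eventually_le cf e0.
exists (1 + d / 2); first by rewrite ltrDl divr_gt0.
rewrite -ler_pdivlMr//; apply: le_trans (hd (d / 2) _ _) _; [lra|lra|].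
by rewrite addr0 expr1n; lra.
Qed.

(** * Choice of the center and of the radius *)

Section PointAndRadius.
Variables (R : realType).

Section Lines.
Variable n : nat.
Local Notation V := 'rV[R]_n.+1.
Implicit Types (x y z c p a u : V) (A C K Y : set V).

Lemma continuous_line p u : continuous (fun t : R => p + t *: u).
Proof.
move=> t; apply: (@continuous_comp _ _ _ (fun t : R => t *: u) (fun x => p + x)).
  exact: scalel_continuous.
exact: continuous_translate.
Qed.

Lemma last_point C p u : closed C -> C p -> ~ C (p + u) ->
  exists t : R, [/\ 0 <= t, t < 1, C (p + t *: u) &
    forall s, t < s -> s <= 1 -> ~ C (p + s *: u)].
Proof.
move=> cC Cp nCu.
pose T := `[0, 1]%classic `&` ((fun t : R => p + t *: u) @^-1` C).
have cT : compact T.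
  apply: (subclosed_compact _ (@segment_compact R 0 1)); last by move=> t [].
  apply: closedI; first exact: interval_closed.
  by apply: closed_comp => // t _; exact: continuous_line.
have T0 : T !=set0 by exists 0; split; rewrite /= ?in_itv/= ?lexx ?ler01// scale0r addr0.
have cid : continuous (fun s : R => s) by move=> s; exact: cvg_id.
have [t /set_mem [t01 Ct] tmax] := compact_EVT_max T0 cT (continuous_subspaceT cid).
rewrite /= in_itv/= in t01; have /andP[t0 t1] := t01.
exists t; split=> //.
  rewrite lt_neqAle t1 andbT; apply/eqP => tE; apply: nCu.
  by move: Ct; rewrite /preimage/= tE scale1r.
move=> s ts s1 Cs; have : s <= t.
  by apply: tmax; apply/mem_set; split => //=; rewrite in_itv/= s1 andbT; apply: le_trans (ltW ts).
by rewrite leNgt ts.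
Qed.

(** Convex combinations of [x] with remote points of the line approach [x + t *: u], and [C] is
    closed. *)
Lemma line_translation_invariant C p u : closed C -> convex_set C ->
  (forall t : R, C (p + t *: u)) -> forall x (t : R), C x -> C (x + t *: u).
Proof.
move=> cC /convexE cvC Cl x t Cx; apply: contrapT => nC.
have /nbhs_eball[e e0 he] : nbhs (x + t *: u) (~` C).
  by apply: open_nbhs_nbhs; split=> //; exact: closed_openC.
(* With weight [s / 2] on a point of the line, the combination misses [x + t *: u] by
   [s / 2 *: (p - x)], of norm below [e]. *)
pose s := e / (e + enorm (p - x)).
have d0 : 0 < e + enorm (p - x) by rewrite ltr_wpDr// enorm_ge0.
have s0 : 0 < s by rewrite divr_gt0.
have s1 : s <= 1 by rewrite ler_pdivrMr// mul1r lerDl enorm_ge0.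
apply: (he (s / 2 *: (p + (t / (s / 2)) *: u) + (1 - s / 2) *: x)); last first.
  by apply: cvC => //; [rewrite divr_ge0// ltW|lra].
rewrite /eball/= (_ : _ - _ = (s / 2) *: (p - x)); last first.
  by apply/rowP => i; rewrite !mxE; field; rewrite gt_eqF.
rewrite enormZ ger0_norm; last by rewrite divr_ge0// ltW.
have : s * enorm (p - x) <= e.
  rewrite /s mulrAC ler_pdivrMr// ler_pM2l// lerDr; exact: ltW.
have := enorm_ge0 (p - x); lra.
Qed.

(** Invariance along the line makes all translates by its points equal, so the sequence of bodies is
    constant. *)
Lemma line_asymptotic_cylinder C p u : closed C -> convex_set C -> u != 0 ->
  (forall t : R, C (p + t *: u)) -> asymptotic_cylinder C (translate (- p) C).
Proof.
move=> cC cvC u0 Cl; have Cp : C p by have := Cl 0; rewrite scale0r addr0.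
have inv := line_translation_invariant cC cvC Cl.
split; [exact: closed_translate|exact: convex_translate|by exists (- p + p); exists p|].
exists (fun i => p + i%:R *: u); split=> //.
  have eu : 0 < enorm u by rewrite enorm_gt0.
  apply/cvgryPgt => M.
  apply: filterS (nbhs_infty_gtr ((M + enorm p) / enorm u)) => i.
  rewrite ltr_pdivrMr// => h.
  have := enormD (p + i%:R *: u) (- p); rewrite enormN addrAC subrr add0r enormZ ger0_norm//.
  lra.
rewrite (_ : (fun i => _) = fun=> translate (- p) C).
  by apply: local_hausdorff_cvg_cst; exact: convex_translate.
apply/funext => i; apply/seteqP; split=> [_ [x Cx <-]|_ [x Cx <-]].
  exists (x + (- i%:R) *: u); first exact: inv.
  by apply/rowP => j; rewrite !mxE; ring.
exists (x + i%:R *: u); first exact: inv.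
by apply/rowP => j; rewrite !mxE; ring.
Qed.

Lemma half_space_translate p C : half_space (translate (- p) C) -> half_space C.
Proof.
move=> [a [b [a0 E]]]; exists a, (b + dotp a p); split=> //; apply/seteqP; split=> x.
  move=> Cx; have : translate (- p) C (- p + x) by exists x.
  by rewrite E /= dotpDr dotpNr; lra.
move=> h; have : translate (- p) C (- p + x) by rewrite E /= dotpDr dotpNr; rewrite /= in h; lra.
by move=> [y Cy /addrI <-].
Qed.

Lemma translate_setT p C : translate (- p) C = setT -> C = setT.
Proof.
move=> E; apply/seteqP; split=> // x _; have : translate (- p) C (- p + x) by rewrite E.
by move=> [y Cy /addrI <-].
Qed.

(** The supremum of the radii of volume at most [v], finite by [ball_section_unbounded], is the
    radius. The volume cannot jump there, since a dilation by [l] multiplies it by at most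
    [l ^+ n.+1]. *)
Lemma exists_radius C p (v : R) : closed C -> convex_set C -> C p -> 0 < v -> uniform_geometry C ->
  exists2 r : R, 0 < r & lebesgue R n (C `&` eclosed_ball p r) = v%:E.
Proof.
move=> cC cvC Cp v0 UG; pose mu := lebesgue R n.
have fin r : mu (C `&` eclosed_ball p r) \is a fin_num.
  rewrite ge0_fin_numE//; apply: le_lt_trans (outer_lebesgue_ball_fin p r).
  by apply: le_outer_lebesgue => x [].
pose W r := fine (mu (C `&` eclosed_ball p r)).
have WE r : mu (C `&` eclosed_ball p r) = (W r)%:E by rewrite /W fineK.
have W0 r : 0 <= W r by rewrite fine_ge0.
have W_mono r s : r <= s -> W r <= W s.
  move=> rs; rewrite -lee_fin -!WE; apply: le_outer_lebesgue => x [Cx xr]; split=> //.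
  exact: le_trans xr rs.
have W_dil r l : 1 <= l -> 0 < r -> W (l * r) <= l ^+ n.+1 * W r.
  by move=> l1 r0; rewrite -lee_fin EFinM -!WE; exact: ball_section_dilate.
have W_ball r : 0 < r -> W r <= r ^+ n.+1 * ball_const R n.
  move=> r0; rewrite -lee_fin -WE; apply: le_trans (outer_lebesgue_ball_le p r0).
  by apply: le_outer_lebesgue => x [].
pose S := [set r | 0 < r /\ W r <= v].
have S0 : S !=set0.
  pose b := `|ball_const R n| + 1; have b0 : 0 < b by rewrite ltr_wpDl.
  pose r := Num.min 1 (v / b).
  have r0 : 0 < r by rewrite lt_min ltr01 divr_gt0.
  exists r; split=> //; apply: le_trans (W_ball r r0) _.
  apply: (@le_trans _ _ (r * b)); last by rewrite -ler_pdivlMr// ge_min lexx orbT.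
  apply: (@le_trans _ _ (r ^+ n.+1 * b)).
    by rewrite ler_pM2l ?exprn_gt0// /b; have := ler_norm (ball_const R n); lra.
  rewrite ler_pM2r// exprS ler_piMr ?(ltW r0)//; apply: exprn_ile1; first exact: ltW.
  by rewrite ge_min lexx.
have Sub : has_sup S.
  split=> //; have [r r0] := ball_section_unbounded p v UG cC.
  rewrite -/mu WE lte_fin => vr; exists r => s [s0 sv].
  by rewrite leNgt; apply/negP => /ltW /W_mono; rewrite leNgt (le_lt_trans sv).
pose r := sup S.
have r0 : 0 < r.
  have [s Ss] := S0; apply: lt_le_trans Ss.1 _; exact: sup_upper_bound.
exists r => //; rewrite -/mu WE; congr EFin; apply/eqP; rewrite eq_le; apply/andP; split.
  rewrite leNgt; apply/negP => vr.
  have [||l l1 lv] := @exists_scaling R n.+1 v ((v + W r) / 2); [by []|lra|].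
  have l0 : 0 < l by lra.
  have e0 : 0 < r - r / l by rewrite subr_gt0 ltr_pdivrMr// ltr_pMr.
  have [s [s0 sv] rs] := sup_adherent e0 Sub.
  have rls : r <= l * s.
    by move: rs; rewrite -/r opprB addrCA subrr addr0 ltr_pdivrMr// mulrC => /ltW.
  have h1 := W_mono _ _ rls; have h2 := W_dil s l (ltW l1) s0.
  have h3 : l ^+ n.+1 * W s <= l ^+ n.+1 * v by rewrite ler_pM2l// exprn_gt0.
  lra.
rewrite leNgt; apply/negP => vr.
have [||l l1 lv] := @exists_scaling R n.+1 ((W r + v) / 2) v; [by have := W0 r; lra|lra|].
have l0 : 0 < l by lra.
have : l * r <= r.
  apply: sup_upper_bound => //; split; first by rewrite mulr_gt0.
  apply: le_trans (W_dil r l (ltW l1) r0) _; apply: le_trans lv.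
  by rewrite ler_pM2l ?exprn_gt0//; lra.
by rewrite leNgt ltr_pMl// l1.
Qed.

End Lines.

Section SmallPoint.
Variable n : nat.
Local Notation V := 'rV[R]_n.+2.
Local Notation mu := (lebesgue R n.+1).
Implicit Types (x y z c p a u : V) (A C K Y : set V).

(** Dimension at least 2 provides a second coordinate to rotate into. *)
Lemma exists_orthogonal a : exists2 u : V, u != 0 & dotp a u = 0.
Proof.
pose i0 : 'I_n.+2 := ord0; pose i1 : 'I_n.+2 := lift ord0 ord0.
have d0 (i : 'I_n.+2) : delta_mx 0 i != 0 :> V.
  by rewrite -enorm_gt0 enorm_delta.
have [a0|a0] := eqVneq (a 0 i0) 0.
  by exists (delta_mx 0 i0) => //; rewrite dotp_delta.
exists (a 0 i1 *: delta_mx 0 i0 - a 0 i0 *: delta_mx 0 i1).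
  apply/eqP => /rowP /(_ i1); rewrite !mxE !eqxx /= mulr0 mulr1 add0r => /eqP.
  by rewrite oppr_eq0 (negPf a0).
by rewrite dotpBr !dotpZr !dotp_delta mulrC subrr.
Qed.

Lemma exists_small_point C : convex_body C -> C <> setT -> ~ half_space C ->
  (forall K, asymptotic_cylinder C K -> half_space K \/ K = setT) ->
  exists2 p, C p & forall r : R, 0 < r ->
    (mu (C `&` eclosed_ball p r) < (half_ball_const R n * r ^+ n.+2)%:E)%E.
Proof.
move=> [cC cvC [q0 /interior_subset Cq0]] CT nhC cyl.
have [z nCz] : exists z, ~ C z.
  apply: contrapT => h; apply: CT; apply/seteqP; split=> // x _.
  by apply: contrapT => nCx; apply: h; exists x.
have [p0 [Cp0 _ sep]] := separation z cC cvC (ex_intro _ q0 Cq0).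
pose a := z - p0.
have a0 : a != 0 by rewrite subr_eq0; apply/eqP => zp; apply: nCz; rewrite zp.
have ea : 0 < enorm a by rewrite enorm_gt0.
have [u u0 au] := exists_orthogonal a.
have [t0 nCt] : exists t : R, ~ C (p0 + t *: u).
  apply: contrapT => h.
  have Cl t : C (p0 + t *: u) by apply: contrapT => nC; apply: h; exists t.
  have [/half_space_translate//|/translate_setT//] := cyl _ (line_asymptotic_cylinder cC cvC u0 Cl).
have [t [tge0 t1 Ct tlast]] := last_point cC Cp0 nCt.
pose w := t0 *: u; pose p := p0 + t *: w.
have aw : dotp a w = 0 by rewrite dotpZr au mulr0.
have ap s : dotp a (p0 + s *: w) = dotp a p0 by rewrite dotpDr dotpZr aw mulr0 addr0.
have CH x : C x -> dotp a x <= dotp a p.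
  by move=> Cx; have := sep x Cx; rewrite -/a dotpBr subr_le0 ap.
exists p => // r r0.
(* Just beyond the last point of [C] on the segment: [q] is outside [C], still in the boundary
   hyperplane, and within [r / 2] of [p]. *)
pose s := Num.min 1 (t + r / 2 / (enorm w + 1)).
have ew : 0 < enorm w + 1 by rewrite ltr_wpDl// enorm_ge0.
have ts : t < s by rewrite lt_min t1 ltrDl !divr_gt0.
have s1 : s <= 1 by rewrite ge_min lexx.
pose q := p0 + s *: w.
have qp : enorm (q - p) <= r / 2.
  rewrite (_ : q - p = (s - t) *: w); last by apply/rowP => i; rewrite !mxE; ring.
  rewrite enormZ ger0_norm ?subr_ge0 ?(ltW ts)//.
  have h : s - t <= r / 2 / (enorm w + 1) by rewrite lerBlDl ge_min lexx orbT.
  apply: (@le_trans _ _ (r / 2 / (enorm w + 1) * (enorm w + 1))); last by rewrite divfK// gt_eqF.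
  by apply: ler_pM => //; rewrite ?subr_ge0 ?(ltW ts) ?enorm_ge0 ?lerDl.
have [e e0 eC] : exists2 e : R, 0 < e & eball q e `<=` ~` C.
  apply/nbhs_eball; apply: open_nbhs_nbhs; split; first exact: closed_openC.
  exact: tlast.
pose d := Num.min (e / 3) (r / 4).
have d0 : 0 < d by rewrite lt_min !divr_gt0.
have de : d <= e / 3 by rewrite ge_min lexx.
have dr : d <= r / 4 by rewrite ge_min lexx orbT.
(* Pushing [q] inwards by [d] puts the ball of radius [d] around [q'] in the half-space;
   [d <= e / 3] keeps it off [C], and [d <= r / 4] keeps it in the ball of radius [r] around [p]. *)
pose q' := q - (d / enorm a) *: a.
have q'q : enorm (q' - q) = d.
  rewrite /q' addrAC subrr add0r enormN enormZ ger0_norm ?divr_ge0 ?(ltW d0) ?enorm_ge0//.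
  by rewrite divfK// gt_eqF.
have q'C : eclosed_ball q' d `&` C = set0.
  apply/seteqP; split=> // x [xq' Cx]; apply: (eC x) => //; rewrite /eball/= /eclosed_ball/= in xq' *.
  by have := enorm_trans q' x q; lra.
have q'H : eclosed_ball q' d `<=` [set x | dotp a x <= dotp a p] `&` eclosed_ball p r.
  move=> x; rewrite /eclosed_ball/= => xq'; split; last first.
    by have := enorm_trans q' x p; have := enorm_trans q q' p; rewrite /eclosed_ball/=; lra.
  have aq' : dotp a q' = dotp a p0 - d / enorm a * enorm a ^+ 2.
    by rewrite dotpBr ap dotpZr -enormE.
  rewrite /= -[x](subrK q') (dotpDr a (x - q')) aq' ap.
  have h1 : dotp a (x - q') <= enorm a * d.
    by apply: le_trans (dotp_le _ _) _; rewrite ler_pM2l.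
  have h2 : d / enorm a * enorm a ^+ 2 = d * enorm a.
    by rewrite expr2 mulrA divfK// gt_eqF.
  lra.
have mq' : lebesgue_measurable (eclosed_ball q' d).
  by apply: closed_lebesgue_measurable; exact: closed_eclosed_ball.
have mC : lebesgue_measurable (C `&` eclosed_ball p r).
  by apply: closed_lebesgue_measurable; apply: closedI => //; exact: closed_eclosed_ball.
have finC : mu (C `&` eclosed_ball p r) \is a fin_num.
  rewrite ge0_fin_numE//; apply: le_lt_trans (outer_lebesgue_ball_fin p r).
  by apply: le_outer_lebesgue => x [].
apply: lt_le_trans (outer_lebesgue_half_ball_at p a0 r0).
apply: (@lt_le_trans _ _ (mu (C `&` eclosed_ball p r) + mu (eclosed_ball q' d))%E).
  by rewrite lteDl//; exact: outer_lebesgue_ball_gt0.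
rewrite -measureU; [|exact: mC|exact: mq'|].
  by apply: le_outer_lebesgue => x [[Cx xr]|/q'H//]; split=> //; exact: CH.
apply/seteqP; split=> // x [[Cx _] xq'].
by have : set0 x by rewrite -q'C.
Qed.

End SmallPoint.
End PointAndRadius.

(** * Comparison *)

Section Comparison.
Variables (R : realType) (n : nat).
Local Notation V := 'rV[R]_n.+2.
Local Notation mu := (lebesgue R n.+1).
Implicit Types (x y z c p a u : V) (A C K E : set V).

Lemma test_fieldS A C xi : A `<=` C -> test_field A xi -> test_field C xi.
Proof.
move=> AC [sxi cxi suppA xi1]; split=> //.
by apply: subset_trans suppA _; exact: interiorS.
Qed.

(** The strict bound on [v] allows a radius [rho < r] at which the half ball still has larger volume
    than [E], and N v / rho is strictly larger than N v / r. *)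
Lemma half_space_isoperimetric K E (v r : R) : half_space K \/ K = setT ->
  lebesgue_measurable E -> E `<=` K -> mu E = v%:E -> 0 < v -> 0 < r ->
  v < half_ball_const R n * r ^+ n.+2 ->
  ((n.+2%:R / r * v)%:E < relative_perimeter K E)%E.
Proof.
move=> hK mE EK muE v0 r0 vr; set k := half_ball_const R n in vr.
have [||l l1 lv] := @exists_scaling R n.+2 ((v + k * r ^+ n.+2) / 2) (k * r ^+ n.+2).
- by lra.
- by lra.
have l0 : 0 < l by lra.
pose rho := r / l; have rho0 : 0 < rho by rewrite divr_gt0.
have rho_r : rho < r by rewrite ltr_pdivrMr// ltr_pMr.
have vrho : v < k * rho ^+ n.+2.
  rewrite /rho expr_div_n mulrA ltr_pdivlMr ?exprn_gt0// mulrC.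
  apply: lt_le_trans lv; rewrite ltr_pM2l ?exprn_gt0//; lra.
have Nr : n.+2%:R / r * v < n.+2%:R / rho * v.
  by rewrite ltr_pM2r// ltr_pM2l// ltf_pV2 ?posrE.
(* Halfway between the two bounds: room below for strictness, room above for the loss of volume when
   [K] is the whole space. *)
pose c := (n.+2%:R / r * v + n.+2%:R / rho * v) / 2.
have c1 : n.+2%:R / r * v < c by rewrite /c; lra.
have c2 : c < n.+2%:R / rho * v by rewrite /c; lra.
have Efin : (mu E < +oo)%E by rewrite muE ltry.
suff [a [b [a0 HK Hv Hc]]] : exists a (b : R), [/\ a != 0, [set x | dotp a x <= b] `<=` K,
    (mu (E `&` [set x | (dotp a x <= b)%R]) <= v%:E)%E &
    (c%:E < (n.+2%:R / rho)%:E * mu (E `&` [set x | (dotp a x <= b)%R]))%E].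
  have [|xi xiT hxi] := half_space_perimeter mE Efin a0 rho0 _ Hc.
    by apply: le_lt_trans Hv _; rewrite lte_fin.
  apply: (@lt_le_trans _ _ c%:E); first by rewrite lte_fin.
  apply: le_trans hxi _; apply: ereal_sup_ubound; exists xi => //.
  exact: test_fieldS xiT.
have [[a [b [a0 KE]]]|KT] := hK.
  by exists a, b; rewrite -KE (setIidl EK) muE -EFinM lte_fin; split.
(* In the whole space, a half-space containing almost all of [E] takes the place of [K]; its test
   fields are admissible there. *)
pose a : V := delta_mx 0 0.
have a0 : a != 0 by rewrite -enorm_gt0 enorm_delta.
pose F (j : nat) := E `&` [set x | dotp a x <= j%:R].
have mF j : lebesgue_measurable (F j).
  apply: measurableI => //; apply: closed_lebesgue_measurable.
  rewrite (_ : [set x | _] = dotp a @^-1` [set t | t <= j%:R])//.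
  by apply: closed_comp => [x _|]; [exact: continuous_dotpl|exact: closed_le].
have F_mono : {homo F : i j / (i <= j)%N >-> (i <= j)%O}.
  move=> i j ij; apply/subsetPset => x [Ex xi]; split=> //.
  by apply: le_trans xi _; rewrite ler_nat.
have FE : \bigcup_j F j = E.
  apply/seteqP; split=> [x [j _ []]//|x Ex]; exists (Num.trunc `|dotp a x|).+1 => //; split=> //=.
  by apply: le_trans (ler_norm _) _; apply: ltW; exact: truncnS_gt.
have cvgF := @nondecreasing_cvg_mu _ _ _ mu F mF _ F_mono.
rewrite FE in cvgF.
have cv : c / (n.+2%:R / rho) < v by rewrite ltr_pdivrMr ?divr_gt0// mulrC.
have [j hj] : exists j, ((c / (n.+2%:R / rho))%:E < mu (F j))%E.
  have : nbhs (mu E) [set z | ((c / (n.+2%:R / rho))%:E < z)%E].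
    apply: open_nbhs_nbhs; split; first exact: open_ereal_gt_ereal.
    by move: cv; rewrite -lte_fin -muE.
  by move=> /(cvgF mE) [j _ hj]; exists j; apply: hj => /=.
have Fv : (mu (F j) <= v%:E)%E by rewrite -muE; apply: le_outer_lebesgue => x [].
exists a, j%:R; split=> //; first by rewrite KT.
have Ffin : mu (F j) \is a fin_num.
  by rewrite ge0_fin_numE// (le_lt_trans Fv)// ltry.
rewrite -/(F j) -(fineK Ffin) -EFinM lte_fin.
by move: hj; rewrite -(fineK Ffin) lte_fin ltr_pdivrMr ?divr_gt0// mulrC.
Qed.

(** The distance [enorm (z - p)] from a point [z] outside [K] to [K] bounds from below the Hausdorff
    distances in a ball around [p] containing [z]. *)
Lemma asymptotic_cylinder_setT K : asymptotic_cylinder setT K -> K = setT.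
Proof.
move=> [cK cvK K0 [x_ [_ _ Kcvg]]]; apply/seteqP; split=> // z _.
apply: contrapT => nKz; have [p [Kp pmin _]] := separation z cK cvK K0.
have e0 : 0 < enorm (z - p).
  by rewrite enorm_gt0 subr_eq0; apply/eqP => zp; apply: nKz; rewrite zp.
have pB : K `&` eball p (enorm (z - p) + 1) !=set0.
  by exists p; split=> //; rewrite /eball/= subrr enorm0; lra.
have : nbhs (0 : \bar R)%E [set t | (t < (enorm (z - p))%:E)%E].
  by apply: open_nbhs_nbhs; split; [exact: open_ereal_lt_ereal|rewrite /= lte_fin].
move=> /(Kcvg _ _ pB)[i _ /(_ i (leqnn i))] /=; rewrite ltNge => /negP; apply.
apply: le_ereal_inf_tmp => _ [s [s0 hs _] <-]; rewrite lee_fin.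
have [|y [Ky _] zy] := hs z; last exact: le_trans (pmin y Ky) zy.
split; first by exists (x_ i + z); rewrite // addKr.
by rewrite /eclosed_ball/= lerDl.
Qed.

End Comparison.

Theorem theorem6p21 (R : realType) (n : nat) (n_ge1 : (1 <= n)%N)
    (C : set 'rV[R]_n.+1)
    (C_body : convex_body C)
    (C_unbounded : ~ bounded_set C)
    (C_not_half_space : ~ half_space C)
    (C_cylinders : forall K : set 'rV[R]_n.+1,
      asymptotic_cylinder C K -> half_space K \/ K = setT) :
  uniform_geometry C /\
  forall (v : R) (K E : set 'rV[R]_n.+1), 0 < v ->
    generalized_isoperimetric_region C v K E -> K = C.
Proof.
have UG := cylinders_uniform_geometry C_body C_unbounded C_cylinders.
split=> // v K E v0 [[//|Kcyl] mE EK muE PE].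
(* From [1 <= n] the dimension has the form [m.+2], as the choice of a line in the supporting
   hyperplane requires. *)
case: n n_ge1 C C_body C_unbounded C_not_half_space C_cylinders UG K E Kcyl mE EK muE PE => [//|m] _
  C CB _ nhC cyl UG K E Kcyl mE EK muE PE.
have [CT|CT] := pselect (C = setT).
  by rewrite CT in Kcyl *; exact: asymptotic_cylinder_setT.
have [cC cvC _] := CB.
have [p Cp pr] := exists_small_point CB CT nhC cyl.
have [r r0 rv] := exists_radius cC cvC Cp v0 UG.
have vr : v < half_ball_const R m * r ^+ m.+2 by rewrite -lte_fin -rv; exact: pr.
have lower := half_space_isoperimetric (cyl K Kcyl) mE EK muE v0 r0 vr.
have upper := ball_section_perimeter cC cvC Cp r0.
rewrite rv -EFinM in upper.
have : (isoperimetric_profile C v <= relative_perimeter C (C `&` eclosed_ball p r))%E.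
  apply: ereal_inf_lbound; exists (C `&` eclosed_ball p r) => //; split=> //.
  by apply: closed_lebesgue_measurable; apply: closedI => //; exact: closed_eclosed_ball.
by rewrite -PE => /le_trans /(_ upper); rewrite leNgt lower.
Qed.
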